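(* Let $X_1,X_2,\dots$ be i.i.d. with $\mathbf{E}X_1=-a<0$ and $\mathrm{Var}(X_1)<\infty$. Assume $\overline F(x)\sim e^{-g(x)}x^{-2}$ as $x\to\infty$, where $g:(0,\infty)\to\mathbb{R}$ is continuously differentiable, nondecreasing for all sufficiently large $x$, and such that $x\mapsto g(x)/x$ is nonincreasing on $(0,\infty)$ with $g(x)/x\to0$. Then: (i) there exists a constant $C>0$ such that for all sufficiently large $x$, \[ \mathbf{P}(A_\tau>x)\le Cx^{1/4}\exp\left\{-g(\sqrt{2ax})\sqrt{1-\frac{2Cg(\sqrt{2ax})}{a\sqrt{2ax}}}\right\}; \] (ii) for every $\varepsilon>0$ there exists $C>0$ such that \[ \liminf_{x\to\infty}\frac{\mathbf{P}(A_\tau>x)}{\overline F(\sqrt{2ax}+Cx^{1/4+\varepsilon})}\ge\mathbf{E}\tau; \] (iii) if moreover there is $\gamma_0\in(0,1)$ such that $x\mapsto g(x)/x^{\gamma_0}$ is nonincreasing on $(0,\infty)$ with $g(x)/x^{\gamma_0}\to0$, then \[ \lim_{x\to\infty}\frac{\ln\mathbf{P}(A_\tau>x)}{\ln\overline F(\sqrt{2ax})}=1. \]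
   Context: $S_0=0$, $S_n=X_1+\dots+X_n$, $\overline F(x)=\mathbf{P}(X_1>x)$, $\tau=\min\{n\ge1:S_n\le0\}$, $A_\tau=\sum_{k=0}^{\tau-1}S_k$. *)

(* Defs.v *)
From HB Require Import structures.
From mathcomp Require Import all_boot all_order all_algebra.
From mathcomp Require Import all_classical all_reals all_analysis.
Set Implicit Arguments. Unset Strict Implicit. Unset Printing Implicit Defensive.
Import Order.TTheory GRing.Theory Num.Theory.
Import numFieldNormedType.Exports.
Local Open Scope classical_set_scope.
Local Open Scope ring_scope.

Section Defs.
Context {d : measure_display} {T : measurableType d} {R : realType}.
Variable (P : probability T R).

(* X i is the (i+1)-th summand X_{i+1} of the paper. *)

Definition mutually_independent (X : nat -> {RV P >-> R}) : Prop :=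
  forall (I : seq nat) (B : nat -> set R), uniq I ->
    (forall i, measurable (B i)) ->
    P (\bigcap_(i in [set` I]) (X i @^-1` B i)) = (\prod_(i <- I) P (X i @^-1` B i))%E.

Definition identically_distributed (X : nat -> {RV P >-> R}) : Prop :=
  forall n (B : set R), measurable B -> distribution P (X n) B = distribution P (X 0) B.

Definition iid (X : nat -> {RV P >-> R}) : Prop :=
  mutually_independent X /\ identically_distributed X.

Definition Ssum (X : nat -> {RV P >-> R}) (n : nat) (w : T) : R :=
  \sum_(i < n) X i w.

Definition Fbar (X : nat -> {RV P >-> R}) (x : R) : R :=
  fine (P [set w | x < X 0 w]).

Definition tau_opt (X : nat -> {RV P >-> R}) (w : T) : option nat :=
  match pselect (exists n, (1 <= n)%N && (Ssum X n w <= 0)) with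
  | left h => Some (ex_minn h)
  | right _ => None
  end.

Definition tau (X : nat -> {RV P >-> R}) (w : T) : \bar R :=
  if tau_opt X w is Some n then (n%:R)%:E else +oo%E.

Definition Atau (X : nat -> {RV P >-> R}) (w : T) : \bar R :=
  if tau_opt X w is Some n then (\sum_(k < n) Ssum X k w)%:E else +oo%E.

Definition PAtau_gt (X : nat -> {RV P >-> R}) (x : R) : R :=
  fine (P [set w | (x%:E < Atau X w)%E]).

Definition Etau (X : nat -> {RV P >-> R}) : \bar R := (\int[P]_w tau X w)%E.

End Defs.

(* Main.v *)
Require Import Defs.
From HB Require Import structures.
From mathcomp Require Import all_boot all_order all_algebra.
From mathcomp Require Import all_classical all_reals all_analysis.
From mathcomp Require Import measurable_realfun ring lra zify.
Import Order.TTheory GRing.Theory Num.Theory.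
Import numFieldNormedType.Exports.
Local Open Scope classical_set_scope.
Local Open Scope ring_scope.
Set Implicit Arguments. Unset Strict Implicit. Unset Printing Implicit Defensive.

(** Write [y = sqrt (2 a x)]: a jump to height [y] followed by a descent at speed [a]
    sweeps the area [y ^ 2 / (2 a) = x].

    Upper bound. As [g t / t] decreases, [e ^ (l t) Fbar t <= 2 / t ^ 2] for
    [l <= g y / y] and [t <= y], so the exponential moment of an increment truncated at
    [y] is at most [exp (- a l + C l ^ 2)].  The area of an excursion of length about [N]
    is at most [sum_i (N - 1 - i) X_i]; tilting the [i]-th increment by
    [(lam / N) (N - 1 - i)] with [lam = g y / y] bounds its tail by
    [exp (- lam (x / N + a N / 2 - C lam N))], which is minimised over [N] by the
    inequality of arithmetic and geometric means.  A maximal inequality treats all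
    lengths in a window of width of order [x ^ (1/4)] at once at the cost of a constant,
    whence the factor [x ^ (1/4)].

    Lower bound. A jump above [y + 2 x ^ (1/4 + eps)] before [tau], followed by
    fluctuations below [x ^ (1/4 + eps)] around the drift (Kolmogorov's maximal
    inequality), forces [A_tau > x]; the times at which this jump may occur contribute
    [sum_k P (tau > k) = E tau].

    Logarithmic asymptotics. If [g y] is much larger than [ln y], the upper bound above
    suffices.  Otherwise its polynomial prefactor matters: the excursion is then cut at
    its first jump larger than a small multiple of [y].  Before that jump the walk stays low up to a
    polynomially negligible event, the jump occurs before [tau] (which costs only
    [sum_k P (tau > k) = O (ln y)]), and the tilted bound applies after it. *)

(** * Independence of blocks of increments *)

(** Windows of width [W] cost an area [a W ^ 2 / 2], which changes [2 sqrt (x (a / 2 - C lam))] by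
    order [W ^ 2 / sqrt x]. So [W] of order [x ^ (1/4)] is the largest width with a bounded loss,
    and about [sqrt x / W] windows remain. The root in the exponent of (i) is the same quantity: it
    equals [y sqrt (1 - 2 C lam / a)] with [lam = g y / y]. In (iii) the obstacle is the factor
    [y ^ -2] of [Fbar y]: when [g y] is at most of order [ln y] it counts on the logarithmic scale,
    yet the tilted area bound does not see it. It can only come from one jump of order [y], which is
    why the excursion is cut at a fixed fraction of [y]. The windows are then proportional to [y]:
    their number is constant, and the area they lose is a small fraction of [x], harmless since a
    small relative loss in [g y] is allowed. Before the cut the tilt is of order [ln y / y] instead
    of [g y / y], because [g] alone may be too small to give any polynomial decay. *)

Section Independence.
Context {d : measure_display} {T : measurableType d} {R : realType}.
Variable (P : probability T R).
Implicit Types (X : nat -> {RV P >-> R}) (I J : set nat).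

Definition pr (E : set T) : R := fine (P E).

Definition generators X I : set (set T) :=
  [set E | exists2 i, I i & exists2 B, measurable B & E = X i @^-1` B].

(** A pi-system generating the sigma-algebra of the block, on which [mutually_independent] is
    directly the product rule; the empty list gives [setT]. *)
Definition cylinders X I : set (set T) :=
  [set E | exists s (B : nat -> set R), [/\ uniq s, (forall i, i \in s -> I i),
     (forall i, measurable (B i)) & E = \bigcap_(i in [set` s]) (X i @^-1` B i)]].

Lemma measurable_preimageX X i (B : set R) : measurable B -> measurable (X i @^-1` B).
Proof. exact: measurable_funPTI. Qed.

Lemma cylinders_measurable X I : cylinders X I `<=` measurable.
Proof.
move=> _ [s [B [us sI mB ->]]]; apply: fin_bigcap_measurable => [|i _].
  exact: finite_seq.
exact: measurable_preimageX.
Qed.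

Lemma cylinders_setI X I : setI_closed (cylinders X I).
Proof.
move=> _ _ [s [B [us sI mB ->]]] [t [C [ut tI mC ->]]].
exists (undup (s ++ t)), (fun i => (if i \in s then B i else setT) `&`
  (if i \in t then C i else setT)); split.
- exact: undup_uniq.
- by move=> i; rewrite mem_undup mem_cat => /orP[/sI|/tI].
- by move=> i; apply: measurableI; case: ifP.
- apply/seteqP; split=> [w [/= sw tw] i /= _|w /= stw].
    by split; case: ifPn => // ?; [exact: sw|exact: tw].
  split=> i /= ii; have /= := stw i; rewrite mem_undup mem_cat ii ?orbT => /(_ isT)[].
    by [].
  by [].
Qed.

Lemma generators_sub_cylinders X I : generators X I `<=` cylinders X I.
Proof.
move=> _ [i Ii [B mB ->]]; exists [:: i], (fun _ => B); split => //.
  by move=> j; rewrite inE => /eqP ->.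
apply/seteqP; split=> [w Bw j /=|w /(_ i)]; last by apply; rewrite /= inE.
by rewrite inE => /eqP ->.
Qed.

Lemma sigma_cylinders X I A : <<s generators X I >> A -> <<s cylinders X I >> A.
Proof. apply: sub_smallest2r; [exact: smallest_sigma_algebra|exact: generators_sub_cylinders]. Qed.

Lemma sigma_measurable X I A : <<s generators X I >> A -> measurable A.
Proof.
apply: smallest_sub; first exact: sigma_algebra_measurable.
by move=> _ [i _ [B mB ->]]; exact: measurable_preimageX.
Qed.

(** Both sides are finite measures in [A]; they agree on the pi-system [G], which contains [setT],
    hence on the sigma-algebra it generates. *)
Lemma product_rule_extend (G : set (set T)) (C : set T) :
  G `<=` measurable -> setI_closed G -> G setT -> measurable C ->
  (forall A, G A -> P (A `&` C) = (P A * P C)%E) ->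
  forall A, <<s G >> A -> P (A `&` C) = (P A * P C)%E.
Proof.
move=> Gm GI GT mC GC A sA.
have PC0 : 0 <= fine (P C) by rewrite fine_ge0.
have cT : \bigcup_(_ : nat) [set: T] = setT by apply/seteqP; split => // w _; exists 0%N.
have fC : (fine (P C))%:E = P C by rewrite fineK// fin_num_measure.
have E B : mscale (NngNum PC0) P B = (P B * P C)%E by rewrite /mscale [X in (X * _)%E]fC muleC.
rewrite -E -[LHS]/(mrestr P mC A).
apply: (@g_sigma_algebra_measure_unique _ _ _ G Gm (fun=> setT) (fun=> GT) cT) => //.
- by move=> B GB; rewrite [RHS]E -GC.
- by move=> _; rewrite /= /mrestr setTI ltey_eq fin_num_measure.
Qed.

Lemma cylinders_setT X I : cylinders X I setT.
Proof.
exists [::], (fun=> setT); split => //.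
by apply/seteqP; split.
Qed.

Lemma cylinders_independent X I J : mutually_independent X -> I `&` J = set0 ->
  forall A B, cylinders X I A -> cylinders X J B -> P (A `&` B) = (P A * P B)%E.
Proof.
move=> iX IJ _ _ [s [B [us sI mB ->]]] [t [C [ut tI mC ->]]].
have dj i : i \in s -> i \in t -> False.
  by move=> /sI Ii /tI Ji; have : (I `&` J) i by []; rewrite IJ.
pose D i := if i \in s then B i else C i.
have mD i : measurable (D i) by rewrite /D; case: ifP.
have := iX (s ++ t) D.
rewrite cat_uniq us ut /= andbT => /(_ _ mD) stP.
have -> : (\bigcap_(i in [set` s]) X i @^-1` B i) `&` (\bigcap_(i in [set` t]) X i @^-1` C i)
   = \bigcap_(i in [set` (s ++ t)]) (X i @^-1` D i).
  apply/seteqP; split=> [w [/= sw tw] i /=|w /= stw].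
    rewrite mem_cat /D => /orP[is_|it]; first by rewrite is_; exact: sw.
    by case: ifPn => [/dj/(_ it)//|_]; exact: tw.
  split=> i /= ii; have /= := stw i; rewrite mem_cat ii ?orbT => /(_ isT); rewrite /D.
    by rewrite ii.
  by case: ifPn => // /dj/(_ ii).
rewrite stP; last by apply/hasPn => i it; apply/negP => /dj/(_ it).
rewrite big_cat /= iX// iX//; congr (_ * _)%E; rewrite big_seq [RHS]big_seq;
  apply: eq_bigr => i ii; rewrite /D ?ii//.
by case: ifPn => // /dj/(_ ii).
Qed.

(** One side is extended at a time: over [J] against a fixed cylinder of [I], then over [I] against
    a fixed event of the [J]-algebra. *)
Lemma sigma_independent X I J : mutually_independent X -> I `&` J = set0 ->
  forall A B, <<s generators X I >> A -> <<s generators X J >> B ->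
  P (A `&` B) = (P A * P B)%E.
Proof.
move=> iX IJ A B sA sB.
apply: (product_rule_extend (@cylinders_measurable X I)) => //.
- exact: cylinders_setI.
- exact: cylinders_setT.
- exact: sigma_measurable sB.
- move=> C IC; rewrite setIC muleC.
  apply: (product_rule_extend (@cylinders_measurable X J)) => //.
  + exact: cylinders_setI.
  + exact: cylinders_setT.
  + exact: cylinders_measurable IC.
  + by move=> D JD; rewrite setIC muleC; exact: (cylinders_independent iX IJ).
  + exact: sigma_cylinders.
- exact: sigma_cylinders.
Qed.

(** Expressed through the type alias that carries the sigma-algebra of the block, so that the
    closure lemmas for measurable functions apply unchanged. *)
Definition adapted X I (f : T -> R) :=
  measurable_fun [set: g_sigma_algebraType (generators X I)]
    (f : g_sigma_algebraType (generators X I) -> R).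

Lemma adaptedX X I i : I i -> adapted X I (X i).
Proof.
move=> Ii _ B mB; rewrite setTI; apply: sub_sigma_algebra.
by exists i => //; exists B.
Qed.

Lemma adapted_preimage X I f (B : set R) : adapted X I f -> measurable B ->
  <<s generators X I >> (f @^-1` B).
Proof. by move=> mf mB; rewrite -[f @^-1` B]setTI; exact: mf. Qed.

Lemma adapted_measurable X I f : adapted X I f -> measurable_fun setT f.
Proof.
move=> mf _ B mB; rewrite setTI.
exact: sigma_measurable (adapted_preimage mf mB).
Qed.

Lemma adapted_sum X I n (f : nat -> T -> R) :
  (forall i, (i < n)%N -> adapted X I (f i)) ->
  adapted X I (fun w => \sum_(i < n) f i w).
Proof.
elim: n => [|n IH] mf.
  by under [X in adapted _ _ X]eq_fun do rewrite big_ord0; exact: measurable_cst.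
under [X in adapted _ _ X]eq_fun do rewrite big_ord_recr.
apply: measurable_funD; last exact: mf.
by apply: IH => i ni; apply: mf; rewrite ltnS ltnW.
Qed.

Lemma adapted_Ssum X n : adapted X [set k | (k < n)%N] (Ssum X n).
Proof. by apply: (@adapted_sum _ _ _ (fun i => X i)) => i ni; exact: adaptedX. Qed.

(** The joint law of [(U, V)] is a product law, by [sigma_independent] on rectangles, and Tonelli
    applies. This replaces conditioning on the past: [U] is frozen while the next increment is
    integrated out. *)
Lemma independent_integral X I J (U V : T -> R) (f : R * R -> \bar R) :
  mutually_independent X -> I `&` J = set0 -> adapted X I U -> adapted X J V ->
  measurable_fun setT f -> (forall z, (0 <= f z)%E) ->
  (\int[P]_w f (U w, V w) = \int[P]_w \int[P]_v f (U w, V v))%E.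
Proof.
move=> iX IJ aU aV mf f0.
have mU := adapted_measurable aU; have mV := adapted_measurable aV.
pose U' := mfun_Sub (mem_set mU); pose V' := mfun_Sub (mem_set mV).
have mUV : measurable_fun setT (fun w => (U w, V w)) by exact: measurable_fun_pair.
pose W' := mfun_Sub (mem_set mUV).
transitivity (\int[distribution P W']_z f z)%E.
  by rewrite ge0_integral_distribution.
transitivity (\int[(distribution P U' \x distribution P V')%E]_z f z)%E.
  apply: eq_measure_integral => A mA _; apply/esym.
  apply: product_measure_unique => // B C mB mC.
  rewrite /distribution /= /pushforward /=.
  apply: (sigma_independent iX IJ); exact: adapted_preimage.
rewrite fubini_tonelli1// ge0_integral_distribution//; last first.
- by move=> z; apply: integral_ge0.
- exact: measurable_fun_fubini_tonelli_F.
apply: eq_integral => w _ /=; rewrite /fubini_F ge0_integral_distribution//.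
exact: measurableT_comp.
Qed.

End Independence.

(** * Maximal inequalities *)

Lemma eq_implies_le disp (T : porderType disp) (x y : T) : x = y -> (x <= y)%O.
Proof. by move->. Qed.

Section MeasurableComparisons.
Context {d : measure_display} {T : measurableType d} {R : realType}.
Variables f g : T -> R.
Hypotheses (mf : measurable_fun setT f) (mg : measurable_fun setT g).

Lemma measurable_lt_set : measurable [set w | f w < g w].
Proof.
have := measurable_fun_ltr mf mg measurableT (Y := [set true]).
by rewrite setTI; apply.
Qed.

Lemma measurable_le_set : measurable [set w | f w <= g w].
Proof.
have := measurable_fun_ler mf mg measurableT (Y := [set true]).
by rewrite setTI; apply.
Qed.

End MeasurableComparisons.

Section Probabilities.
Context {d : measure_display} {T : measurableType d} {R : realType}.
Variable (P : probability T R).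
Implicit Types (A B : set T).

Lemma prE A : measurable A -> P A = (pr P A)%:E.
Proof. by move=> mA; rewrite /pr fineK// fin_num_measure. Qed.

Lemma pr_ge0 A : 0 <= pr P A.
Proof. by rewrite /pr fine_ge0. Qed.

Lemma pr_le1 A : measurable A -> pr P A <= 1.
Proof. by move=> mA; rewrite -lee_fin -prE// probability_le1. Qed.

Lemma pr_le A B : measurable A -> measurable B -> A `<=` B -> pr P A <= pr P B.
Proof. by move=> mA mB AB; rewrite -lee_fin -!prE// le_measure// inE. Qed.

Lemma pr_setU A B : measurable A -> measurable B ->
  pr P (A `|` B) <= pr P A + pr P B.
Proof.
move=> mA mB; have mU := measurableU _ _ mA mB.
by rewrite -lee_fin EFinD -!prE// measureU2.
Qed.

Lemma pr_setC A : measurable A -> pr P (~` A) = 1 - pr P A.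
Proof.
move=> mA; apply: EFin_inj; rewrite -prE ?EFinB -?prE//; last exact: measurableC.
exact: probability_setC.
Qed.

Lemma pr_cover (I : Type) (s : seq I) (F : I -> set T) A :
  measurable A -> (forall i, measurable (F i)) ->
  A `<=` \big[setU/set0]_(i <- s) F i -> pr P A <= \sum_(i <- s) pr P (F i).
Proof.
move=> mA mF sub.
have mU t : measurable (\big[setU/set0]_(i <- t) F i).
  by apply: big_ind => //; exact: measurableU.
apply: le_trans (pr_le mA (mU s) sub) _.
elim: s {sub} => [|i s IH]; first by rewrite !big_nil /pr measure0.
by rewrite !big_cons; apply: le_trans (pr_setU _ _) _ => //; exact: lerD.
Qed.

Lemma pr_cover_ord n (F : nat -> set T) A :
  measurable A -> (forall i, measurable (F i)) ->
  (forall w, A w -> exists2 i, (i < n)%N & F i w) ->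
  pr P A <= \sum_(i < n) pr P (F i).
Proof.
move=> mA mF sub; apply: (pr_cover mA (F := fun i : 'I_n => F i)) => // w Aw.
have [i ni Fw] := sub w Aw.
rewrite -(@bigcup_mkord _ _ F); by exists i.
Qed.

Lemma pr_markov (f : T -> R) (L M : R) A : measurable_fun setT f -> 0 < L ->
  (forall w, 0 <= f w) -> measurable A -> A `<=` [set w | L <= f w] ->
  (\int[P]_w (f w)%:E <= M%:E)%E -> pr P A <= M / L.
Proof.
move=> mf L0 f0 mA sub iM.
have mB : measurable [set w | L <= f w].
  exact: measurable_le_set.
apply: le_trans (pr_le mA mB sub) _.
rewrite ler_pdivlMr// mulrC -lee_fin EFinM -prE//.
apply: le_trans iM.
have mf' : measurable_fun setT (EFin \o f) by exact/measurable_EFinP.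
apply: le_trans (le_trans (@le_integral_abse _ _ _ P setT measurableT (EFin \o f) L mf' L0) _).
  rewrite setTI; apply: eq_implies_le; congr (_ * P _)%E; apply/seteqP.
  by split=> w /=; rewrite ger0_norm ?lee_fin.
by apply: eq_implies_le; apply: eq_integral => w _ /=; rewrite ger0_norm.
Qed.

Lemma integral_constant (r : R) : (\int[P]_w r%:E = r%:E)%E.
Proof. by rewrite integral_cst//= probability_setT mule1. Qed.

End Probabilities.

Section MaximalInequality.
Context {d : measure_display} {T : measurableType d} {R : realType}.
Variable (P : probability T R).
Implicit Types (X : nat -> {RV P >-> R}) (I J : set nat).

Lemma adapted_sub X I J f : I `<=` J -> adapted X I f -> adapted X J f.
Proof.
move=> IJ aI _ B mB; rewrite setTI.
have := adapted_preimage aI mB; apply: sub_smallest2r.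
  exact: smallest_sigma_algebra.
by move=> _ [i Ii [C mC ->]]; exists i; [exact: IJ|exists C].
Qed.

Lemma below_above_disjoint n : [set k | (k < n)%N] `&` [set n] = set0.
Proof. by apply/seteqP; split=> // k [/= kn ek]; move: kn; rewrite ek ltnn. Qed.

(** Stopping the product when it first reaches [L] keeps its mean below [1], so Markov's
    inequality for the stopped product is a maximal inequality. *)
Fixpoint stopped_prod X (L : R) (phi : nat -> R -> R) n (w : T) : R :=
  if n is m.+1 then
    let v := stopped_prod X L phi m w in if L <= v then v else v * phi m (X m w)
  else 1.

Lemma stopped_prod_adapted X L (phi : nat -> R -> R) n : (forall i, measurable_fun setT (phi i)) ->
  adapted X [set k | (k < n)%N] (stopped_prod X L phi n).
Proof.
move=> mphi; elim: n => [|n IH] /=; first exact: measurable_cst.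
have IH' : adapted X [set k | (k < n.+1)%N] (stopped_prod X L phi n).
  by apply: adapted_sub IH => k /=; lia.
apply: measurable_fun_ifT => //.
  by apply: measurable_fun_ler => //; exact: measurable_cst.
apply: measurable_funM => //; apply: measurableT_comp => //.
exact: (@adaptedX _ _ _ _ X [set k | (k < n.+1)%N] n (ltnSn n)).
Qed.

Lemma stopped_prod_ge0 X L (phi : nat -> R -> R) n w : (forall i x, 0 <= phi i x) ->
  0 <= stopped_prod X L phi n w.
Proof. by move=> p0; elim: n => //= n IH; case: ifP => // _; exact: mulr_ge0. Qed.

Lemma integral_stopped_prod X L (phi : nat -> R -> R) n :
  mutually_independent X -> (forall i, measurable_fun setT (phi i)) ->
  (forall i x, 0 <= phi i x) ->
  (forall i, (i < n)%N -> (\int[P]_w (phi i (X i w))%:E <= 1)%E) ->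
  (\int[P]_w (stopped_prod X L phi n w)%:E <= 1)%E.
Proof.
move=> iX mphi p0; elim: n => [|n IH] pn /=.
  by rewrite integral_constant.
(* The absolute values make [f] nonnegative on the whole plane, as [independent_integral] requires;
   they change nothing on the values actually taken. *)
pose f (z : R * R) := (if L <= z.1 then `|z.1| else `|z.1| * `|z.2|)%:E.
have s0 m w : 0 <= stopped_prod X L phi m w by exact: stopped_prod_ge0.
pose U := stopped_prod X L phi n; pose V w := phi n (X n w).
have mf : measurable_fun setT f.
  apply/measurable_EFinP; apply: measurable_fun_ifT => //=.
  - by apply: measurable_fun_ler => //; exact: measurable_fst.
  - by apply: measurableT_comp => //; exact: measurable_fst.
  - by apply: measurable_funM; exact: measurableT_comp.
have mU : measurable_fun setT U.
  exact: adapted_measurable (stopped_prod_adapted _ _).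
have mV : measurable_fun setT V by apply: measurableT_comp => //; exact: measurable_funP.
rewrite (eq_integral (fun w => f (U w, V w))); last first.
  by move=> w _; rewrite /f /= !ger0_norm//; [exact: p0|exact: s0].
rewrite (independent_integral iX (below_above_disjoint n))//; first last.
- by move=> z; rewrite /f lee_fin; case: ifP => // _; rewrite mulr_ge0.
- by apply: measurableT_comp => //; exact: (@adaptedX _ _ _ _ X [set n] n).
- exact: stopped_prod_adapted.
apply: le_trans (IH _); last by move=> i ni; apply: pn; lia.
apply: ge0_le_integral => //.
- move=> w _; apply: integral_ge0 => v _.
  by rewrite /f lee_fin; case: ifP => // _; rewrite mulr_ge0.
- apply: (@measurableT_comp _ _ _ _ _ _ (fun u => \int[P]_v f (u, V v))%E) => //.
  apply: (@measurable_fun_fubini_tonelli_F _ _ _ _ _ P (fun z => f (z.1, V z.2))).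
    apply: measurableT_comp => //; apply: measurable_fun_pair; first exact: measurable_fst.
    by apply: measurableT_comp => //; exact: measurable_snd.
  by move=> z; rewrite /f lee_fin; case: ifP => // _; rewrite mulr_ge0.
- exact/measurable_EFinP.
move=> w _; rewrite /f /=; case: (L <= U w).
  by rewrite integral_constant ger0_norm// s0.
under eq_integral do rewrite EFinM.
rewrite ge0_integralZl//; last first.
  by apply/measurable_EFinP; apply: measurableT_comp.
rewrite ger0_norm ?s0// -[leRHS]mule1 lee_wpmul2l ?lee_fin ?s0//.
apply: le_trans (pn n (ltnSn n)).
by apply: eq_implies_le; apply: eq_integral => v _; rewrite ger0_norm ?p0.
Qed.

(** At each time the stopped product either has reached [L], and is frozen, or still equals the
    plain product; so a crossing at time [m] remains visible at time [n]. *)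
Lemma stopped_prodP X L (phi : nat -> R -> R) n w m : (m <= n)%N ->
  L <= \prod_(i < m) phi i (X i w) -> L <= stopped_prod X L phi n w.
Proof.
have step k : L <= stopped_prod X L phi k w \/
    stopped_prod X L phi k w = \prod_(i < k) phi i (X i w).
  elim: k => [|k /= IH]; first by right; rewrite big_ord0.
  case: ifPn => [|Lk]; first by left.
  case: IH => [|->]; first by rewrite (negPf Lk).
  by right; rewrite big_ord_recr.
elim: n => [|n IH].
  by rewrite leqn0 => /eqP ->; rewrite big_ord0.
rewrite leq_eqVlt => /orP[/eqP ->|]; last first.
  by rewrite ltnS => mn Lm; rewrite /= IH//; exact: IH.
by have [Ls|<-] := step n.+1.
Qed.

(** Ville's inequality for the nonnegative supermartingale of partial products. *)
Lemma pr_max_prod X L (phi : nat -> R -> R) n (E : set T) :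
  mutually_independent X -> (forall i, measurable_fun setT (phi i)) ->
  (forall i x, 0 <= phi i x) ->
  (forall i, (i < n)%N -> (\int[P]_w (phi i (X i w))%:E <= 1)%E) ->
  0 < L -> measurable E ->
  (forall w, E w -> exists2 m, (m <= n)%N & L <= \prod_(i < m) phi i (X i w)) ->
  pr P E <= L^-1.
Proof.
move=> iX mphi p0 pn L0 mE sub.
rewrite -[leRHS]mul1r; apply: (@pr_markov _ _ _ _ (stopped_prod X L phi n)) => //.
- exact: adapted_measurable (stopped_prod_adapted _ _).
- by move=> w; exact: stopped_prod_ge0.
- by move=> w /sub[m mn]; exact: stopped_prodP.
- exact: integral_stopped_prod.
Qed.

(** The centred walk [S_n + n a], frozen once its modulus reaches [L]: Markov's inequality for its
    square is then Kolmogorov's maximal inequality. *)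
Fixpoint stopped_walk X (L a : R) n (w : T) : R :=
  if n is m.+1 then
    let v := stopped_walk X L a m w in if L <= `|v| then v else v + (X m w + a)
  else 0.

Lemma stopped_walk_adapted X L a n :
  adapted X [set k | (k < n)%N] (stopped_walk X L a n).
Proof.
elim: n => [|n IH] /=; first exact: measurable_cst.
have IH' : adapted X [set k | (k < n.+1)%N] (stopped_walk X L a n).
  by apply: adapted_sub IH => k /=; lia.
apply: measurable_fun_ifT => //.
  by apply: measurable_fun_ler => //; exact: measurableT_comp.
apply: measurable_funD => //; apply: measurable_funD => //.
exact: (@adaptedX _ _ _ _ X [set k | (k < n.+1)%N] n (ltnSn n)).
Qed.

Lemma stopped_walkP X L a n w m : 0 <= L -> (m <= n)%N ->
  L <= `|Ssum X m w + m%:R * a| -> L <= `|stopped_walk X L a n w|.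
Proof.
move=> L0.
have step k : L <= `|stopped_walk X L a k w| \/
    stopped_walk X L a k w = Ssum X k w + k%:R * a.
  elim: k => [|k /= IH]; first by right; rewrite /Ssum big_ord0 mul0r addr0.
  case: ifPn => [|Lk]; first by left.
  case: IH => [|->]; first by rewrite (negPf Lk).
  by right; rewrite /Ssum big_ord_recr /= -natr1; ring.
elim: n => [|n IH].
  by rewrite leqn0 => /eqP ->; rewrite /Ssum big_ord0 mul0r addr0.
rewrite leq_eqVlt => /orP[/eqP ->|]; last first.
  by rewrite ltnS => mn Lm; rewrite /= IH//; exact: IH.
by have [Ls|<-] := step n.+1.
Qed.

(** Each unfrozen step adds at most [s2] in mean; the hypothesis on squares already encodes that the
    cross term of a centred increment vanishes. *)
Lemma integral_stopped_walk X L a s2 n :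
  mutually_independent X -> 0 <= s2 ->
  (forall i u, (\int[P]_w ((u + (X i w + a)) ^+ 2)%:E <= (u ^+ 2 + s2)%:E)%E) ->
  (\int[P]_w (stopped_walk X L a n w ^+ 2)%:E <= (n%:R * s2)%:E)%E.
Proof.
move=> iX s20 iq; elim: n => [|n IH] /=.
  by rewrite mul0r integral_constant expr0n.
pose f (z : R * R) := ((if L <= `|z.1| then z.1 else z.1 + (z.2 + a)) ^+ 2)%:E.
pose U := stopped_walk X L a n; pose V : T -> R := X n.
have mf : measurable_fun setT f.
  apply/measurable_EFinP; apply: measurable_funX.
  apply: measurable_fun_ifT => //=.
  - by apply: measurable_fun_ler => //; apply: measurableT_comp => //; exact: measurable_fst.
  - apply: measurable_funD => //; apply: measurable_funD => //.
have f0 z : (0 <= f z)%E by rewrite /f lee_fin sqr_ge0.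
have mU : measurable_fun setT U.
  exact: adapted_measurable (@stopped_walk_adapted X L a n).
have mV : measurable_fun setT V by exact: measurable_funP.
rewrite (eq_integral (fun w => f (U w, V w)))//.
rewrite (independent_integral iX (below_above_disjoint n))//; first last.
- exact: adaptedX.
- exact: stopped_walk_adapted.
apply: (@le_trans _ _ (\int[P]_w ((U w ^+ 2)%:E + s2%:E))%E).
  apply: ge0_le_integral => //.
  - by move=> w _; apply: integral_ge0.
  - apply: (@measurableT_comp _ _ _ _ _ _ (fun u => \int[P]_v f (u, V v))%E) => //.
    apply: (@measurable_fun_fubini_tonelli_F _ _ _ _ _ P (fun z => f (z.1, V z.2))) => //.
    apply: measurableT_comp => //; apply: measurable_fun_pair => //.
    by apply: measurableT_comp => //.
  - by apply: emeasurable_funD => //; apply/measurable_EFinP; exact: measurable_funX.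
  move=> w _; rewrite /f /=; case: (L <= `|U w|).
    by rewrite integral_constant lee_fin lerDl.
  exact: iq.
rewrite ge0_integralD//; last 2 first.
- by move=> w _; rewrite lee_fin sqr_ge0.
- by apply/measurable_EFinP; exact: measurable_funX.
rewrite integral_constant -natr1 mulrDl mul1r EFinD.
by rewrite leeD2r.
Qed.

Lemma pr_max_walk X L a s2 n (E : set T) :
  mutually_independent X -> 0 <= s2 ->
  (forall i u, (\int[P]_w ((u + (X i w + a)) ^+ 2)%:E <= (u ^+ 2 + s2)%:E)%E) ->
  0 < L -> measurable E ->
  (forall w, E w -> exists2 m, (m <= n)%N & L <= `|Ssum X m w + m%:R * a|) ->
  pr P E <= n%:R * s2 / L ^+ 2.
Proof.
move=> iX s20 iq L0 mE sub.
apply: (@pr_markov _ _ _ _ (fun w => stopped_walk X L a n w ^+ 2)) => //.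
- apply: measurable_funX; exact: adapted_measurable (@stopped_walk_adapted X L a n).
- by rewrite exprn_gt0.
- by move=> w; exact: sqr_ge0.
- move=> w /sub[m mn Lm] /=; rewrite -[leRHS]real_normK ?num_real//.
  by rewrite ler_pXn2r ?nnegrE ?(ltW L0)//; exact: (stopped_walkP (ltW L0) mn Lm).
- exact: integral_stopped_walk.
Qed.

End MaximalInequality.

(** * The area under an excursion without large jumps *)

Section AreaBound.
Context {d : measure_display} {T : measurableType d} {R : realType}.
Variable (P : probability T R).
Implicit Types (X : nat -> {RV P >-> R}).

(** Zero beyond [y], so that only the tail below [y] enters its mean; on paths without a jump above
    [y] a product of such factors is the full exponential. *)
Definition trunc_exp (l y s : R) : R := if s <= y then expR (l * s) else 0.

Lemma trunc_exp_ge0 l y s : 0 <= trunc_exp l y s.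
Proof. by rewrite /trunc_exp; case: ifP => // _; exact: expR_ge0. Qed.

Lemma measurable_trunc_exp l y : measurable_fun setT (trunc_exp l y).
Proof.
apply: measurable_fun_ifT => //.
- exact: measurable_fun_ler.
- by apply: measurableT_comp => //; exact: mulrl_measurable.
Qed.

Lemma SsumS X n w : Ssum X n.+1 w = Ssum X n w + X n w.
Proof. by rewrite /Ssum big_ord_recr. Qed.

Lemma Ssum0 X w : Ssum X 0 w = 0.
Proof. by rewrite /Ssum big_ord0. Qed.

Lemma measurable_Ssum X n : measurable_fun setT (Ssum X n).
Proof. exact: adapted_measurable (adapted_Ssum (X := X) (n := n)). Qed.

(** Summation by parts. For [p <= N - 1] and a nonnegative final height the last term only helps, so
    the area is bounded with weights [N - 1 - i] that do not depend on [p]: one tilt serves all end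
    times of a window. *)
Lemma area_by_increments X (N v : R) p w :
  \sum_(k < p.+1) (v + Ssum X k w) =
  N * v + \sum_(i < p) (N - 1 - i%:R) * X i w - (N - 1 - p%:R) * (v + Ssum X p w).
Proof.
elim: p => [|p IH]; first by rewrite big_ord_recl !big_ord0 /= Ssum0; ring.
by rewrite big_ord_recr IH [in RHS]big_ord_recr /= SsumS -natr1; ring.
Qed.

(** The constraint [n <= m] on the stopping index is what makes the compensator
    [sum_(i < n) (a l_i - C l_i ^ 2)] available in the bound. *)
Lemma pr_exp_max X (a C lam y : R) (l : nat -> R) n N (L : R) (E : set T) :
  mutually_independent X ->
  (forall i u, 0 <= u <= lam ->
    (\int[P]_w (trunc_exp u y (X i w))%:E <= (expR (- (a * u) + C * u ^+ 2))%:E)%E) ->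
  0 <= C -> C * lam <= a -> (forall i, (i < N)%N -> 0 <= l i <= lam) -> (n <= N)%N ->
  measurable E ->
  (forall w, E w -> exists2 m, (n <= m <= N)%N &
     (forall i, (i < m)%N -> X i w <= y) /\ L <= \sum_(i < m) l i * X i w) ->
  pr P E <= expR (- (L + \sum_(i < n) (a * l i - C * l i ^+ 2))).
Proof.
move=> iX mgf C0 Ca lN nN mE sub.
pose c i := a * l i - C * l i ^+ 2.
(* The factor [expR (c i)] brings the mean of the tilted increment down to at most 1. *)
pose phi i s := expR (c i) * trunc_exp (l i) y s.
rewrite expRN; apply: (@pr_max_prod _ _ _ _ X _ phi N) => //.
- move=> i; apply: measurable_funM => //; exact: measurable_trunc_exp.
- by move=> i s; rewrite mulr_ge0 ?expR_ge0 ?trunc_exp_ge0.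
- move=> i iN; rewrite /phi; under eq_integral do rewrite EFinM.
  have mt : measurable_fun setT (fun w => (trunc_exp (l i) y (X i w))%:E).
    by apply/measurable_EFinP; apply: measurableT_comp => //; exact: measurable_trunc_exp.
  have t0 w : setT w -> (0 <= (trunc_exp (l i) y (X i w))%:E)%E.
    by rewrite lee_fin trunc_exp_ge0.
  have e0 : (0 <= (expR (c i))%:E)%E by rewrite lee_fin expR_ge0.
  rewrite (ge0_integralZl P measurableT mt t0 e0).
  have := mgf i (l i) (lN i iN).
  move=> /(lee_wpmul2l e0)/le_trans; apply.
  by rewrite -EFinM -expRD lee_fin /c -[leRHS]expR0 ler_expR; lra.
- exact: expR_gt0.
- move=> w /sub[m /andP[nm mN] [Xy LX]]; exists m => //.
  have -> : \prod_(i < m) phi i (X i w) = expR (\sum_(i < m) l i * X i w + \sum_(i < m) c i).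
    rewrite -big_split /= expR_sum; apply: eq_bigr => i _.
    by rewrite /phi /trunc_exp Xy// -expRD addrC.
  rewrite ler_expR lerD//.
  (* The compensators with [n <= i < m] are nonnegative, since [C * l i <= C * lam <= a], and may be
     dropped. *)
  rewrite -(big_mkord xpredT c) -(big_mkord xpredT c) (big_cat_nat (leq0n n) nm) /= lerDl.
  rewrite big_nat sumr_ge0// => i /andP[_ im].
  have /andP[l0 ll] := lN i (leq_trans im mN).
  rewrite /c subr_ge0 expr2 mulrA ler_wpM2r//.
  by apply: le_trans Ca; rewrite ler_wpM2l.
Qed.

(** The excursion may end anywhere in the window, so the drift is credited only for the first
    [n = N - W] increments; this costs [a W ^ 2 / (2 N)]. The squares of the tilts are bounded
    crudely by [lam ^ 2]. *)
Lemma pr_block X (a C lam y v x N : R) n W (E : set T) :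
  mutually_independent X ->
  (forall i u, 0 <= u <= lam ->
    (\int[P]_w (trunc_exp u y (X i w))%:E <= (expR (- (a * u) + C * u ^+ 2))%:E)%E) ->
  0 < a -> 0 <= C -> 0 <= lam -> C * lam <= a -> (0 < W)%N -> measurable E ->
  (forall w, E w -> (forall i, (i < n + W)%N -> X i w <= y) /\
     exists2 p, (n <= p < n + W)%N &
       0 <= v + Ssum X p w /\ x < \sum_(k < p.+1) (v + Ssum X k w)) ->
  N = (n + W)%:R ->
  pr P E <= expR (- (lam * (x / N - v + a * (N / 2 - 1 / 2 - W%:R ^+ 2 / (2 * N)) - C * lam * N))).
Proof.
move=> iX mgf a0 C0 lam0 Ca W0 mE sub NE.
have N0 : 0 < N by rewrite NE ltr0n; lia.
pose l i := lam / N * (N - 1 - i%:R).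
have lN i : (i < n + W)%N -> 0 <= l i <= lam.
  move=> iN; have : (i.+1%:R : R) <= N by rewrite NE ler_nat.
  rewrite -natr1 => iN'; rewrite /l mulr_ge0 ?divr_ge0 ?(ltW N0)//=; last by lra.
  rewrite -[leRHS]mulr1 -mulrA ler_wpM2l// mulrC ler_pdivrMr// mul1r.
  by have : (0 : R) <= i%:R by []; lra.
apply: (@le_trans _ _ (expR (- (lam / N * (x - N * v) + \sum_(i < n) (a * l i - C * l i ^+ 2))))).
  apply: (pr_exp_max iX mgf C0 Ca lN (leq_addr _ _) mE) => w /sub[Xy [p /andP[np pN] [vp xs]]].
  exists p; first by rewrite np ltnW.
  split; first by move=> i ip; apply: Xy; exact: ltn_trans pN.
  have -> : \sum_(i < p) l i * X i w = lam / N * \sum_(i < p) (N - 1 - i%:R) * X i w.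
    by rewrite mulr_sumr; apply: eq_bigr => i _; rewrite mulrA.
  apply: ler_wpM2l; first by rewrite divr_ge0 ?(ltW N0).
  move: xs; rewrite (area_by_increments X N) => /ltW.
  have : (p.+1%:R : R) <= N by rewrite NE ler_nat.
  rewrite -natr1 => pN'.
  have : 0 <= (N - 1 - p%:R) * (v + Ssum X p w) by rewrite mulr_ge0//; lra.
  by lra.
rewrite ler_expR lerN2.
have sumw m : \sum_(i < m) (N - 1 - i%:R) = m%:R * (2 * N - 1 - m%:R) / 2.
  elim: m => [|m IH]; first by rewrite big_ord0 !mul0r.
  by rewrite big_ord_recr IH /= -natr1; field.
have -> : \sum_(i < n) (a * l i - C * l i ^+ 2) =
    a * (lam / N) * (n%:R * (2 * N - 1 - n%:R) / 2) - C * \sum_(i < n) l i ^+ 2.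
  rewrite -sumw !mulr_sumr -sumrB; apply: eq_bigr => i _.
  by rewrite /l mulrA.
have ub : \sum_(i < n) l i ^+ 2 <= N * lam ^+ 2.
  apply: (@le_trans _ _ (\sum_(i < n) lam ^+ 2)).
    apply: ler_sum => i _; have /andP[l0 ll] := lN i (ltn_addr _ (ltn_ord i)).
    by rewrite ler_pXn2r.
  rewrite sumr_const card_ord -[leLHS]mulr_natl ler_wpM2r ?sqr_ge0//.
  by rewrite NE ler_nat leq_addr.
have {}ub : C * \sum_(i < n) l i ^+ 2 <= C * (N * lam ^+ 2) by rewrite ler_wpM2l.
have eN : n%:R = N - W%:R :> R by rewrite NE natrD; ring.
have W0' : (0 : R) <= W%:R by [].
have : lam * (x / N - v + a * (N / 2 - 1 / 2 - W%:R ^+ 2 / (2 * N)) - C * lam * N)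
     + a * lam * W%:R / (2 * N)
   = lam / N * (x - N * v) + a * (lam / N) * (n%:R * (2 * N - 1 - n%:R) / 2) - C * (N * lam ^+ 2).
  by rewrite eN; field; rewrite gt_eqF.
have : 0 <= a * lam * W%:R / (2 * N) by rewrite !mulr_ge0 ?invr_ge0 ?mulr_ge0 ?(ltW a0) ?(ltW N0).
lra.
Qed.

(** The window loss [a W ^ 2 / (2 N)] scales in [N] like [x / N] and is merged with it. What is left
    is [p ^ 2 / N + q ^ 2 N >= 2 p q], so that the bound is the same for all windows. *)
Lemma block_exponent (a C lam v x N W : R) : 0 < N -> 0 <= lam ->
  0 <= x - a * W ^+ 2 / 2 -> 0 <= a / 2 - C * lam ->
  lam * (2 * Num.sqrt ((x - a * W ^+ 2 / 2) * (a / 2 - C * lam)) - v - a / 2) <=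
  lam * (x / N - v + a * (N / 2 - 1 / 2 - W ^+ 2 / (2 * N)) - C * lam * N).
Proof.
move=> N0 lam0 x0 c0; rewrite ler_wpM2l//.
rewrite sqrtrM//.
set p := Num.sqrt (x - _); set q := Num.sqrt (a / 2 - _).
have ep : p ^+ 2 = x - a * W ^+ 2 / 2 by rewrite sqr_sqrtr.
have eq : q ^+ 2 = a / 2 - C * lam by rewrite sqr_sqrtr.
have -> : x / N - v + a * (N / 2 - 1 / 2 - W ^+ 2 / (2 * N)) - C * lam * N =
   p ^+ 2 / N + q ^+ 2 * N - v - a / 2.
  by rewrite ep eq; field; rewrite gt_eqF.
have : 0 <= (p - q * N) ^+ 2 / N by rewrite divr_ge0 ?sqr_ge0 ?(ltW N0).
have -> : (p - q * N) ^+ 2 / N = p ^+ 2 / N + q ^+ 2 * N - 2 * (p * q).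
  by field; rewrite gt_eqF.
lra.
Qed.

(** Contains the event that the excursion of the walk started at [v] has area larger than
    [x], but depends on the first [n] increments only. *)
Definition large_area X (v x : R) n : set T :=
  [set w | (exists2 p, (p < n)%N &
     0 <= v + Ssum X p w /\ x < \sum_(k < p.+1) (v + Ssum X k w)) \/
     0 < v + Ssum X n w].

(** Two sequences, because [X] will be a shifted walk while the sigma-algebra belongs to the
    original increments [Y]. *)
Lemma adapted_large_area X I (v x : R) n (Y : nat -> {RV P >-> R}) :
  (forall i, (i < n)%N -> adapted Y I (X i)) ->
  <<s generators Y I >> (large_area X v x n).
Proof.
move=> aX.
have aS k : (k <= n)%N -> adapted Y I (Ssum X k).
  move=> kn; apply: (@adapted_sum _ _ _ _ Y I k (fun i => X i)) => i ik.
  exact: (aX i (leq_trans ik kn)).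
pose GT := g_sigma_algebraType (generators Y I).
have -> : large_area X v x n = (\big[setU/set0]_(p < n)
   ([set w | 0 <= v + Ssum X p w] `&` [set w | x < \sum_(k < p.+1) (v + Ssum X k w)]))
   `|` [set w | 0 < v + Ssum X n w].
  rewrite -(@bigcup_mkord _ n (fun p => [set w | 0 <= v + Ssum X p w] `&`
    [set w | x < \sum_(k < p.+1) (v + Ssum X k w)])).
  apply/seteqP; split=> [w [[p pn [h1 h2]]|h]|w [[p pn [h1 h2]]|h]].
  - by left; exists p.
  - by right.
  - by left; exists p.
  - by right.
have aD k : (k <= n)%N -> adapted Y I (fun w => v + Ssum X k w).
  by move=> kn; apply: measurable_funD; [exact: measurable_cst|exact: aS].
apply: (@measurableU _ GT); last first.
  by apply: (@measurable_lt_set _ GT) => //; exact: aD.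
apply: (@bigsetU_measurable _ GT) => p _; apply: (@measurableI _ GT).
  by apply: (@measurable_le_set _ GT) => //; apply: aD; rewrite ltnW.
apply: (@measurable_lt_set _ GT) => //.
apply: (@adapted_sum _ _ _ _ Y I p.+1 (fun k w => v + Ssum X k w)) => i ip.
by apply: aD; have := ltn_ord p; lia.
Qed.

Lemma measurable_large_area X v x n : measurable (large_area X v x n).
Proof.
apply: (@sigma_measurable _ _ _ _ X [set k | (k < n)%N]).
by apply: adapted_large_area => i ni; exact: adaptedX.
Qed.

Lemma measurable_jump X i (y : R) : measurable [set w | y < X i w].
Proof. by apply: measurable_lt_set => //; exact: measurable_funP. Qed.

Lemma measurable_nojump X n (y : R) : measurable [set w | forall i, (i < n)%N -> X i w <= y].
Proof.
have -> : [set w | forall i, (i < n)%N -> X i w <= y] =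
    \bigcap_(i in [set k | (k < n)%N]) [set w | X i w <= y].
  by apply/seteqP; split=> w /= h i; exact: h.
apply: fin_bigcap_measurable => [|i _]; first exact: finite_II.
by apply: measurable_le_set => //; exact: measurable_funP.
Qed.

(** A constant tilt over all [n] steps: each step gains the drift [a] and pays [C lam]. *)
Lemma pr_positive_nojump X (a C lam y v : R) n (E : set T) :
  mutually_independent X ->
  (forall i u, 0 <= u <= lam ->
    (\int[P]_w (trunc_exp u y (X i w))%:E <= (expR (- (a * u) + C * u ^+ 2))%:E)%E) ->
  0 <= C -> 0 <= lam -> C * lam <= a -> measurable E ->
  (forall w, E w -> (forall i, (i < n)%N -> X i w <= y) /\ 0 < v + Ssum X n w) ->
  pr P E <= expR (lam * (v - (a - C * lam) * n%:R)).
Proof.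
move=> iX mgf C0 lam0 Ca mE sub.
have lN i : (i < n)%N -> 0 <= lam <= lam by rewrite lam0 lexx.
apply: le_trans (pr_exp_max (L := - (lam * v)) iX mgf C0 Ca lN (leqnn n) mE _) _.
  move=> w /sub[Xy vn]; exists n; first by rewrite leqnn.
  split=> //; rewrite -mulr_sumr -mulrN ler_wpM2l//.
  by move: vn; rewrite /Ssum; lra.
by rewrite sumr_const card_ord ler_expR -[X in _ + X]mulr_natl; apply: eq_implies_le; ring.
Qed.

(** The three terms are a jump above [y] within [m W] steps, a large area reached in one of the [m]
    windows of length [W], and survival up to time [m W]. *)
Lemma pr_large_area X (a C lam y v x F : R) m W :
  mutually_independent X ->
  (forall i u, 0 <= u <= lam ->
    (\int[P]_w (trunc_exp u y (X i w))%:E <= (expR (- (a * u) + C * u ^+ 2))%:E)%E) ->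
  (forall i, pr P [set w | y < X i w] <= F) ->
  0 < a -> 0 <= C -> 0 <= lam -> 0 <= a / 2 - C * lam -> (0 < W)%N ->
  0 <= x - a * W%:R ^+ 2 / 2 ->
  pr P (large_area X v x (m * W)) <= (m * W)%:R * F +
    m%:R * expR (- (lam * (2 * Num.sqrt ((x - a * W%:R ^+ 2 / 2) * (a / 2 - C * lam)) - v - a / 2)))
    + expR (lam * (v - (a - C * lam) * (m * W)%:R)).
Proof.
move=> iX mgf jump a0 C0 lam0 c0 W0 x0; set n := (m * W)%N.
have Ca : C * lam <= a by lra.
pose J := [set w | exists2 i, (i < n)%N & y < X i w].
have JE : J = \bigcup_(i < n) [set w | y < X i w].
  by apply/seteqP; split=> w [i ni h]; exists i.
have mJ : measurable J.
  by rewrite JE; apply: bigcup_measurable => i _; exact: measurable_jump.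
pose NJ := [set w | forall i, (i < n)%N -> X i w <= y].
have mNJ : measurable NJ by exact: measurable_nojump.
pose bl b := large_area X v x n `&` NJ `&` [set w | exists2 p, (b * W <= p < b * W + W)%N &
  0 <= v + Ssum X p w /\ x < \sum_(k < p.+1) (v + Ssum X k w)].
have mbl b : measurable (bl b).
  apply: measurableI.
    by apply: measurableI => //; exact: measurable_large_area.
  have -> : [set w | exists2 p, (b * W <= p < b * W + W)%N &
      0 <= v + Ssum X p w /\ x < \sum_(k < p.+1) (v + Ssum X k w)] =
    \bigcup_(p in [set p | (b * W <= p < b * W + W)%N])
     ([set w | 0 <= v + Ssum X p w] `&` [set w | x < \sum_(k < p.+1) (v + Ssum X k w)]).
    by apply/seteqP; split=> w [p h1 h2]; exists p.
  have mD k : measurable_fun setT (fun w => v + Ssum X k w).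
    by apply: measurable_funD => //; exact: measurable_Ssum.
  apply: bigcup_measurable => p _; apply: measurableI; first exact: measurable_le_set.
  by apply: measurable_lt_set => //; exact: measurable_sum.
pose last := large_area X v x n `&` NJ `&` [set w | 0 < v + Ssum X n w].
have mD k : measurable_fun setT (fun w => v + Ssum X k w).
  by apply: measurable_funD => //; exact: measurable_Ssum.
have mlast : measurable last.
  apply: measurableI; last exact: measurable_lt_set.
  by apply: measurableI => //; exact: measurable_large_area.
pose BL := \big[setU/set0]_(b < m) bl b.
have mBL : measurable BL by apply: bigsetU_measurable.
have sub : large_area X v x n `<=` (J `|` BL) `|` last.
  move=> w Lw; have [Jw|nJw] := pselect (J w); first by left; left.
  have NJw : NJ w.
    by move=> i ni; rewrite leNgt; apply/negP => yX; apply: nJw; exists i.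
  have := Lw; case=> [[p pn hp]|h]; last by right.
  left; right; rewrite /BL -(@bigcup_mkord _ m bl).
  exists (p %/ W)%N; first by rewrite /= ltn_divLR.
  split=> //; exists p => //.
  by rewrite leq_divM /=; have := ltn_ceil p W0; rewrite mulSn addnC.
have mJBL : measurable (J `|` BL) by exact: measurableU.
have mall : measurable ((J `|` BL) `|` last) by exact: measurableU.
apply: (le_trans (pr_le P (measurable_large_area X v x n) mall sub)).
apply: (le_trans (pr_setU P mJBL mlast)).
apply: lerD.
  apply: (le_trans (pr_setU P mJ mBL)); apply: lerD.
    apply: (@le_trans _ _ (\sum_(i < n) pr P [set w | y < X i w])).
      apply: (@pr_cover_ord _ _ _ P n (fun i => [set w | y < X i w])) => //.
      by move=> i; exact: measurable_jump.
    rewrite mulr_natl -[X in _ *+ X]card_ord -sumr_const.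
    by apply: ler_sum => i _.
  apply: (@le_trans _ _ (\sum_(b < m) pr P (bl b))).
    apply: (@pr_cover_ord _ _ _ P m bl) => // w; rewrite /BL -(@bigcup_mkord _ m bl) => -[b bm h].
    by exists b.
  rewrite mulr_natl -[X in _ *+ X]card_ord -sumr_const.
  apply: ler_sum => b _.
  apply: le_trans (@pr_block X a C lam y v x _ (b * W) W _ iX mgf a0 C0 lam0 Ca W0
    (mbl b) _ erefl) _.
    move=> w [[_ NJw] hp]; split=> // i ib; apply: NJw.
    by apply: leq_trans ib _; rewrite -mulSnr leq_mul2r ltn_ord orbT.
  rewrite ler_expR lerN2; apply: block_exponent => //.
  by rewrite ltr0n addn_gt0 W0 orbT.
by apply: (pr_positive_nojump iX mgf C0 lam0 Ca mlast) => w [[_ h] hn].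
Qed.

End AreaBound.

(** * Exponential moments of truncated increments *)

(** Squaring [1 - u / 2 <= exp (- u / 2)] bounds [exp u] by a rational function, leaving a
    polynomial inequality. There is no lower restriction on [u], as increments are unbounded
    below. *)
Lemma expR_le_quadratic (R : realType) (u : R) : u <= 1 -> expR u <= 1 + u + 2 * u ^+ 2.
Proof.
move=> u1.
have q0 : 0 < 1 - u / 2 by lra.
have qe : 1 - u / 2 <= expR (- (u / 2)) by have := expR_ge1Dx (- (u / 2)); lra.
have e1 : expR u * expR (- (u / 2)) ^+ 2 = 1.
  by rewrite -expRM_natl -expRD (_ : u + _ = 0) ?expR0//; lra.
have e2 : expR u * (1 - u / 2) ^+ 2 <= 1.
  rewrite -[leRHS]e1 ler_wpM2l ?expR_ge0//.
  by rewrite ler_pXn2r ?nnegrE ?(ltW q0) ?expR_ge0.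
have q20 : 0 < (1 - u / 2) ^+ 2 by rewrite exprn_gt0.
rewrite -(ler_pM2r q20); apply: le_trans e2 _.
have -> : (1 + u + 2 * u ^+ 2) * (1 - u / 2) ^+ 2 =
  1 + u ^+ 2 * ((1 - u) * (5 / 4 - u / 2)) by field.
by rewrite lerDl mulr_ge0 ?sqr_ge0 ?mulr_ge0//; lra.
Qed.

(** Strengthened to [2 - 1 / K] so that the induction telescopes. *)
Lemma sum_inv_sqr_le2 (R : realType) K : \sum_(k < K) (k.+1%:R ^- 2 : R) <= 2.
Proof.
case: K => [|K]; first by rewrite big_ord0.
suff : \sum_(k < K.+1) (k.+1%:R ^- 2 : R) <= 2 - K.+1%:R^-1.
  by move/le_trans; apply; rewrite lerBlDr lerDl invr_ge0.
elim: K => [|K IH]; first by rewrite big_ord_recl big_ord0 /= invr1 expr1n invr1; lra.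
rewrite big_ord_recr /=; apply: le_trans (lerD IH (lexx _)) _.
have a0 : (0 : R) < K.+1%:R by [].
have b0 : (0 : R) < K.+2%:R by [].
have e : (K.+2%:R : R) = K.+1%:R + 1 by rewrite -natr1.
rewrite -subr_ge0.
have -> : 2 - K.+2%:R^-1 - (2 - K.+1%:R^-1 + K.+2%:R ^- 2) =
    (K.+1%:R * K.+2%:R ^+ 2)^-1 :> R.
  by move: a0 b0; rewrite e; move: (K.+1%:R : R) => z z0 z1; field; rewrite !gt_eqF.
by rewrite invr_ge0 mulr_ge0// exprn_ge0.
Qed.

Section Moments.
Context {d : measure_display} {T : measurableType d} {R : realType}.
Variables (P : probability T R) (X : nat -> {RV P >-> R}) (a : R).
Hypotheses (iX : identically_distributed X)
  (intX : P.-integrable setT (EFin \o X 0%N))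
  (EX : ('E_P[X 0%N] = (- a)%:E)%E)
  (X2 : P.-integrable setT (EFin \o (fun w => X 0%N w ^+ 2))).

Definition second_moment : R := fine (\int[P]_w (X 0%N w ^+ 2)%:E)%E.

Let mX i : measurable_fun setT (X i : T -> R). Proof. exact: measurable_funP. Qed.

Lemma second_moment_ge0 : 0 <= second_moment.
Proof. by rewrite fine_ge0// integral_ge0// => w _; rewrite lee_fin sqr_ge0. Qed.

Lemma integral_identical i (f : R -> R) : measurable_fun setT f -> (forall x, 0 <= f x) ->
  (\int[P]_w (f (X i w))%:E = \int[P]_w (f (X 0%N w))%:E)%E.
Proof.
move=> mf f0.
have mEf : measurable_fun setT (EFin \o f) by exact/measurable_EFinP.
have f0' x : (0 <= (EFin \o f) x)%E by rewrite lee_fin.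
rewrite -[LHS]/(\int[P]_w ((EFin \o f) \o X i) w)%E -[RHS]/(\int[P]_w ((EFin \o f) \o X 0%N) w)%E.
rewrite -!ge0_integral_distribution//.
by apply: eq_measure_integral => A mA _; exact: iX.
Qed.

Lemma pr_tail i y : pr P [set w | y < X i w] = Fbar X y.
Proof.
rewrite /pr /Fbar; congr fine.
have e j : [set w | y < X j w] = X j @^-1` `]y, +oo[.
  by apply/seteqP; split=> w /=; rewrite in_itv /= andbT.
by rewrite !e; exact: (iX i (measurable_itv `]y, +oo[)).
Qed.

Lemma Fbar_ge0 y : 0 <= Fbar X y. Proof. by rewrite fine_ge0. Qed.

Lemma integral_quadratic (c0 c1 c2 : R) :
  (\int[P]_w (c0 + c1 * X 0%N w + c2 * X 0%N w ^+ 2)%:E =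
   (c0 - c1 * a + c2 * second_moment)%:E)%E.
Proof.
have i0 : P.-integrable setT (fun w => c0%:E) by exact: finite_measure_integrable_cst.
have i1 : P.-integrable setT (fun w => (c1%:E * (X 0%N w)%:E)%E) by exact: integrableZl.
have i2 : P.-integrable setT (fun w => (c2%:E * (X 0%N w ^+ 2)%:E)%E) by exact: integrableZl.
under eq_integral do rewrite EFinD EFinD !EFinM.
rewrite integralD//; last exact: integrableD.
rewrite integralD// integral_constant integralZl// integralZl//.
have -> : (\int[P]_w (X 0%N w)%:E = (- a)%:E)%E by rewrite -EX unlock.
have -> : (\int[P]_w (X 0%N w ^+ 2)%:E = second_moment%:E)%E.
  by rewrite /second_moment fineK//; exact: (integrable_fin_num measurableT X2).
by rewrite -!EFinM -!EFinD mulrN.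
Qed.

(** The cross term cancels because the mean is [- a]; the variance [second_moment - a ^ 2] is then
    bounded by [second_moment]. *)
Lemma centered_second_moment i u :
  (\int[P]_w ((u + (X i w + a)) ^+ 2)%:E <= (u ^+ 2 + second_moment)%:E)%E.
Proof.
rewrite (@integral_identical i (fun x => (u + (x + a)) ^+ 2)); last 2 first.
- apply: measurable_funX; apply: measurable_funD => //; exact: measurable_funD.
- by move=> x; exact: sqr_ge0.
rewrite (eq_integral (fun w =>
  ((u + a) ^+ 2 + (2 * (u + a)) * X 0%N w + 1 * X 0%N w ^+ 2)%:E)); last first.
  by move=> w _; congr EFin; ring.
rewrite integral_quadratic lee_fin.
have : 0 <= a ^+ 2 by exact: sqr_ge0.
lra.
Qed.

(** [e ^ u <= 1 + u + 2 u ^ 2] for [u <= 1], and the part [l X > 1] is cut into the layers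
    [k + 1 < l X <= k + 2]. *)
Lemma mgf_bound l w B : 0 < l -> 0 <= B ->
  (forall t, l^-1 <= t -> t <= w -> expR (l * t) * Fbar X t <= B * t ^- 2) ->
  forall i, (\int[P]_v (trunc_exp l w (X i v))%:E <=
    (1 - a * l + (2 * second_moment + 2 * expR 1 * B) * l ^+ 2)%:E)%E.
Proof.
move=> l0 B0 tail i.
rewrite (integral_identical i (measurable_trunc_exp l w) (trunc_exp_ge0 l w)).
(* Under the truncation at [w] the layers starting beyond [l w] are empty. *)
pose K := Num.truncn (l * w).
pose q v : R := 1 + l * X 0%N v + 2 * l ^+ 2 * X 0%N v ^+ 2.
pose J k := [set v | k.+1%:R / l < X 0%N v].
have mJ k : measurable (J k) by exact: measurable_jump.
have q0 v : 0 <= q v.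
  rewrite /q; have -> : 1 + l * X 0%N v + 2 * l ^+ 2 * X 0%N v ^+ 2 =
   2 * (l * X 0%N v + 1 / 4) ^+ 2 + 7 / 8 by field.
  have := sqr_ge0 (l * X 0%N v + 1 / 4); lra.
have mq : measurable_fun setT (EFin \o q).
  apply/measurable_EFinP; apply: measurable_funD; first apply: measurable_funD => //.
    exact: measurable_funM.
  by apply: measurable_funM => //; exact: measurable_funX.
have pw v : trunc_exp l w (X 0%N v) <= q v + \sum_(k < K) expR (k.+2%:R : R) * \1_(J k) v.
  have s0 : 0 <= \sum_(k < K) expR (k.+2%:R : R) * \1_(J k) v.
    by apply: sumr_ge0 => k _; rewrite mulr_ge0 ?expR_ge0.
  rewrite /trunc_exp; case: ifPn => [Xw|_]; last exact: addr_ge0.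
  have [X1|X1] := leP (l * X 0%N v) 1.
    have := expR_le_quadratic X1; rewrite exprMn mulrA -/(q v); lra.
  have [k /andP[k1 k2]] : exists k : nat, k.+1%:R < l * X 0%N v <= k.+2%:R.
    have /andP[t1 t2] : (Num.truncn (l * X 0%N v))%:R <= l * X 0%N v <
        (Num.truncn (l * X 0%N v)).+1%:R.
      by apply: truncn_itv; lra.
    case: (Num.truncn _) t1 t2 => [|[|n]] t1 t2.
    - by move: X1; rewrite ltNge => /negP[]; exact: ltW.
    - by exists 0%N; rewrite X1 ltW.
    - move: t1; rewrite le_eqVlt => /orP[/eqP t1|t1].
        by exists n; rewrite -t1 lexx andbT ltr_nat.
      by exists n.+1; rewrite t1 ltW.
  have kK : (k < K)%N.
    have kw : k.+1%:R <= l * w by rewrite ltW// (lt_le_trans k1)// ler_wpM2l// ltW.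
    by rewrite /K truncn_ge_nat// (le_trans _ kw).
  apply: (@le_trans _ _ (\sum_(k < K) expR (k.+2%:R : R) * \1_(J k) v)); last by rewrite lerDr.
  rewrite (bigD1 (Ordinal kK)) //=.
  have -> : \1_(J k) v = 1 :> R.
    by rewrite indicE mem_set// /J /= ltr_pdivrMr// mulrC.
  rewrite mulr1; apply: (@le_trans _ _ (expR (k.+2%:R : R))); first by rewrite ler_expR.
  by rewrite lerDl sumr_ge0// => j _; rewrite mulr_ge0 ?expR_ge0.
have mI k : measurable_fun setT (fun v => (expR (k.+2%:R : R) * \1_(J k) v)%:E).
  by apply/measurable_EFinP; apply: measurable_funM => //; exact: measurable_indic.
apply: (@le_trans _ _ (\int[P]_v ((q v)%:E + \sum_(k < K) (expR (k.+2%:R : R) * \1_(J k) v)%:E))%E).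
  apply: ge0_le_integral => //.
  - by move=> v _; rewrite lee_fin trunc_exp_ge0.
  - apply/measurable_EFinP; apply: measurableT_comp => //; exact: measurable_trunc_exp.
  - by apply: emeasurable_funD => //; exact: emeasurable_sum.
  - by move=> v _; rewrite sumEFin -EFinD lee_fin; exact: pw.
rewrite ge0_integralD//; last 3 first.
- by move=> v _; rewrite lee_fin.
- by move=> v _; apply: sume_ge0 => k _; rewrite lee_fin mulr_ge0 ?expR_ge0.
- exact: emeasurable_sum.
rewrite ge0_integral_sum//.
have -> : (\int[P]_v (q v)%:E = (1 - l * a + 2 * l ^+ 2 * second_moment)%:E)%E.
  exact: integral_quadratic.
have -> : (\sum_(k < K) \int[P]_v (expR (k.+2%:R : R) * \1_(J k) v)%:E =
    (\sum_(k < K) expR (k.+2%:R : R) * Fbar X (k.+1%:R / l))%:E)%E.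
  rewrite -sumEFin; apply: eq_bigr => k _.
  under eq_integral do rewrite EFinM.
  have m1 : measurable_fun setT (fun v => (\1_(J k) v : R)%:E).
    by apply/measurable_EFinP; exact: measurable_indic.
  have p1 v : setT v -> (0 <= (\1_(J k) v : R)%:E)%E by rewrite lee_fin.
  have p2 : (0 <= (expR (k.+2%:R : R))%:E)%E by rewrite lee_fin expR_ge0.
  rewrite (ge0_integralZl P measurableT m1 p1 p2).
  rewrite integral_indic// setIT EFinM; congr (_ * _)%E.
  by rewrite /Fbar fineK// fin_num_measure//; exact: mJ.
rewrite -EFinD lee_fin.
(* With [t = (k + 1) / l] a layer weighs [e ^ (k + 2) Fbar t = e e ^ (l t) Fbar t <= e B l ^ 2 / (k
   + 1) ^ 2], and the inverse squares sum to at most 2. *)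
have : \sum_(k < K) expR (k.+2%:R : R) * Fbar X (k.+1%:R / l) <= expR 1 * B * l ^+ 2 * 2.
  apply: (@le_trans _ _ (expR 1 * B * l ^+ 2 * \sum_(k < K) (k.+1%:R ^- 2))).
    rewrite mulr_sumr; apply: ler_sum => k _.
    set t := k.+1%:R / l.
    have t0 : 0 < t by rewrite divr_gt0.
    have lt : l * t = k.+1%:R by rewrite /t mulrC divfK// gt_eqF.
    have h : expR (l * t) * Fbar X t <= B * t ^- 2.
      apply: tail; first by rewrite /t -[leLHS]mul1r ler_wpM2r ?invr_ge0 ?(ltW l0)// ler1n.
      have lw1 : 1 <= l * w by rewrite -truncn_gt0; exact: leq_ltn_trans (ltn_ord k).
      rewrite /t ler_pdivrMr// [w * l]mulrC -truncn_ge_nat; first exact: ltn_ord.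
      exact: le_trans lw1.
    rewrite (_ : k.+2%:R = 1 + l * t); last by rewrite lt -natr1 addrC.
    rewrite expRD -!mulrA ler_wpM2l ?expR_ge0//.
    apply: le_trans h _; rewrite ler_wpM2l// /t expr_div_n invf_div mulrA.
    exact: lexx.
  apply: ler_wpM2l; last exact: sum_inv_sqr_le2.
  by rewrite mulr_ge0 ?sqr_ge0// mulr_ge0 ?expR_ge0.
set s := \sum_(_ < _) _; lra.
Qed.

End Moments.

(** * Elementary limits at infinity *)

Section AtInfinity.
Context {R : realType}.
Implicit Types (Q : R -> Prop).

Lemma near_pinfty_ex Q : (\forall x \near +oo, Q x) ->
  forall m, exists2 M, m <= M & forall x, M <= x -> Q x.
Proof.
move=> [M [_ h]] m; exists (Num.max m (M + 1)); first by rewrite le_max lexx.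
by move=> x; rewrite ge_max => /andP[_ Mx]; apply: h; lra.
Qed.

Lemma sqrt_near (b M : R) : 0 < b -> \forall x \near +oo, M <= Num.sqrt (b * x).
Proof.
move=> b0; near=> x.
have xM : M ^+ 2 / b <= x by near: x; apply: nbhs_pinfty_ge; exact: num_real.
apply: (le_trans (ler_norm M)); rewrite -sqrtr_sqr ler_wsqrtr//.
by rewrite mulrC -ler_pdivrMr.
Unshelve. all: by end_near. Qed.

Lemma root4E (x : R) : 0 <= x -> (x `^ 4^-1) ^+ 2 = Num.sqrt x.
Proof.
move=> x0; have q0 : 0 <= x `^ 4^-1 by exact: powR_ge0.
have q4 : (x `^ 4^-1) ^+ 4 = x.
  by rewrite -powR_mulrn// -powRrM mulVf// powRr1.
have e : x = ((x `^ 4^-1) ^+ 2) ^+ 2 by rewrite -exprM.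
by rewrite [in RHS]e sqrtr_sqr ger0_norm// exprn_ge0.
Qed.

Lemma root4_near (M : R) : \forall x \near +oo, M <= x `^ 4^-1.
Proof.
near=> x.
have x0 : 0 <= x by near: x; apply: nbhs_pinfty_ge; exact: num_real.
have : `|M| ^+ 2 <= Num.sqrt (1 * x) by near: x; exact: sqrt_near.
rewrite mul1r -root4E// ler_pXn2r ?nnegrE ?powR_ge0//.
by apply: le_trans; exact: ler_norm.
Unshelve. all: by end_near. Qed.

End AtInfinity.

(** * The excursion and the measurability of its area *)

Section Excursion.
Context {d : measure_display} {T : measurableType d} {R : realType}.
Variables (P : probability T R) (X : nat -> {RV P >-> R}).

(** The event [tau > n]; for [n = 0] it is the whole space. *)
Definition positive_until n : set T :=
  [set w | forall k, (0 < k <= n)%N -> 0 < Ssum X k w].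

Lemma adapted_positive_until n : <<s generators X [set k | (k < n)%N] >> (positive_until n).
Proof.
pose GT := g_sigma_algebraType (generators X [set k | (k < n)%N]).
have -> : positive_until n = \bigcap_(k in [set k | (0 < k <= n)%N]) [set w | 0 < Ssum X k w].
  by apply/seteqP; split=> w /= h k; exact: h.
apply: (@fin_bigcap_measurable _ GT) => [|k /= /andP[k0 kn]].
  by apply: (@sub_finite_set _ _ [set k | (k < n.+1)%N]) => [k /= /andP[]|]; [|exact: finite_II].
apply: (@measurable_lt_set _ GT) => //.
apply: (@adapted_sub _ _ _ _ X [set i | (i < k)%N]) (adapted_Ssum (n := k)).
by move=> i /= /leq_trans; apply.
Qed.

Lemma measurable_positive_until n : measurable (positive_until n).
Proof. exact: (@sigma_measurable _ _ _ _ X _ _ (adapted_positive_until (n := n))). Qed.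

Lemma tau_optP w :
  (exists2 n, tau_opt X w = Some n.+1 & positive_until n w /\ Ssum X n.+1 w <= 0) \/
  (tau_opt X w = None /\ forall n, positive_until n w).
Proof.
rewrite /tau_opt; case: pselect => [h|h]; [left|right].
  case: ex_minnP => -[//|n] /andP[_ Sn] mn; exists n => //; split=> // k /andP[k0 kn].
  rewrite ltNge; apply/negP => Sk; have := mn k; rewrite k0 Sk => /(_ isT).
  by rewrite ltnNge kn.
split=> // n k /andP[k0 _]; rewrite ltNge; apply/negP => Sk; apply: h.
by exists k; rewrite k0.
Qed.

(** The [n]-th set says that [tau = n + 1] forces an area above [x]. Paths with infinite [tau] lie
    in all of them, in agreement with the value [+oo] of [Atau]. *)
Lemma Atau_gtE x : [set w | (x%:E < Atau X w)%E] =
  \bigcap_n ((~` positive_until n) `|` [set w | 0 < Ssum X n.+1 w] `|`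
    [set w | x < \sum_(k < n.+1) Ssum X k w]).
Proof.
rewrite /Atau; apply/seteqP; split=> w /=.
  have [[n tn [pn Sn]]|[tn pn]] := tau_optP w; rewrite tn => h m _.
    rewrite lte_fin in h; have [mn|nm|->] := ltngtP m n; last by right.
      by left; right; apply: pn; rewrite ltnS leq0n.
    left; left => /(_ n.+1); rewrite ltnS leq0n nm => /(_ isT); rewrite ltNge Sn.
    by [].
  by left; right; apply: (pn m.+1); rewrite ltnS leq0n leqnn.
move=> h; have [[n tn [pn Sn]]|[tn pn]] := tau_optP w; rewrite tn ?ltry//.
rewrite lte_fin; have [[//|/= Sn']|//] := h n I.
by move: Sn'; rewrite ltNge Sn.
Qed.

Lemma measurable_Atau_gt x : measurable [set w | (x%:E < Atau X w)%E].
Proof.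
rewrite Atau_gtE; apply: bigcapT_measurable => n; apply: measurableU.
  apply: measurableU; first by apply: measurableC; exact: measurable_positive_until.
  by apply: measurable_lt_set => //; exact: measurable_Ssum.
apply: measurable_lt_set => //; apply: measurable_sum => k; exact: measurable_Ssum.
Qed.

(** If [tau <= n], the first alternative holds with [p = tau - 1]; otherwise the walk is still
    positive at time [n]. *)
Lemma Atau_gt_large_area x n w : (0 < n)%N ->
  (x%:E < Atau X w)%E -> large_area X 0 x n w.
Proof.
move=> n0; rewrite /Atau.
have [[m tm [pm Sm]]|[tm pm]] := tau_optP w; rewrite tm => h; last first.
  by right; rewrite add0r; apply: (pm n); rewrite n0 leqnn.
have [mn|nm] := ltnP m n; last first.
  by right; rewrite add0r; apply: (pm n); rewrite n0.
left; exists m => //; split.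
  rewrite add0r; case: m {tm mn Sm h} pm => [|m] pm; first by rewrite Ssum0.
  by apply/ltW; apply: pm; rewrite leqnn.
by move: h; rewrite lte_fin; under [in X in _ -> X]eq_bigr do rewrite add0r.
Qed.

End Excursion.

(** * Consequences of the tail assumption *)

Section Tail.
Context {d : measure_display} {T : measurableType d} {R : realType}.
Variables (P : probability T R) (X : nat -> {RV P >-> R}) (a : R) (g : R -> R).
Hypotheses (iX : iid X) (a0 : 0 < a)
  (intX : P.-integrable setT (EFin \o X 0%N))
  (EX : ('E_P[X 0%N] = (- a)%:E)%E)
  (X2 : P.-integrable setT (EFin \o (fun w => X 0%N w ^+ 2)))
  (tailg : (fun x => Fbar X x / (expR (- g x) * x ^- 2)) @ +oo --> (1:R))
  (gdec : forall x y, 0 < x -> x <= y -> g y / y <= g x / x)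
  (glim : (fun x => g x / x) @ +oo --> (0:R)).

Let m2 := second_moment X.

(** [g x / x] decreases to 0, so it cannot become negative. *)
Lemma g_ge0 x : 0 < x -> 0 <= g x.
Proof.
move=> x0; suff : 0 <= g x / x by rewrite ler_pdivlMr// mul0r.
rewrite leNgt; apply/negP => gx.
have /cvgrPdist_lt /(_ (- (g x / x))) := glim; rewrite oppr_gt0 => /(_ gx).
move=> /near_pinfty_ex/(_ x)[M xM /(_ M (lexx M))].
have := gdec x0 xM; rewrite sub0r normrN => h1 h2.
have := ler_norm (- (g M / M)); rewrite normrN; lra.
Qed.

Lemma g_sublinear e : 0 < e -> \forall x \near +oo, g x <= e * x.
Proof.
move=> e0; have /cvgrPdist_lt /(_ e e0) h := glim.
near=> x.
have x0 : 0 < x by near: x; apply: nbhs_pinfty_gt; exact: num_real.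
rewrite -ler_pdivrMr//; have : `|0 - g x / x| < e by near: x.
by rewrite sub0r normrN => /ltW; apply: le_trans; exact: ler_norm.
Unshelve. all: by end_near. Qed.

Lemma tail_two_sided : exists2 t0, 1 <= t0 & forall t, t0 <= t ->
  expR (- g t) * t ^- 2 / 2 <= Fbar X t <= 2 * (expR (- g t) * t ^- 2).
Proof.
have half : (0 : R) < 2^-1 by rewrite invr_gt0.
have /cvgrPdist_lt /(_ _ half) h := tailg.
have [M M1 {}h] := near_pinfty_ex h 1; exists M => // t Mt.
have := h t Mt; set r := expR _ * _.
have r0 : 0 < r by rewrite mulr_gt0 ?expR_gt0// invr_gt0 exprn_gt0//; lra.
rewrite ltr_norml => /andP[h1 h2].
have e : Fbar X t = Fbar X t / r * r by rewrite divfK// gt_eqF.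
move: e h1 h2; move: (Fbar X t / r) => z -> h1 h2.
have p1 : 0 <= (z - 2^-1) * r by rewrite mulr_ge0 ?(ltW r0)//; lra.
have p2 : 0 <= (2 - z) * r by rewrite mulr_ge0 ?(ltW r0)//; lra.
by apply/andP; split; lra.
Qed.

Lemma trunc_exp0_integral i y : (\int[P]_w (trunc_exp 0 y (X i w))%:E <= 1)%E.
Proof.
rewrite -(integral_constant P 1); apply: ge0_le_integral => //.
- by move=> w _; rewrite lee_fin trunc_exp_ge0.
- apply/measurable_EFinP; apply: measurableT_comp => //; exact: measurable_trunc_exp.
- by move=> w _; rewrite lee_fin /trunc_exp mul0r expR0; case: ifP.
Qed.

(** The constant of [mgf_bound] for [B = 2], the factor in the upper tail estimate. *)
Definition mgf_const : R := 2 * m2 + 4 * expR 1.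

Lemma mgf_const_gt0 : 0 < mgf_const.
Proof. by rewrite /mgf_const ltr_wpDl ?mulr_gt0 ?expR_gt0// mulr_ge0// second_moment_ge0. Qed.

(** The condition [u <= t0^-1] places all layers [t >= u^-1] of [mgf_bound] where the tail estimate
    holds; [u = 0], excluded there, is treated apart. *)
Lemma mgf_subexponential t0 : 1 <= t0 ->
  (forall t, t0 <= t -> Fbar X t <= 2 * (expR (- g t) * t ^- 2)) ->
  forall y u, 0 < y -> 0 <= u <= g y / y -> u <= t0^-1 ->
  forall i, (\int[P]_w (trunc_exp u y (X i w))%:E <=
     (expR (- (a * u) + mgf_const * u ^+ 2))%:E)%E.
Proof.
move=> t1 tail y u y0 /andP[u0 ug] ut i.
move: u0; rewrite le_eqVlt => /orP[/eqP <-|u0].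
  by rewrite expr0n /= !mulr0 oppr0 addr0 expR0; exact: trunc_exp0_integral.
apply: le_trans (mgf_bound iX.2 intX EX X2 (B := 2) u0 _ _ i) _; first by [].
  move=> t ut' ty.
  have t0t : t0 <= t by apply: le_trans ut'; rewrite -[t0]invrK lef_pV2 ?posrE ?invr_gt0//; lra.
  have tp : 0 < t by lra.
  have ut_g : u * t <= g t.
    by rewrite -ler_pdivlMr//; exact: le_trans ug (gdec tp ty).
  apply: le_trans (ler_wpM2l (expR_ge0 _) (tail t t0t)) _.
  rewrite mulrCA ler_wpM2l// mulrA -expRD -[leRHS]mul1r ler_wpM2r ?invr_ge0 ?exprn_ge0 ?(ltW tp)//.
  by rewrite -[leRHS]expR0 ler_expR; lra.
rewrite lee_fin; apply: le_trans (expR_ge1Dx _).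
by rewrite /mgf_const /m2; lra.
Qed.

End Tail.

(** * The upper bound *)

Lemma sqrt_subr_ge (R : realType) (x e : R) : 0 < x -> 0 <= e <= x ->
  Num.sqrt x - e / Num.sqrt x <= Num.sqrt (x - e).
Proof.
move=> x0 /andP[e0 ex]; set s := Num.sqrt x.
have s0 : 0 < s by rewrite sqrtr_gt0.
have s2 : s ^+ 2 = x by rewrite sqr_sqrtr// ltW.
apply: (le_trans (ler_norm _)); rewrite -sqrtr_sqr ler_wsqrtr//.
have -> : (s - e / s) ^+ 2 = s ^+ 2 - 2 * e + e * (e / s ^+ 2) by field; rewrite gt_eqF.
rewrite s2; have : e * (e / x) <= e * 1 by rewrite ler_wpM2l// ler_pdivrMr// mul1r.
lra.
Qed.

Lemma truncnS_itv (R : realType) (q : R) : 0 <= q -> q <= (Num.truncn q).+1%:R <= q + 1.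
Proof.
by move=> q0; have /andP[h1 h2] := truncn_itv q0; rewrite (ltW h2) -natr1 lerD2r.
Qed.

(** [W] is about [x ^ (1/4)]. The horizon [m W] is at least twice the descent time [y / a], so that
    even at half the drift surviving it has probability at most [exp (- lam y)]. *)
Lemma block_parameters (R : realType) (a x : R) : 0 < a -> 1 <= x `^ 4^-1 ->
  2 * a + 1 <= x `^ 4^-1 -> 0 <= x ->
  let y := Num.sqrt (2 * a * x) in let s := Num.sqrt (2 * a) in
  let c := 2 * s / a + 1 in
  exists m W, [/\ (0 < m)%N, (0 < W)%N, m%:R <= c * x `^ 4^-1,
    2 * y / a <= (m * W)%:R <= 2 * c / s * y &
    a * W%:R ^+ 2 / 2 <= 2 * a * Num.sqrt x <= x].
Proof.
move=> a0 + + x0 y s c; set q := x `^ 4^-1 => q1 qa.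
have s0 : 0 < s by rewrite sqrtr_gt0 mulr_gt0.
have q2 : q ^+ 2 = Num.sqrt x by rewrite root4E.
have q4 : q ^+ 2 * q ^+ 2 = x by rewrite q2 -expr2 sqr_sqrtr.
have yq : y = s * q ^+ 2 by rewrite /y sqrtrM ?q2// mulr_ge0// ltW.
have q0 : 0 <= q by lra.
pose b := 2 * s * q / a.
have b0 : 0 <= b by rewrite divr_ge0 ?mulr_ge0 ?(ltW s0) ?(ltW a0).
have /andP[W1 W2] := truncnS_itv q0.
have /andP[m1 m2] := truncnS_itv b0.
exists (Num.truncn b).+1, (Num.truncn q).+1.
move: (Num.truncn b) (Num.truncn q) m1 m2 W1 W2 => m W m1 m2 W1 W2.
have ecq : c * q = b + q by rewrite /c /b; field; rewrite gt_eqF.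
have mc : m.+1%:R <= c * q by rewrite ecq; lra.
have c0 : 0 <= c by rewrite addr_ge0 ?divr_ge0 ?mulr_ge0 ?(ltW s0) ?(ltW a0).
split=> //.
  rewrite natrM; apply/andP; split.
    apply: (@le_trans _ _ (b * q)); last exact: ler_pM.
    by apply: eq_implies_le; rewrite yq /b; field; rewrite gt_eqF.
  apply: (@le_trans _ _ (c * q * (2 * q))).
    by apply: ler_pM => //; lra.
  by apply: eq_implies_le; rewrite yq; field; rewrite gt_eqF.
apply/andP; split.
  have : W.+1%:R ^+ 2 <= (2 * q) ^+ 2 by rewrite ler_pXn2r ?nnegrE ?mulr_ge0//; lra.
  by rewrite -q2 exprMn => h; have := ler_wpM2l (ltW a0) h; lra.
have aq : 1 * (2 * a) <= q * q.
  by apply: ler_pM => //; [rewrite mulr_ge0// ltW|apply: le_trans qa; rewrite lerDl].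
by rewrite -q2 -[leRHS]q4; have := ler_wpM2r (sqr_ge0 q) aq; rewrite mul1r -expr2.
Qed.

(** Removing [e <= 2 a sqrt x] from [x] moves [sqrt x] by at most [2 a]; as [lam <= 1], the exponent
    loses only a constant. *)
Lemma block_exponent_ge (R : realType) (a C lam x e : R) : 0 < a -> 0 <= C -> 0 <= lam <= 1 ->
  0 <= a / 2 - C * lam -> 0 < x -> 0 <= e <= 2 * a * Num.sqrt x -> e <= x ->
  lam * (Num.sqrt (2 * a * x) * Num.sqrt (1 - 2 * C * lam / a)) -
    (4 * a * Num.sqrt (a / 2) + a / 2) <=
  lam * (2 * Num.sqrt ((x - e) * (a / 2 - C * lam)) - a / 2).
Proof.
move=> a0 C0 /andP[l0 l1] c0 x0 /andP[e0 ea] ex.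
set D := 4 * a * _ + _.
have D0 : 0 <= D by rewrite addr_ge0 ?divr_ge0 ?mulr_ge0 ?sqrtr_ge0 ?(ltW a0).
have sx : Num.sqrt x - 2 * a <= Num.sqrt (x - e).
  apply: le_trans (sqrt_subr_ge x0 _); last by rewrite e0.
  by rewrite lerD2l lerN2 ler_pdivrMr ?sqrtr_gt0.
have <- : 2 * Num.sqrt x * Num.sqrt (a / 2 - C * lam) =
    Num.sqrt (2 * a * x) * Num.sqrt (1 - 2 * C * lam / a).
  rewrite -sqrtrM; last by rewrite !mulr_ge0 ?(ltW a0) ?(ltW x0).
  rewrite (_ : 2 * a * x * _ = 2 ^+ 2 * x * (a / 2 - C * lam)); last first.
    by field; rewrite gt_eqF.
  rewrite sqrtrM; last by rewrite mulr_ge0 ?(ltW x0) ?sqr_ge0.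
  by rewrite sqrtrM// sqrtr_sqr ger0_norm.
have k1 : Num.sqrt (a / 2 - C * lam) <= Num.sqrt (a / 2).
  by rewrite ler_wsqrtr//; have := mulr_ge0 C0 l0; lra.
have k2 : (Num.sqrt x - 2 * a) * Num.sqrt (a / 2 - C * lam) <=
    Num.sqrt ((x - e) * (a / 2 - C * lam)).
  by rewrite sqrtrM ?subr_ge0// ler_wpM2r ?sqrtr_ge0.
have k3 : 2 * a * Num.sqrt (a / 2 - C * lam) <= 2 * a * Num.sqrt (a / 2).
  by rewrite ler_wpM2l// mulr_ge0// ltW.
move: k1 k2 k3 D0; rewrite /D.
move: (Num.sqrt x) (Num.sqrt (a / 2 - C * lam)) (Num.sqrt (a / 2))
   (Num.sqrt ((x - e) * (a / 2 - C * lam))) => u v w z k1 k2 k3 D0.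
have : lam * (2 * u * v - (4 * a * w + a / 2)) <= lam * (2 * z - a / 2).
  by rewrite ler_wpM2l//; lra.
have : lam * (4 * a * w + a / 2) <= 1 * (4 * a * w + a / 2) by rewrite ler_wpM2r.
lra.
Qed.

Section UpperBound.
Context {d : measure_display} {T : measurableType d} {R : realType}.
Variables (P : probability T R) (X : nat -> {RV P >-> R}) (a : R) (g : R -> R).
Hypotheses (iX : iid X) (a0 : 0 < a)
  (intX : P.-integrable setT (EFin \o X 0%N))
  (EX : ('E_P[X 0%N] = (- a)%:E)%E)
  (X2 : P.-integrable setT (EFin \o (fun w => X 0%N w ^+ 2)))
  (tailg : (fun x => Fbar X x / (expR (- g x) * x ^- 2)) @ +oo --> (1:R))
  (gdec : forall x y, 0 < x -> x <= y -> g y / y <= g x / x)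
  (glim : (fun x => g x / x) @ +oo --> (0:R)).

Let C0 := mgf_const X.

Lemma area_tail_upper : exists C, 0 < C /\
      \forall x \near +oo,
        PAtau_gt X x <=
          C * x `^ (4^-1) *
          expR (- (g (Num.sqrt (2 * a * x)) *
                   Num.sqrt (1 - 2 * C * g (Num.sqrt (2 * a * x))
                                   / (a * Num.sqrt (2 * a * x))))).
Proof.
have a_gt0 := a0.
have [t0 t01 tail] := tail_two_sided tailg.
have C00 : 0 < C0 by exact: mgf_const_gt0.
pose s := Num.sqrt (2 * a).
have s0 : 0 < s by rewrite sqrtr_gt0 mulr_gt0.
pose c1 := 2 * s / a + 1.
have c10 : 0 < c1 by rewrite ltr_wpDl// divr_ge0 ?mulr_ge0 ?ltW.
pose D := 4 * a * Num.sqrt (a / 2) + a / 2.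
(* The 2 pays for a big jump and for survival, each at most [E]; each of the at most [c1 q] windows
   costs [expR D * E]. *)
pose C3 := 2 + c1 * expR D.
have C30 : 0 < C3 by rewrite ltr_wpDr ?mulr_ge0 ?expR_ge0 ?ltW.
(* [C0] acts under the root and [C3] is the prefactor; their sum serves in both places because the
   bound increases with each. *)
exists (C0 + C3); split; first exact: addr_gt0.
(* The bounds on [lam] serve, in this order, the bounded loss of [block_exponent_ge], the range of
   [mgf_subexponential], and a net drift of at least [a / 2]. *)
pose e := Num.min 1 (Num.min t0^-1 (a / (4 * C0))).
have t00 : 0 < t0 by exact: lt_le_trans t01.
have e0 : 0 < e by rewrite !lt_min ltr01 invr_gt0 t00 divr_gt0 ?mulr_gt0.
have [M M1 gM] := near_pinfty_ex (g_sublinear glim e0) 1.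
near=> x.
have x1 : 1 <= x by near: x; apply: nbhs_pinfty_ge; exact: num_real.
have x0 : 0 < x by exact: lt_le_trans x1.
set y := Num.sqrt (2 * a * x).
have [yM yt0 yc] : [/\ M <= y, t0 <= y & 4 * c1 / s <= y].
  by split; rewrite /y; near: x; apply: sqrt_near; rewrite mulr_gt0.
set q := x `^ 4^-1.
have [q1 qa] : 1 <= q /\ 2 * a + 1 <= q by split; rewrite /q; near: x; exact: root4_near.
have y0 : 0 < y by exact: lt_le_trans yt0.
pose lam := g y / y.
have gy0 : 0 <= g y by exact: (g_ge0 gdec glim).
have lam0 : 0 <= lam by rewrite divr_ge0// ltW.
have lame : lam <= e by rewrite ler_pdivrMr//; exact: gM.
have [lam1 lamt lama] : [/\ lam <= 1, lam <= t0^-1 & C0 * lam <= a / 4].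
  move: lame; rewrite /e !le_min => /andP[h1 /andP[h2 h3]]; split=> //.
  move: h3; rewrite !ler_pdivlMr ?mulr_gt0// => h3; apply: le_trans h3.
  by apply: eq_implies_le; ring.
have c0 : 0 <= a / 2 - C0 * lam by move: lama; move: (C0 * lam) => z; lra.
have gE : g y = lam * y by rewrite divfK// gt_eqF.
have [m [W [m0 W0 mc /andP[nlow nup] /andP[dl dq]]]] := block_parameters a0 q1 qa (ltW x0).
pose E := expR (- (g y * Num.sqrt (1 - 2 * C0 * g y / (a * y)))).
have E0 : 0 <= E by exact: expR_ge0.
have Eg : expR (- g y) <= E.
  rewrite ler_expR lerN2 -[leRHS]mulr1 ler_wpM2l//.
  rewrite -[leRHS]sqrtr1 ler_wsqrtr// lerBlDr lerDl.
  by rewrite divr_ge0 ?mulr_ge0 ?(ltW C00) ?(ltW a0) ?(ltW y0).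
have main : PAtau_gt X x <= C3 * q * E.
  have n0 : (0 < m * W)%N by rewrite muln_gt0 m0.
  have mgf i u : 0 <= u <= lam ->
      (\int[P]_w (trunc_exp u y (X i w))%:E <= (expR (- (a * u) + C0 * u ^+ 2))%:E)%E.
    move=> /andP[u0 ul].
    apply: (mgf_subexponential iX intX EX X2 gdec t01 _ y0); last exact: le_trans lamt.
      by move=> t /tail/andP[].
    by rewrite u0.
  apply: (@le_trans _ _ (pr P (large_area X 0 x (m * W)))).
    apply: pr_le; [exact: measurable_Atau_gt|exact: measurable_large_area|].
    by move=> w; exact: Atau_gt_large_area.
  have jump i : pr P [set w | y < X i w] <= Fbar X y by rewrite pr_tail//; exact: iX.2.
  have dx : 0 <= x - a * W%:R ^+ 2 / 2 by rewrite subr_ge0 (le_trans dl).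
  apply: le_trans (pr_large_area 0 m iX.1 mgf jump a0 (ltW C00) lam0 c0 W0 dx) _.
  have b1 : (m * W)%:R * Fbar X y <= E.
    apply: le_trans Eg.
    have /tail/andP[_ Fy] := yt0.
    apply: (@le_trans _ _ (2 * c1 / s * y * (2 * (expR (- g y) * y ^- 2)))).
      by apply: ler_pM => //; exact: Fbar_ge0.
    have -> : 2 * c1 / s * y * (2 * (expR (- g y) * y ^- 2)) = expR (- g y) * ((4 * c1 / s) / y).
      by field; rewrite !gt_eqF.
    by rewrite -[leRHS]mulr1 ler_wpM2l ?expR_ge0// ler_pdivrMr// mul1r.
  have b3 : expR (lam * (0 - (a - C0 * lam) * (m * W)%:R)) <= E.
    apply: le_trans Eg; rewrite ler_expR gE sub0r mulrN lerN2 ler_wpM2l//.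
    apply: (@le_trans _ _ (a / 2 * (2 * y / a))).
      by apply: eq_implies_le; field; rewrite gt_eqF.
    apply: ler_pM => //; rewrite ?divr_ge0 ?mulr_ge0 ?(ltW y0) ?(ltW a0)//.
    by move: c0; move: (C0 * lam) => z; lra.
  have b2 : expR (- (lam * (2 * Num.sqrt ((x - a * W%:R ^+ 2 / 2) *
      (a / 2 - C0 * lam)) - 0 - a / 2)))
      <= expR D * E.
    rewrite -expRD ler_expR subr0 lerNl opprD opprK addrC.
    have -> : g y * Num.sqrt (1 - 2 * C0 * g y / (a * y)) =
        lam * (y * Num.sqrt (1 - 2 * C0 * lam / a)).
      rewrite gE [RHS]mulrA; congr (_ * Num.sqrt _).
      by field; rewrite !gt_eqF.
    apply: block_exponent_ge => //; rewrite ?lam0 ?(ltW C00)//.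
      by rewrite dl andbT divr_ge0 ?mulr_ge0 ?(ltW a0) ?sqr_ge0.
    exact: le_trans dq.
  have b2' : m%:R * expR (- (lam * (2 * Num.sqrt ((x - a * W%:R ^+ 2 / 2) *
       (a / 2 - C0 * lam)) - 0 - a / 2))) <= c1 * q * (expR D * E).
    by apply: ler_pM => //; exact: expR_ge0.
  apply: (le_trans (lerD (lerD b1 b2') b3)).
  have : 2 * E <= 2 * q * E by rewrite ler_wpM2r// ler_peMr.
  rewrite /C3; move: (expR D) (E) (c1) (q) => u v w z; lra.
apply: (le_trans main).
have q0 : 0 <= q by exact: powR_ge0.
apply: ler_pM; rewrite ?mulr_ge0 ?expR_ge0 ?(ltW C30)//.
  by rewrite ler_wpM2r// lerDr ltW.
rewrite ler_expR lerN2 ler_wpM2l// ler_wsqrtr// lerD2l lerN2 ler_wpM2r//.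
  by rewrite invr_ge0 mulr_ge0 ?(ltW a0) ?(ltW y0).
by rewrite ler_wpM2r// ler_wpM2l// lerDl ltW.
Unshelve. all: by end_near. Qed.

End UpperBound.

Lemma powR_near (R : realType) (e M : R) : 0 < e -> \forall x \near +oo, M <= x `^ e.
Proof.
move=> e0; near=> x.
have x0 : 0 <= x by near: x; apply: nbhs_pinfty_ge; exact: num_real.
have xM : `|M| `^ e^-1 <= x by near: x; apply: nbhs_pinfty_ge; exact: num_real.
have := ge0_ler_powR (ltW e0) (powR_ge0 _ _) x0 xM.
rewrite -powRrM mulVf ?gt_eqF// powRr1//.
by apply: le_trans; exact: ler_norm.
Unshelve. all: by end_near. Qed.

(** * The expected duration as a sum of survival probabilities *)

Section ExpectedDuration.
Context {d : measure_display} {T : measurableType d} {R : realType}.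
Variables (P : probability T R) (X : nat -> {RV P >-> R}).

Lemma sum_indic_positive_until K w :
  \sum_(k < K) \1_(positive_until X k) w =
  (if tau_opt X w is Some m then minn K m else K)%:R :> R.
Proof.
have [[n -> [pn Sn]]|[-> pn]] := tau_optP X w; elim: K => [|K IH]; rewrite ?big_ord0//.
- rewrite big_ord_recr /= IH indicE.
  have [Kn|nK] := leqP K n.
    rewrite mem_set ?natr1 => [|k /andP[k0 kK]]; last by apply: pn; rewrite k0 (leq_trans kK).
    by congr _%:R; rewrite !/minn; do 2 case: ifP; lia.
  rewrite memNset; last first.
    by move=> /(_ n.+1); rewrite nK /= => /(_ isT); rewrite ltNge Sn.
  by rewrite addr0; congr _%:R; rewrite !/minn; do 2 case: ifP; lia.
- by rewrite big_ord_recr /= IH indicE mem_set// natr1.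
Qed.

(** Monotone convergence for [min K tau], the number of [k < K] with [tau > k]. The form with a real
    [c] also covers an infinite expectation. *)
Lemma Etau_gt c : (c%:E < Etau X)%E ->
  exists K, c < \sum_(k < K) pr P (positive_until X k).
Proof.
move=> cE.
pose f K w := (\sum_(k < K) (\1_(positive_until X k) w : R))%:E.
have mf K : measurable_fun setT (f K).
  apply/measurable_EFinP; apply: measurable_sum => k; apply: measurable_indic.
  exact: measurable_positive_until.
have f0 K w : setT w -> (0 <= f K w)%E by move=> _; rewrite lee_fin sumr_ge0.
have ndf w : setT w -> {homo f ^~ w : n m / (n <= m)%N >-> (n <= m)%E}.
  move=> _ n m nm; rewrite lee_fin !sum_indic_positive_until ler_nat.
  by case: tau_opt => // k; rewrite /minn; do 2 case: ifP; lia.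
have flim w : limn (f ^~ w) = tau X w.
  rewrite /tau; case E: (tau_opt X w) => [n|].
    apply: lim_near_cst => //; near=> K.
    rewrite /f sum_indic_positive_until E; congr (_%:R)%:E; apply/minn_idPr.
    by near: K; exact: nbhs_infty_ge.
  apply/cvg_lim => //; rewrite (_ : f ^~ w = fun K => (K%:R : R)%:E).
    exact/cvgenyP.
  by apply/funext => K; rewrite /f sum_indic_positive_until E.
have fint K : (\int[P]_w f K w = (\sum_(k < K) pr P (positive_until X k))%:E)%E.
  rewrite /f; under eq_integral do rewrite -sumEFin.
  rewrite ge0_integral_sum//; last first.
  - by move=> k; apply/measurable_EFinP; apply: measurable_indic; exact: measurable_positive_until.
  rewrite -sumEFin; apply: eq_bigr => k _.
  rewrite integral_indic//; last exact: measurable_positive_until.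
  by rewrite setIT -prE//; exact: measurable_positive_until.
apply: contrapT => nK.
have := cvg_monotone_convergence (mu := P) measurableT mf f0 ndf.
under eq_fun do rewrite fint.
under [in X in _ --> X]eq_integral do rewrite flim.
rewrite -/(Etau X) => /cvg_lim-/(_ (@ereal_hausdorff R)) h.
move: cE; rewrite -h ltNge => /negP; apply.
apply: lime_le.
  apply: ereal_nondecreasing_is_cvgn => n m nm; rewrite -!fint.
  by apply: ge0_le_integral => // w _; [exact: f0|exact: ndf].
near=> K; rewrite lee_fin leNgt; apply/negP => cK; apply: nK; by exists K.
Unshelve. all: by end_near. Qed.

End ExpectedDuration.

(** * The walk restarted after a given step *)

Section Shift.
Context {d : measure_display} {T : measurableType d} {R : realType}.
Variables (P : probability T R).
Implicit Types (X : nat -> {RV P >-> R}).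

Definition shifted X k : nat -> {RV P >-> R} := fun i => X (k + i)%N.

Lemma shift_independent X k : mutually_independent X -> mutually_independent (shifted X k).
Proof.
move=> iX s B us mB.
pose B' i := B (i - k)%N.
have := iX [seq (k + i)%N | i <- s] B'.
rewrite map_inj_uniq; last exact: addnI.
move=> /(_ us (fun i => mB _)); rewrite big_map /B'.
under eq_bigr do rewrite addKn.
move=> <-; congr (P _); apply/seteqP; split=> w /= h i /=.
  by move=> /mapP[j js ->]; rewrite addKn; exact: (h j).
move=> is_; have := h (k + i)%N; rewrite /= addKn; apply.
exact: map_f.
Qed.

Lemma Ssum_shift X k j w : Ssum X (k + j) w = Ssum X k w + Ssum (shifted X k) j w.
Proof. by rewrite /Ssum big_split_ord. Qed.

Lemma adapted_shift X k n I : (forall i, (k <= i)%N -> I i) ->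
  adapted X I (Ssum (shifted X k) n).
Proof.
move=> kI; apply: (@adapted_sum _ _ _ _ X I n (fun i => shifted X k i)) => i _.
by apply: (@adaptedX _ _ _ _ X I (k + i)%N); apply: kI; rewrite leq_addr.
Qed.

Lemma pr_past_jump_future X k (A E : set T) (B : set R) : mutually_independent X ->
  <<s generators X [set i | (i < k)%N] >> A -> measurable B ->
  <<s generators X [set i | (k < i)%N] >> E ->
  pr P (A `&` X k @^-1` B `&` E) = pr P A * pr P (X k @^-1` B) * pr P E.
Proof.
move=> iX sA mB sE.
have mA := sigma_measurable sA; have mE := sigma_measurable sE.
have sB : <<s generators X [set k] >> (X k @^-1` B).
  by apply: sub_sigma_algebra; exists k => //; exists B.
have mXB := sigma_measurable sB.
pose I := [set i | (i <= k)%N].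
have sub (J : set nat) C : J `<=` I -> <<s generators X J >> C -> <<s generators X I >> C.
  move=> JI; apply: sub_smallest2r; first exact: smallest_sigma_algebra.
  by move=> _ [i Ji [D mD ->]]; exists i; [exact: JI|exists D].
have sAB : <<s generators X I >> (A `&` X k @^-1` B).
  apply: (@measurableI _ (g_sigma_algebraType (generators X I))).
    by apply: sub sA => i /= /ltnW.
  by apply: sub sB => i /= ->; rewrite /I /=.
have d1 : I `&` [set i | (k < i)%N] = set0.
  by apply/seteqP; split=> // i []; rewrite /I /= => h1 h2; lia.
have e1 := sigma_independent iX d1 sAB sE.
have e2 := sigma_independent iX (below_above_disjoint k) sA sB.
have mAB := measurableI _ _ mA mXB.
have mABE := measurableI _ _ mAB mE.
by apply: EFin_inj; rewrite !EFinM -!prE// e1 e2.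
Qed.

End Shift.

(** * One big jump forces a large area *)

Section JumpExcursion.
Context {d : measure_display} {T : measurableType d} {R : realType}.
Variables (P : probability T R) (X : nat -> {RV P >-> R}) (a : R).
Hypothesis (a0 : 0 < a).

(** After the jump the walk is above [y + L - j a] for all [j <= m]: one [L] absorbs the
    fluctuations, the other keeps the walk positive while [j a <= y]. These [m + 1] heights already
    sum to at least [y ^ 2 / (2 a)], and the other heights before [tau] are nonnegative. *)
Lemma jump_area (L x y z : R) k m w : 0 < L -> 0 <= y -> z = y + 2 * L ->
  m%:R * a <= y -> y <= m.+1%:R * a -> 2 * a * x <= y ^+ 2 ->
  positive_until X k w -> z < X k w ->
  (forall j, (j <= m)%N -> `|Ssum (shifted X k.+1) j w + j%:R * a| < L) ->
  (x%:E < Atau X w)%E.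
Proof.
move=> L0 y0 zE my ym xy pk zX fl.
have Sk0 : 0 <= Ssum X k w.
  by case: k pk {zX fl} => [|k] pk; [rewrite Ssum0|apply/ltW; apply: pk; rewrite leqnn].
have low j : (j <= m)%N -> y + L - j%:R * a < Ssum X (k.+1 + j) w.
  move=> jm; rewrite Ssum_shift SsumS.
  have := fl j jm; rewrite ltr_norml => /andP[h _]; lra.
have pos j : (j <= m)%N -> 0 < Ssum X (k.+1 + j) w.
  move=> jm; apply: le_lt_trans (low j jm).
  have : (j%:R : R) * a <= m%:R * a by rewrite ler_wpM2r ?ler_nat ?ltW.
  by move: L0 my; lra.
have pkm : positive_until X (k.+1 + m) w.
  move=> i /andP[i0 im]; have [ik|ki] := leqP i k; first by apply: pk; rewrite i0.
  by have := pos (i - k.+1)%N; rewrite subnKC//; apply; lia.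
rewrite /Atau; have [[n -> [pn Sn]]|[-> _]] := tau_optP X w; last exact: ltry.
have kmn : (k.+1 + m <= n)%N.
  rewrite leqNgt; apply/negP => h.
  have := pkm n.+1; rewrite h /= => /(_ isT); by rewrite ltNge Sn.
have S0 i : (i <= n)%N -> 0 <= Ssum X i w.
  by case: i => [|i] h; [rewrite Ssum0|apply/ltW; apply: pn].
rewrite lte_fin.
rewrite -(big_mkord xpredT (fun i => Ssum X i w)).
rewrite (@big_cat_nat _ _ _ k.+1)//=; last by lia.
rewrite (@big_cat_nat _ _ _ (k.+1 + m.+1) k.+1)//=; [|lia|lia].
have s1 : 0 <= \sum_(0 <= i < k.+1) Ssum X i w.
  by rewrite big_nat sumr_ge0// => i /andP[_ h]; apply: S0; lia.
have s3 : 0 <= \sum_(k.+1 + m.+1 <= i < n.+1) Ssum X i w.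
  by rewrite big_nat sumr_ge0// => i /andP[_ h]; apply: S0; lia.
have s2 : \sum_(j < m.+1) (y + L - j%:R * a) < \sum_(k.+1 <= i < k.+1 + m.+1) Ssum X i w.
  have -> : \sum_(k.+1 <= i < k.+1 + m.+1) Ssum X i w = \sum_(j < m.+1) Ssum X (k.+1 + j) w.
    rewrite -[X in \sum_(X <= _ < _) _]add0n big_addn addKn big_mkord.
    by apply: eq_bigr => j _; rewrite addnC.
  rewrite -(big_mkord xpredT (fun j => y + L - j%:R * a)).
  rewrite -(big_mkord xpredT (fun j => Ssum X (k.+1 + j) w)).
  by apply: ltr_sum_nat => // j /andP[_ jm]; apply: low.
have e2 p : \sum_(j < p) (y + L - j%:R * a) = p%:R * (y + L) - a * (p%:R * (p%:R - 1)) / 2.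
  elim: p => [|p IH]; first by rewrite big_ord0; field.
  by rewrite big_ord_recr IH /= -natr1; field.
suff : x <= \sum_(j < m.+1) (y + L - j%:R * a) by lra.
rewrite e2; move: my ym; rewrite -natr1; have : (0 : R) <= m%:R by [].
move: (m%:R : R) => u u0 my ym.
have -> : (u + 1) * (y + L) - a * ((u + 1) * (u + 1 - 1)) / 2 =
   (u + 1) * (y / 2 + L) + (u + 1) * (y - u * a) / 2 by field.
have h1 : 0 <= (u + 1) * (y - u * a) by rewrite mulr_ge0//; lra.
have h2 : 0 <= (u + 1) * L by rewrite mulr_ge0 ?(ltW L0)//; lra.
have h3 : y * y <= (u + 1) * a * y by rewrite ler_wpM2r.
suff : a * x <= a * ((u + 1) * y / 2).
  rewrite ler_pM2l//; lra.
by move: xy; rewrite expr2; lra.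
Qed.

End JumpExcursion.

(** * The lower bound *)

Lemma pr_disjoint_sum d (T : measurableType d) (R : realType) (P : probability T R)
    n (F : nat -> set T) (A : set T) :
  measurable A -> (forall i, measurable (F i)) -> trivIset `I_n F ->
  (forall i, (i < n)%N -> F i `<=` A) -> \sum_(i < n) pr P (F i) <= pr P A.
Proof.
move=> mA mF tF FA.
have mU : measurable (\big[setU/set0]_(i < n) F i) by exact: bigsetU_measurable.
have e := measure_semi_additive_ord_I P (fun k _ => mF k) tF mU.
rewrite -lee_fin -sumEFin.
have -> : (\sum_(i < n) (pr P (F i))%:E = \sum_(i < n) P (F i))%E.
  by apply: eq_bigr => i _; rewrite -prE.
apply: (le_trans (eq_implies_le (esym e))); rewrite -prE// le_measure ?inE//.
by rewrite -(@bigcup_mkord _ n F) => w [i ni Fw]; exact: (FA i ni).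
Qed.

Section LowerBound.
Context {d : measure_display} {T : measurableType d} {R : realType}.
Variables (P : probability T R) (X : nat -> {RV P >-> R}) (a : R) (g : R -> R).
Hypotheses (iX : iid X) (a0 : 0 < a)
  (intX : P.-integrable setT (EFin \o X 0%N))
  (EX : ('E_P[X 0%N] = (- a)%:E)%E)
  (X2 : P.-integrable setT (EFin \o (fun w => X 0%N w ^+ 2)))
  (tailg : (fun x => Fbar X x / (expR (- g x) * x ^- 2)) @ +oo --> (1:R))
  (gdec : forall x y, 0 < x -> x <= y -> g y / y <= g x / x)
  (glim : (fun x => g x / x) @ +oo --> (0:R)).

Let m2 := second_moment X.

Definition small_fluctuation k m (L : R) : set T :=
  [set w | forall j, (j <= m)%N -> `|Ssum (shifted X k.+1) j w + j%:R * a| < L].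

Lemma adapted_small_fluctuation k m L :
  <<s generators X [set i | (k < i)%N] >> (small_fluctuation k m L).
Proof.
pose GT := g_sigma_algebraType (generators X [set i | (k < i)%N]).
have -> : small_fluctuation k m L = \bigcap_(j in [set j | (j < m.+1)%N])
    [set w | `|Ssum (shifted X k.+1) j w + j%:R * a| < L].
  by apply/seteqP; split=> w /= h j; exact: h.
apply: (@fin_bigcap_measurable _ GT) => [|j _]; first exact: finite_II.
apply: (@measurable_lt_set _ GT) => //; apply: measurableT_comp => //.
by apply: measurable_funD => //; exact: adapted_shift.
Qed.

Lemma pr_small_fluctuation k m L : 0 < L ->
  1 - m%:R * m2 / L ^+ 2 <= pr P (small_fluctuation k m L).
Proof.
move=> L0.
have mF : measurable (small_fluctuation k m L).
  exact: (@sigma_measurable _ _ _ _ X [set i | (k < i)%N] _ (@adapted_small_fluctuation k m L)).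
have : pr P (~` small_fluctuation k m L) <= m%:R * m2 / L ^+ 2.
  apply: (@pr_max_walk _ _ _ _ (shifted X k.+1) L a m2 m) => //.
  - exact/shift_independent/iX.1.
  - exact: second_moment_ge0.
  - by move=> i u; exact: (centered_second_moment iX.2 intX EX X2).
  - exact: measurableC.
  - move=> w /existsNP[j /not_implyP[jm]] /negP; rewrite -leNgt => h.
    by exists j.
rewrite pr_setC//; lra.
Qed.

(** Staying positive up to [j] forces a deviation [j a] of the centred walk. The decay [1 / j] is
    what makes the partial sums of [P (tau > j)] logarithmic. *)
Lemma pr_positive_until j : (0 < j)%N -> pr P (positive_until X j) <= m2 / a ^+ 2 / j%:R.
Proof.
move=> j0; have j0' : (0 : R) < j%:R by rewrite ltr0n.
have -> : m2 / a ^+ 2 / j%:R = j%:R * m2 / (j%:R * a) ^+ 2 by field; rewrite !gt_eqF.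
apply: (@pr_max_walk _ _ _ _ X _ a m2 j).
- exact: iX.1.
- exact: second_moment_ge0.
- by move=> i u; exact: (centered_second_moment iX.2 intX EX X2).
- by rewrite mulr_gt0.
- exact: measurable_positive_until.
- move=> w pj; exists j => //; apply: le_trans (ler_norm _).
  by rewrite lerDr ltW//; apply: pj; rewrite j0 leqnn.
Qed.

(** The event is split by the time [k < K] of the first jump above [z], which makes the pieces
    disjoint. Excluding earlier jumps costs at most [K Fbar z] for each [k], hence the term
    [K ^ 2 Fbar z]. *)
Lemma area_tail_lower_sum (L x y z : R) K m : 0 < L -> 0 <= y -> z = y + 2 * L ->
  m%:R * a <= y -> y <= m.+1%:R * a -> 2 * a * x <= y ^+ 2 ->
  m%:R * m2 / L ^+ 2 <= 1 ->
  Fbar X z * ((1 - m%:R * m2 / L ^+ 2) *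
    (\sum_(k < K) pr P (positive_until X k) - K%:R ^+ 2 * Fbar X z)) <= PAtau_gt X x.
Proof.
move=> L0 y0 zE my ym xy d1; set dl := m%:R * m2 / L ^+ 2.
pose past k := positive_until X k `&` [set w | forall i, (i < k)%N -> X i w <= z].
pose D k := past k `&` X k @^-1` `]z, +oo[ `&` small_fluctuation k m L.
have sN k : <<s generators X [set i | (i < k)%N] >> [set w | forall i, (i < k)%N -> X i w <= z].
  pose GT := g_sigma_algebraType (generators X [set i | (i < k)%N]).
  have -> : [set w | forall i, (i < k)%N -> X i w <= z] =
      \bigcap_(i in [set i | (i < k)%N]) [set w | X i w <= z].
    by apply/seteqP; split=> w /= h j; exact: h.
  apply: (@fin_bigcap_measurable _ GT) => [|i ik]; first exact: finite_II.
  by apply: (@measurable_le_set _ GT) => //; exact: (@adaptedX _ _ _ _ X [set i | (i < k)%N] i ik).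
have spast k : <<s generators X [set i | (i < k)%N] >> (past k).
  apply: (@measurableI _ (g_sigma_algebraType (generators X [set i | (i < k)%N]))).
    exact: adapted_positive_until.
  exact: sN.
have mpast k : measurable (past k).
  exact: (@sigma_measurable _ _ _ _ X [set i | (i < k)%N] (past k) (spast k)).
have mD k : measurable (D k).
  apply: measurableI.
    by apply: measurableI => //; exact: measurable_preimageX.
  exact: (@sigma_measurable _ _ _ _ X [set i | (k < i)%N] _ (@adapted_small_fluctuation k m L)).
have jumpE k : X k @^-1` `]z, +oo[ = [set w | z < X k w].
  by apply/seteqP; split=> w /=; rewrite in_itv /= andbT.
have DE k : pr P (D k) = pr P (past k) * Fbar X z * pr P (small_fluctuation k m L).
  rewrite /D (pr_past_jump_future iX.1 (spast k))//; last exact: adapted_small_fluctuation.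
  by rewrite jumpE (pr_tail iX.2).
have pastE k : (k < K)%N -> pr P (positive_until X k) - K%:R * Fbar X z <= pr P (past k).
  move=> kK; rewrite lerBlDr.
  pose J := \big[setU/set0]_(i < k) [set w | z < X i w].
  have mJ : measurable J by apply: bigsetU_measurable => i _; exact: measurable_jump.
  have mpos := measurable_positive_until X k.
  apply: (@le_trans _ _ (pr P (past k `|` J))).
    apply: pr_le => //; first exact: measurableU.
    move=> w pw; have [h|/existsNP[i /not_implyP[ik /negP]]] :=
      pselect (forall i, (i < k)%N -> X i w <= z); first by left.
    rewrite -ltNge => zX; right.
    by rewrite /J -(@bigcup_mkord _ k (fun i => [set w | z < X i w])); exists i.
  apply: le_trans (pr_setU P (mpast k) mJ) _; rewrite lerD2l.
  apply: (@le_trans _ _ (\sum_(i < k) pr P [set w | z < X i w])).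
    apply: (@pr_cover_ord _ _ _ P k (fun i => [set w | z < X i w])) => //.
      by move=> i; exact: measurable_jump.
    move=> w; rewrite /J -(@bigcup_mkord _ k (fun i => [set w | z < X i w])) => -[i ik h].
    by exists i.
  under eq_bigr do rewrite (pr_tail iX.2).
  rewrite sumr_const card_ord -[leLHS]mulr_natl ler_wpM2r ?Fbar_ge0// ler_nat.
  exact: ltnW.
apply: (@le_trans _ _ (\sum_(k < K) pr P (D k))); last first.
  apply: pr_disjoint_sum => //.
  - exact: measurable_Atau_gt.
  - apply/trivIsetP => i j _ _ ij; apply/seteqP; split=> // w [[[[pi hi] zi] _] [[[pj hj] zj] _]].
    move: zi zj; rewrite !jumpE /= => zi zj.
    have [lij|lji|/eqP] := ltngtP i j; last by rewrite (negPf ij).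
      by have := hj i lij; rewrite leNgt zi.
    by have := hi j lji; rewrite leNgt zj.
  - move=> k _ w [[[pk hk]]]; rewrite jumpE /= => zX fl.
    exact: (jump_area a0 L0 y0 zE my ym xy pk zX fl).
apply: (@le_trans _ _ (\sum_(k < K) (Fbar X z * ((1 - dl) *
     (pr P (positive_until X k) - K%:R * Fbar X z))))).
  rewrite -mulr_sumr -mulr_sumr sumrB sumr_const card_ord -(mulr_natl (K%:R * Fbar X z)).
  by apply: eq_implies_le; ring.
apply: ler_sum => k _; rewrite DE (mulrC (pr P (past k))) -(mulrA (Fbar X z)) ler_wpM2l ?Fbar_ge0//.
have h1 := pastE k (ltn_ord k); have h2 := @pr_small_fluctuation k m L L0.
have dl1 : 0 <= 1 - dl by rewrite subr_ge0.
(* The difference bounded in [pastE] may be negative, so it is replaced by [pr P (past k)] before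
   [1 - dl] is replaced by a probability. *)
apply: (@le_trans _ _ ((1 - dl) * pr P (past k))); first by rewrite ler_wpM2l.
by rewrite mulrC ler_wpM2l ?pr_ge0.
Qed.

Lemma Fbar_small eta : 0 < eta -> exists M, forall z, M <= z -> Fbar X z <= eta.
Proof.
move=> eta0; have [t0 t01 tail] := tail_two_sided tailg.
exists (t0 + 2 / eta) => z zM.
have e0 : 0 < 2 / eta by rewrite divr_gt0.
have zt : t0 <= z by lra.
have z1 : 1 <= z by lra.
have z0 : 0 < z by lra.
have /tail/andP[_] := zt; move/le_trans; apply.
have g1 : expR (- g z) <= 1.
  by rewrite -expR0 ler_expR oppr_le0 (g_ge0 gdec glim).
have zi : z ^- 2 <= z^-1.
  by rewrite lef_pV2 ?posrE ?exprn_gt0// expr2 ler_peMr// ltW.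
have zz : z^-1 <= eta / 2.
  rewrite -[leRHS]invrK lef_pV2 ?posrE ?invr_gt0 ?divr_gt0// invf_div; lra.
have h : expR (- g z) * z ^- 2 <= 1 * z^-1.
  by apply: ler_pM => //; rewrite ?expR_ge0 ?invr_ge0 ?exprn_ge0// ltW.
lra.
Qed.

(** With [L = x ^ (1/4 + eps)] and about [y / a] steps, the failure probability in Kolmogorov's
    inequality is of order [x ^ (- 2 eps)]. *)
Lemma area_tail_lower eps c K : 0 < eps ->
  c < \sum_(k < K) pr P (positive_until X k) ->
    \forall x \near +oo,
      c <= PAtau_gt X x / Fbar X (Num.sqrt (2 * a * x) + 2 * x `^ (4^-1 + eps)).
Proof.
move=> eps0 cK.
pose S := \sum_(k < K) pr P (positive_until X k).
have S0 : 0 <= S by apply: sumr_ge0 => k _; exact: pr_ge0.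
have m20 : 0 <= m2 by exact: second_moment_ge0.
pose eta := S - c.
have eta0 : 0 < eta by rewrite subr_gt0.
have K0 : 0 < K%:R ^+ 2 + 1 :> R by rewrite ltr_wpDl ?sqr_ge0.
have e1 : 0 < eta / 2 / (K%:R ^+ 2 + 1) by rewrite !divr_gt0.
have [M1 FM1] := Fbar_small e1.
have [t0 t01 tail] := tail_two_sided tailg.
pose s := Num.sqrt (2 * a).
have s0 : 0 < s by rewrite sqrtr_gt0 mulr_gt0.
(* Half of the gap [eta = S - c] pays for the fluctuations, the other half for [K ^ 2 Fbar z]. *)
pose b := Num.min 1 (eta / 2 / (S + 1)).
have b0 : 0 < b by rewrite lt_min ltr01 !divr_gt0// ltr_wpDl.
near=> x.
have x1 : 1 <= x by near: x; apply: nbhs_pinfty_ge; exact: num_real.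
have x0 : 0 < x by exact: lt_le_trans x1.
set y := Num.sqrt (2 * a * x); set L := x `^ (4^-1 + eps).
have [yM yt0] : M1 <= y /\ t0 <= y.
  by split; rewrite /y; near: x; apply: sqrt_near; rewrite mulr_gt0.
have pp : s * m2 / a / b + 1 <= x `^ eps by near: x; exact: powR_near.
have LE : L = x `^ 4^-1 * x `^ eps by rewrite /L powRD//; apply/implyP => _; rewrite gt_eqF.
have L0 : 0 < L by exact: powR_gt0.
have y0 : 0 <= y by exact: sqrtr_ge0.
have y2 : y ^+ 2 = 2 * a * x by rewrite sqr_sqrtr// !mulr_ge0// ltW.
have /andP[t1 t2] : (Num.truncn (y / a))%:R <= y / a < (Num.truncn (y / a)).+1%:R.
  by apply: truncn_itv; rewrite divr_ge0// ltW.
set m := Num.truncn (y / a) in t1 t2.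
have my : m%:R * a <= y by rewrite -ler_pdivlMr.
have ym : y <= m.+1%:R * a by rewrite -ler_pdivrMr// ltW.
have dlb : m%:R * m2 / L ^+ 2 <= b.
  rewrite LE exprMn root4E ?(ltW x0)//.
  have sx0 : 0 < Num.sqrt x by rewrite sqrtr_gt0.
  have p0 : 0 < x `^ eps by exact: powR_gt0.
  have p1 : 1 <= x `^ eps.
    by apply: le_trans pp; rewrite lerDr !divr_ge0 ?mulr_ge0 ?(ltW s0) ?(ltW a0) ?(ltW b0).
  rewrite ler_pdivrMr ?mulr_gt0 ?exprn_gt0//.
  apply: (@le_trans _ _ (y / a * m2)); first by rewrite ler_wpM2r.
  rewrite /y sqrtrM; last by rewrite mulr_ge0// ltW.
  rewrite -/s.
  have h1 : s * m2 / a <= b * x `^ eps.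
    by rewrite [leRHS]mulrC -ler_pdivrMr//; apply: le_trans pp; rewrite lerDl.
  have h2 : b * x `^ eps <= b * x `^ eps ^+ 2.
    by rewrite ler_wpM2l ?(ltW b0)// expr2 ler_peMr// ltW.
  have -> : s * Num.sqrt x / a * m2 = s * m2 / a * Num.sqrt x by field; rewrite gt_eqF.
  rewrite [Num.sqrt x * _]mulrC mulrA ler_wpM2r ?(ltW sx0)//.
  exact: le_trans h2.
have /andP[d1 d2] : (m%:R * m2 / L ^+ 2 <= 1) && (m%:R * m2 / L ^+ 2 <= eta / 2 / (S + 1)).
  by move: dlb; rewrite le_min.
have d0 : 0 <= m%:R * m2 / L ^+ 2 by rewrite divr_ge0 ?sqr_ge0// mulr_ge0.
set z := y + 2 * L.
have zy : y <= z by rewrite lerDl mulr_ge0// ltW.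
have Fz0 : 0 < Fbar X z.
  have z0 : 0 < z by rewrite (lt_le_trans _ zy)// (lt_le_trans _ yt0)// (lt_le_trans ltr01).
  have /tail/andP[+ _] := le_trans yt0 zy; apply: lt_le_trans.
  by rewrite divr_gt0// mulr_gt0 ?expR_gt0// invr_gt0 exprn_gt0.
have Fz1 := FM1 z (le_trans yM zy).
rewrite ler_pdivlMr//.
have := area_tail_lower_sum K L0 y0 erefl my ym (_ : 2 * a * x <= y ^+ 2) d1.
rewrite y2 lexx -/z => /(_ isT); apply: le_trans.
rewrite mulrC ler_wpM2l ?(ltW Fz0)//.
move: d0 d1 d2 Fz1 Fz0; rewrite -/S.
have K20 : 0 <= K%:R ^+ 2 :> R by exact: sqr_ge0.
move: (m%:R * m2 / L ^+ 2) (Fbar X z) => u F u0 u1 u2 F1 F0.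
have v1 : u * (S + 1) <= eta / 2 by rewrite -ler_pdivlMr// ltr_wpDl.
have v2 : F * (K%:R ^+ 2 + 1) <= eta / 2 by rewrite -ler_pdivlMr.
have v3 : 0 <= u * (K%:R ^+ 2 * F) by rewrite !mulr_ge0// ltW.
move: v1 v2 v3; rewrite /eta; lra.
Unshelve. all: by end_near. Qed.

End LowerBound.

(** * Decomposition at the first big jump *)

Section FirstBigJump.
Context {d : measure_display} {T : measurableType d} {R : realType}.
Variables (P : probability T R) (X : nat -> {RV P >-> R}).

Definition high_without_jump (h b : R) n : set T :=
  [set w | exists2 j, (j <= n)%N & (forall i, (i < j)%N -> X i w <= b) /\ h < Ssum X j w].

Definition positive_without_jump (b : R) n : set T :=
  [set w | (forall i, (i < n)%N -> X i w <= b) /\ 0 < Ssum X n w].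

Lemma measurable_positive_without_jump b n : measurable (positive_without_jump b n).
Proof.
apply: measurableI; first exact: measurable_nojump.
by apply: measurable_lt_set => //; exact: measurable_Ssum.
Qed.

Lemma measurable_high_without_jump h b n : measurable (high_without_jump h b n).
Proof.
have -> : high_without_jump h b n = \bigcup_(j in [set j | (j <= n)%N])
   ([set w | forall i, (i < j)%N -> X i w <= b] `&` [set w | h < Ssum X j w]).
  by apply/seteqP; split=> w [j h1 h2]; exists j.
apply: bigcup_measurable => j _; apply: measurableI; first exact: measurable_nojump.
by apply: measurable_lt_set => //; exact: measurable_Ssum.
Qed.

Lemma level_of_jump (h s y : R) n : 0 < h -> 0 < s -> s <= y -> y <= n%:R * h ->
  exists2 l, (l < n)%N & l%:R * h < s <= l.+1%:R * h.
Proof.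
move=> h0 s0 sy yn.
have n0 : (0 < n)%N by case: n yn => //; rewrite mul0r => ?; lra.
have ex : exists l, s <= l.+1%:R * h by exists n.-1; rewrite prednK//; exact: le_trans yn.
have [l sl lmin] := ex_minnP ex; exists l.
  by have := lmin n.-1; rewrite prednK// => /(_ (le_trans sy yn)); lia.
rewrite sl andbT; case: l lmin {sl} => [|l] lmin; first by rewrite mul0r.
by rewrite ltNge; apply/negP => /lmin; rewrite ltnn.
Qed.

(** A walk that stays below [h] and ends before [n0] has area at most [n0 h <= x]. So, unless one of
    the first two events occurs, some jump exceeds [b] before [n0]; the first one happens before
    [tau], at height at most [h], with area at most [n0 h] so far. The size of the jump is
    discretised in steps of [h]. *)
Lemma first_big_jump (x y h b : R) n0 n1 L w : 0 < h -> 0 < b -> (0 < n0)%N ->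
  n0%:R * h <= x -> y <= L%:R * h -> (x%:E < Atau X w)%E ->
  [\/ high_without_jump h b n0 w, positive_without_jump b n0 w |
    exists2 j, (j < n0)%N & positive_until X j w /\ (y < X j w \/
      exists2 l, (l < L)%N & Num.max (l%:R * h) b < X j w /\
        large_area (shifted X j.+1) (l.+2%:R * h) (x - n0%:R * h) n1 w)].
Proof.
move=> h0 b0 n00 n0h yL; rewrite /Atau => xA.
have [|nH] := pselect (high_without_jump h b n0 w); first by constructor 1.
have short n : (n < n0)%N -> (forall i, (i <= n)%N -> Ssum X i w <= h) ->
    tau_opt X w = Some n.+1 -> False.
  move=> nn0 low tn; move: xA; rewrite tn lte_fin ltNge => /negP; apply.
  apply: le_trans n0h; apply: (@le_trans _ _ (\sum_(k < n.+1) h)).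
    by apply: ler_sum => k _; apply: low; rewrite -ltnS.
  by rewrite sumr_const card_ord -[leLHS]mulr_natl ler_wpM2r ?(ltW h0)// ler_nat.
have [[i0 hi0]|nJ] := pselect (exists i, (i < n0)%N && (b < X i w)); last first.
  have Xb i : (i < n0)%N -> X i w <= b.
    by move=> i_n; rewrite leNgt; apply/negP => h'; apply: nJ; exists i; rewrite i_n.
  have low i : (i <= n0)%N -> Ssum X i w <= h.
    move=> i_n; rewrite leNgt; apply/negP => hS; apply: nH; exists i => //; split=> // k ki.
    by apply: Xb; exact: leq_trans i_n.
  constructor 2; split=> //.
  have [[n tn [pn Sn]]|[tn pn]] := tau_optP X w; last by apply: (pn n0); rewrite n00 leqnn.
  have [nn0|] := ltnP n n0.
    by exfalso; apply: (short n nn0) => // i i_n; apply: low; rewrite (leq_trans i_n)// ltnW.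
  by move=> n0n; apply: pn; rewrite n00.
have [j /andP[jn0 bX] jmin] := ex_minnP (ex_intro (fun i => (i < n0)%N && (b < X i w)) i0 hi0).
have Xb i : (i < j)%N -> X i w <= b.
  move=> ij; rewrite leNgt; apply/negP => h'; have := jmin i.
  by rewrite h' (ltn_trans ij jn0) => /(_ isT); rewrite leqNgt ij.
have low i : (i <= j)%N -> Ssum X i w <= h.
  move=> ij; rewrite leNgt; apply/negP => hS; apply: nH; exists i.
    by rewrite (leq_trans ij)// ltnW.
  by split=> // k ki; apply: Xb; exact: leq_trans ij.
have [pj|npj] := pselect (positive_until X j w); last first.
  exfalso; have [[n tn [pn Sn]]|[tn pn]] := tau_optP X w; last by apply: npj; exact: pn.
  have nj : (n < j)%N.
    rewrite ltnNge; apply/negP => jn; apply: npj => k /andP[k0 kj]; apply: pn.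
    by rewrite k0 (leq_trans kj).
  apply: (short n) => //; first exact: ltn_trans jn0.
  by move=> i i_n; apply: low; rewrite (leq_trans i_n)// ltnW.
constructor 3; exists j => //; split=> //.
have [Xy|yX] := leP (X j w) y; last by left.
right; have [l lL /andP[l1 l2]] := level_of_jump h0 (lt_trans b0 bX) Xy yL.
exists l => //; split; first by rewrite gt_max l1.
have Sj0 : 0 <= Ssum X j w.
  by case: {+}j pj => [|k] pj; [rewrite Ssum0|apply/ltW; apply: pj; rewrite leqnn].
(* [l + 1] levels bound the jump and one more bounds the height before it. *)
have up k : Ssum X (j.+1 + k) w <= l.+2%:R * h + Ssum (shifted X j.+1) k w.
  rewrite Ssum_shift SsumS lerD2r -natr1 mulrDl mul1r addrC.
  exact: lerD l2 (low j (leqnn j)).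
have Sj1 : 0 < Ssum X j.+1 w by rewrite SsumS ltr_wpDl// (lt_trans b0).
have pos_up n : positive_until X (j.+1 + n) w -> 0 < l.+2%:R * h + Ssum (shifted X j.+1) n w.
  by move=> pn; apply: lt_le_trans (up n); apply: pn; rewrite leqnn.
have [[n tn [pn Sn]]|[tn pn]] := tau_optP X w; last by right; exact: pos_up.
have jn : (j < n)%N.
  rewrite ltnNge; apply/negP => nj.
  have : 0 < Ssum X n.+1 w.
    have [->//|nj'] := eqVneq n j; by apply: pj; rewrite /= ltn_neqAle nj' nj.
  by rewrite ltNge Sn.
have pm m : (m <= n)%N -> positive_until X m w.
  by move=> mn k /andP[k0 km]; apply: pn; rewrite k0 (leq_trans km).
have [pn1|n1p] := ltnP (n - j.+1)%N n1; last first.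
  by right; apply: pos_up; apply: pm; rewrite -(subnKC jn) leq_add2l.
left; exists (n - j.+1)%N => //; split.
  by apply/ltW/pos_up/pm; rewrite subnKC.
move: xA; rewrite tn lte_fin => xA.
have e : \sum_(k < n.+1) Ssum X k w = \sum_(k < j.+1) Ssum X k w +
    \sum_(k < (n - j.+1).+1) Ssum X (j.+1 + k) w.
  rewrite -(@big_mkord _ _ _ n.+1 xpredT (fun k => Ssum X k w)).
  rewrite (@big_cat_nat _ _ _ j.+1)//=; last by rewrite ltnS ltnW.
  rewrite big_mkord; congr (_ + _).
  rewrite -[X in \sum_(X <= _ < _) _]add0n big_addn big_mkord.
  have -> : (n.+1 - j.+1 = (n - j.+1).+1)%N by rewrite subSS subnSK.
  by apply: eq_bigr => k _; rewrite addnC.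
have s1 : \sum_(k < j.+1) Ssum X k w <= n0%:R * h.
  apply: (@le_trans _ _ (\sum_(k < j.+1) h)).
    by apply: ler_sum => k _; apply: low; rewrite -ltnS.
  by rewrite sumr_const card_ord -[leLHS]mulr_natl ler_wpM2r ?(ltW h0)// ler_nat.
have s2 : \sum_(k < (n - j.+1).+1) Ssum X (j.+1 + k) w <=
    \sum_(k < (n - j.+1).+1) (l.+2%:R * h + Ssum (shifted X j.+1) k w).
  by apply: ler_sum => k _; exact: up.
rewrite ltrBlDr addrC; apply: lt_le_trans xA _; rewrite e; exact: lerD.
Qed.

(** Past, jump and future are independent, so the jump time enters only through [P (tau > j)]. *)
Lemma pr_first_big_jump (x y h b e1 e2 : R) n0 n1 L (Q : nat -> R) : iid X ->
  0 < h -> 0 < b -> (0 < n0)%N -> n0%:R * h <= x -> y <= L%:R * h ->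
  pr P (high_without_jump h b n0) <= e1 ->
  pr P (positive_without_jump b n0) <= e2 ->
  (forall j l, (l < L)%N ->
    pr P (large_area (shifted X j.+1) (l.+2%:R * h) (x - n0%:R * h) n1) <= Q l) ->
  PAtau_gt X x <= e1 + e2 + (\sum_(j < n0) pr P (positive_until X j)) *
    (Fbar X y + \sum_(l < L) Fbar X (Num.max (l%:R * h) b) * Q l).
Proof.
move=> iX h0 b0 n00 n0h yL he1 he2 hQ.
pose A j := positive_until X j `&` X j @^-1` `]y, +oo[ `&` setT.
pose la j l := large_area (shifted X j.+1) (l.+2%:R * h) (x - n0%:R * h) n1.
pose B j l := positive_until X j `&` X j @^-1` `]Num.max (l%:R * h) b, +oo[ `&` la j l.
have jumpE k z : X k @^-1` `]z, +oo[ = [set w | z < X k w].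
  by apply/seteqP; split=> w /=; rewrite in_itv /= andbT.
have sla j l : <<s generators X [set i | (j < i)%N] >> (la j l).
  apply: adapted_large_area => i _.
  by apply: (@adaptedX _ _ _ _ X [set i | (j < i)%N]); rewrite /= addSn ltnS leq_addr.
have mla j l : measurable (la j l) by exact: measurable_large_area.
have mpos j : measurable (positive_until X j) by exact: measurable_positive_until.
have mA j : measurable (A j).
  by apply: measurableI => //; apply: measurableI => //; exact: measurable_preimageX.
have mB j l : measurable (B j l).
  by apply: measurableI => //; apply: measurableI => //; exact: measurable_preimageX.
have prA j : pr P (A j) = pr P (positive_until X j) * Fbar X y.
  rewrite /A (pr_past_jump_future iX.1 (adapted_positive_until (n := j)))//; last first.
    exact: (@measurableT _ (g_sigma_algebraType (generators X [set i | (j < i)%N]))).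
  by rewrite jumpE (pr_tail iX.2) [pr P setT]/pr probability_setT /= mulr1.
have prB j l : (l < L)%N -> pr P (B j l) <=
    pr P (positive_until X j) * (Fbar X (Num.max (l%:R * h) b) * Q l).
  move=> lL; rewrite /B (pr_past_jump_future iX.1 (adapted_positive_until (n := j)))//.
  rewrite jumpE (pr_tail iX.2) -mulrA ler_wpM2l ?pr_ge0// ler_wpM2l ?Fbar_ge0//.
  exact: hQ.
pose G j := A j `|` \big[setU/set0]_(l < L) B j l.
have mG j : measurable (G j) by apply: measurableU => //; exact: bigsetU_measurable.
have prG j : pr P (G j) <= pr P (positive_until X j) *
    (Fbar X y + \sum_(l < L) Fbar X (Num.max (l%:R * h) b) * Q l).
  have mBU : measurable (\big[setU/set0]_(l < L) B j l) by exact: bigsetU_measurable.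
  apply: le_trans (pr_setU P (mA j) mBU) _; rewrite mulrDr prA lerD2l mulr_sumr.
  apply: le_trans (_ : _ <= \sum_(l < L) pr P (B j l)) _.
    apply: (@pr_cover_ord _ _ _ P L (B j)) => // w.
    by rewrite -(@bigcup_mkord _ L (B j)) => -[l lL Bw]; exists l.
  by apply: ler_sum => l _; exact: prB.
pose U := \big[setU/set0]_(j < n0) G j.
have mU : measurable U by exact: bigsetU_measurable.
pose H1 := high_without_jump h b n0; pose H2 := positive_without_jump b n0.
have mH1 : measurable H1 by exact: measurable_high_without_jump.
have mH2 : measurable H2 by exact: measurable_positive_without_jump.
have mH : measurable (H1 `|` H2) by exact: measurableU.
have mHU : measurable (H1 `|` H2 `|` U) by exact: measurableU.
have sub : [set w | (x%:E < Atau X w)%E] `<=` H1 `|` H2 `|` U.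
  move=> w /(first_big_jump n1 h0 b0 n00 n0h yL)[H1w|H2w|[j jn [pj c]]].
  - by left; left.
  - by left; right.
  - right; rewrite /U -(@bigcup_mkord _ n0 G); exists j => //.
    case: c => [yX|[l lL [mX lw]]]; first by left; split=> //; split=> //; rewrite jumpE.
    right; rewrite -(@bigcup_mkord _ L (B j)); exists l => //.
    by split=> //; split=> //; rewrite jumpE.
apply: le_trans (pr_le P (measurable_Atau_gt X x) mHU sub) _.
apply: le_trans (pr_setU P mH mU) _; apply: lerD.
  by apply: le_trans (pr_setU P mH1 mH2) _; exact: lerD.
rewrite mulr_suml.
apply: le_trans (_ : _ <= \sum_(j < n0) pr P (G j)) _.
  apply: (@pr_cover_ord _ _ _ P n0 G) => // w.
  by rewrite /U -(@bigcup_mkord _ n0 G) => -[j jn Gw]; exists j.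
by apply: ler_sum => j _; exact: prG.
Qed.

End FirstBigJump.

(** * Estimates and parameters for the logarithmic case *)

Lemma harmonic_le_ln (R : realType) n : (0 < n)%N ->
  \sum_(j < n) (j.+1%:R^-1 : R) <= 1 + ln n%:R.
Proof.
elim: n => // -[|n] IH _; first by rewrite big_ord_recl big_ord0 ln1 invr1.
rewrite big_ord_recr /=; apply: le_trans (lerD (IH isT) (lexx _)) _.
rewrite -addrA lerD2l.
have p1 : (0 : R) < n.+1%:R by [].
have p2 : (0 : R) < n.+2%:R by [].
have i1 : (n.+2%:R : R)^-1 < 1 by rewrite invf_lt1// ltr1n.
have e : n.+1%:R = (1 + - n.+2%:R^-1) * n.+2%:R :> R.
  by rewrite mulrDl mul1r mulNr mulVf ?gt_eqF// -[in RHS]natr1 addrK.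
have q0 : 0 < 1 + - (n.+2%:R^-1 : R) by rewrite subr_gt0.
rewrite e lnM ?posrE//.
have : ln (1 + - (n.+2%:R^-1 : R)) <= - n.+2%:R^-1 by apply: le_ln1Dx; rewrite ltrN2.
by rewrite addrAC -lerBrDr subrr -lerBrDr sub0r.
Qed.

(** A tilt of order [ln y / y] stays admissible although the moment constant grows like [sqrt y]:
    with [r = y ^ (1/4)] and [ln y <= 4 r], their product is of order [1 / r]. *)
Lemma log_tilt (R : realType) (m c t0 a M : R) : 0 <= m -> 0 <= c -> 0 < t0 -> 0 < a ->
  0 < M -> exists2 Y, 1 <= Y & forall y, Y <= y ->
    (m + c * expR (ln y / 2)) * (M * ln y / y) <= a / 2 /\ M * ln y / y <= t0^-1.
Proof.
move=> m0 c0 t00 a0 M0.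
pose r0 := 1 + 8 * M * (m + c) / a + 4 * M * t0.
have p1 : 0 <= 8 * M * (m + c) / a by rewrite divr_ge0 ?mulr_ge0 ?addr_ge0 ?(ltW M0) ?(ltW a0).
have p2 : 0 <= 4 * M * t0 by rewrite !mulr_ge0 ?(ltW M0) ?(ltW t00).
have r01 : 1 <= r0 by rewrite /r0; lra.
exists (r0 ^+ 4); first by rewrite exprn_ege1.
move=> y Yy.
have y1 : 1 <= y by apply: le_trans Yy; rewrite exprn_ege1.
have y0 : 0 < y by lra.
pose r := expR (ln y / 4).
have r4 : r ^+ 4 = y.
  by rewrite -expRM_natl (_ : 4%:R * _ = ln y) ?lnK ?posrE//; field.
have r2 : expR (ln y / 2) = r ^+ 2 by rewrite -expRM_natl; congr expR; field.
have rr0 : r0 <= r.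
  have : r0 ^+ 4 <= r ^+ 4 by rewrite r4.
  by rewrite ler_pXn2r ?nnegrE ?expR_ge0//; lra.
have rp : 0 < r by exact: expR_gt0.
have r1 : 1 <= r by lra.
have ly : ln y <= 4 * r.
  have : ln r < r by exact: ln_sublinear.
  by rewrite expRK; lra.
have lam4 : M * ln y / y <= 4 * M * r / r ^+ 4.
  rewrite r4 ler_wpM2r ?invr_ge0 ?(ltW y0)//.
  have : M * ln y <= M * (4 * r) by rewrite ler_wpM2l// ltW.
  by lra.
have ly0 : 0 <= ln y by exact: ln_ge0.
have lam0 : 0 <= M * ln y / y by rewrite divr_ge0 ?mulr_ge0 ?(ltW M0) ?(ltW y0).
split.
  rewrite r2.
  have k1 : m + c * r ^+ 2 <= (m + c) * r ^+ 2.
    by rewrite mulrDl lerD2r ler_peMr// exprn_ege1.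
  have k0 : 0 <= m + c * r ^+ 2 by rewrite addr_ge0// mulr_ge0// sqr_ge0.
  apply: le_trans (ler_pM k0 lam0 k1 lam4) _.
  have -> : (m + c) * r ^+ 2 * (4 * M * r / r ^+ 4) = 4 * M * (m + c) / r.
    by field; rewrite gt_eqF.
  rewrite ler_pdivrMr//.
  have : 8 * M * (m + c) / a <= r by move: rr0; rewrite /r0; lra.
  rewrite ler_pdivrMr//; lra.
apply: le_trans lam4 _.
have -> : 4 * M * r / r ^+ 4 = 4 * M / r ^+ 3 by field; rewrite gt_eqF.
rewrite ler_pdivrMr ?exprn_gt0//.
have : t0^-1 * (4 * M * t0) <= t0^-1 * r ^+ 3.
  rewrite ler_wpM2l ?invr_ge0 ?(ltW t00)//.
  apply: (@le_trans _ _ r); first by move: rr0; rewrite /r0; lra.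
  by rewrite exprS ler_peMr ?(ltW rp)// exprn_ege1.
have -> : t0^-1 * (4 * M * t0) = 4 * M by field; rewrite gt_eqF.
by [].
Qed.

Lemma sqrt_scaled_ge (R : realType) (x a u v e : R) : 0 <= x -> 0 <= a -> 0 <= 1 - e ->
  (1 - e) * x <= u -> (1 - e) * (a / 2) <= v ->
  (1 - e) * Num.sqrt (2 * a * x) <= 2 * Num.sqrt (u * v).
Proof.
move=> x0 a0 e0 hu hv.
have -> : (1 - e) * Num.sqrt (2 * a * x) = 2 * Num.sqrt (((1 - e) * x) * ((1 - e) * (a / 2))).
  have -> : 2 * a * x = 2 ^+ 2 * (a / 2 * x) by field.
  rewrite sqrtrM ?sqr_ge0// sqrtr_sqr ger0_norm//.
  have -> : (1 - e) * x * ((1 - e) * (a / 2)) = (1 - e) ^+ 2 * (a / 2 * x) by field.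
  by rewrite [in RHS]sqrtrM ?sqr_ge0// sqrtr_sqr ger0_norm// mulrCA.
rewrite ler_wpM2l// ler_wsqrtr//; apply: ler_pM => //; first exact: mulr_ge0.
by apply: mulr_ge0 => //; rewrite divr_ge0.
Qed.

(** Since [h ^ 2 / a = 2 dl ^ 2 x], the area before the jump is at most [8 dl ^ 2 x] and the window
    loss at most [4 dl ^ 2 x]; their sum is at most [dl x] exactly when [12 dl <= 1]. The number
    [2 L] of windows does not depend on [x]. *)
Lemma log_case_parameters (R : realType) (a x dl h : R) L : 0 < a -> 0 < x ->
  12 * dl <= 1 -> L%:R * dl = 1 -> h = dl * Num.sqrt (2 * a * x) -> 0 < dl -> a <= h ->
  exists n W, [/\ (0 < n)%N, (0 < W)%N, 2 * h / a <= n%:R <= 4 * (h / a),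
    n%:R * h <= x /\ (1 - dl) * x <= x - n%:R * h - a * W%:R ^+ 2 / 2 &
    2 * Num.sqrt (2 * a * x) / a <= (2 * L * W)%:R <= 4 * Num.sqrt (2 * a * x) / a].
Proof.
move=> a0 x0; set y := Num.sqrt (2 * a * x) => dl12 Ldl hE dl0 ha.
have y2 : y ^+ 2 = 2 * a * x by rewrite sqr_sqrtr// !mulr_ge0// ltW.
have Lh : L%:R * h = y by rewrite hE mulrA Ldl mul1r.
have h0 : 0 < h by lra.
have h2a : 0 <= 2 * h / a by rewrite divr_ge0 ?mulr_ge0 ?(ltW h0) ?(ltW a0).
have h1a : 0 <= h / a by rewrite divr_ge0 ?(ltW h0) ?(ltW a0).
have /andP[n1 n2] := truncnS_itv h2a; have /andP[W1 W2] := truncnS_itv h1a.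
exists (Num.truncn (2 * h / a)).+1, (Num.truncn (h / a)).+1.
move: (Num.truncn (2 * h / a)) (Num.truncn (h / a)) n1 n2 W1 W2 => n W n1 n2 W1 W2.
have ha1 : 1 <= h / a by rewrite ler_pdivlMr// mul1r.
have e2 : 2 * h / a = 2 * (h / a) by ring.
have W3 : W.+1%:R <= 2 * (h / a) by lra.
have n3 : n.+1%:R <= 4 * (h / a) by lra.
have hx : h ^+ 2 / a = 2 * dl ^+ 2 * x by rewrite hE exprMn y2; field; rewrite gt_eqF.
have nh : n.+1%:R * h <= 8 * dl ^+ 2 * x.
  apply: le_trans (ler_wpM2r (ltW h0) n3) _.
  have -> : 4 * (h / a) * h = 4 * (h ^+ 2 / a) by ring.
  by rewrite hx; apply: eq_implies_le; ring.
have aW : a * W.+1%:R ^+ 2 / 2 <= 4 * dl ^+ 2 * x.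
  have : W.+1%:R ^+ 2 <= (2 * (h / a)) ^+ 2 by rewrite ler_pXn2r ?nnegrE// mulr_ge0.
  move=> /(ler_wpM2l (ltW a0)).
  have -> : a * (2 * (h / a)) ^+ 2 = 4 * (h ^+ 2 / a) by field; rewrite gt_eqF.
  by rewrite hx; lra.
have dlx : 12 * dl ^+ 2 * x <= dl * x.
  by rewrite ler_wpM2r ?(ltW x0)// expr2 mulrA -[leRHS]mul1r ler_wpM2r// ltW.
have dlx1 : dl * x <= x by rewrite ler_piMl ?(ltW x0)//; lra.
have d2 : 0 <= dl ^+ 2 * x by rewrite mulr_ge0 ?sqr_ge0 ?(ltW x0).
split=> //.
- by rewrite n1.
- by split; lra.
- rewrite !natrM -Lh.
  have -> : 2 * (L%:R * h) / a = 2 * L%:R * (h / a) by ring.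
  have -> : 4 * (L%:R * h) / a = 2 * L%:R * (2 * (h / a)) by ring.
  by rewrite !ler_wpM2l// mulr_ge0.
Qed.

(** * The area tail when [g] is at most logarithmic *)

Section LogarithmicCase.
Context {d : measure_display} {T : measurableType d} {R : realType}.
Variables (P : probability T R) (X : nat -> {RV P >-> R}) (a : R) (g : R -> R).
Hypotheses (iX : iid X) (a0 : 0 < a)
  (intX : P.-integrable setT (EFin \o X 0%N))
  (EX : ('E_P[X 0%N] = (- a)%:E)%E)
  (X2 : P.-integrable setT (EFin \o (fun w => X 0%N w ^+ 2)))
  (tailg : (fun x => Fbar X x / (expR (- g x) * x ^- 2)) @ +oo --> (1:R))
  (gdec : forall x y, 0 < x -> x <= y -> g y / y <= g x / x)
  (glim : (fun x => g x / x) @ +oo --> (0:R)).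

Let m2 := second_moment X.
Let C0 := mgf_const X.

Lemma sum_positive_until n : (0 < n)%N ->
  \sum_(j < n) pr P (positive_until X j) <= 1 + m2 / a ^+ 2 * (1 + ln n%:R).
Proof.
have m20 : 0 <= m2 / a ^+ 2 by rewrite divr_ge0 ?sqr_ge0// second_moment_ge0.
case: n => // n _; rewrite big_ord_recl; apply: lerD.
  by apply: pr_le1; exact: measurable_positive_until.
apply: (@le_trans _ _ (m2 / a ^+ 2 * \sum_(j < n) (j.+1%:R^-1))).
  rewrite mulr_sumr; apply: ler_sum => j _.
  exact: (pr_positive_until iX a0 intX EX X2).
apply: ler_wpM2l => //; case: n => [|n]; first by rewrite big_ord0 ln1 addr0.
apply: le_trans (harmonic_le_ln _ (ltn0Sn n)) _.
by rewrite lerD2l ler_ln ?posrE// ler_nat.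
Qed.

(** Only the tail [2 t ^ -2] is used, so [lam] need not be compared with [g]; the price is the
    factor [B] bounding [exp (lam b)]. *)
Lemma mgf_truncated t0 lam b B : 1 <= t0 ->
  (forall t, t0 <= t -> Fbar X t <= 2 * t ^- 2) ->
  lam <= t0^-1 -> expR (lam * b) <= B ->
  forall i u, 0 <= u <= lam ->
    (\int[P]_w (trunc_exp u b (X i w))%:E <=
     (expR (- (a * u) + (2 * m2 + 4 * expR 1 * B) * u ^+ 2))%:E)%E.
Proof.
move=> t1 tail lt eB i u /andP[u0 ul].
have B0 : 0 <= B by apply: le_trans eB; exact: expR_ge0.
move: u0; rewrite le_eqVlt => /orP[/eqP <-|u0].
  by rewrite expr0n /= !mulr0 oppr0 addr0 expR0; exact: trunc_exp0_integral.
apply: le_trans (mgf_bound iX.2 intX EX X2 (B := 2 * B) u0 _ _ i) _.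
- by rewrite mulr_ge0.
- move=> t ut' ty.
  have t00 : 0 < t0 by exact: lt_le_trans t1.
  have t0t : t0 <= t.
    apply: le_trans ut'; rewrite -[t0]invrK lef_pV2 ?posrE ?invr_gt0//.
    exact: le_trans lt.
  have tp : 0 < t by exact: lt_le_trans t0t.
  have eub : expR (u * t) <= B.
    by apply: le_trans eB; rewrite ler_expR ler_pM// ltW.
  apply: le_trans (ler_pM (expR_ge0 _) (Fbar_ge0 X t) eub (tail t t0t)) _.
  by rewrite mulrA [B * 2]mulrC.
rewrite lee_fin; apply: le_trans (expR_ge1Dx _).
by apply: eq_implies_le; rewrite /m2; ring.
Qed.

(** By monotonicity of [g t / t], the factor [exp (- g t)] cancels the tilt, and [t ^ -2 <= b ^ -2]
    survives. With [b] proportional to [y] this is the source of the factor [y ^ -2]. *)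
Lemma tilted_tail_le t0 y b t s : 1 <= t0 ->
  (forall t, t0 <= t -> Fbar X t <= 2 * (expR (- g t) * t ^- 2)) ->
  t0 <= b -> b <= t -> t <= y -> s <= t ->
  Fbar X t * expR (g y / y * s) <= 2 * b ^- 2.
Proof.
move=> t1 tail bt0 bt ty st.
have t00 : 0 < t0 by exact: lt_le_trans t1.
have b0 : 0 < b by exact: lt_le_trans bt0.
have tp : 0 < t by exact: lt_le_trans bt.
have y0 : 0 < y by exact: lt_le_trans ty.
have lam0 : 0 <= g y / y by rewrite divr_ge0 ?(ltW y0)// (g_ge0 gdec glim).
apply: le_trans (ler_wpM2r (expR_ge0 _) (tail t (le_trans bt0 bt))) _.
rewrite -(mulrA 2) ler_wpM2l// mulrAC -expRD.
have bi : t ^- 2 <= b ^- 2.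
  by rewrite lef_pV2 ?posrE ?exprn_gt0// ler_pXn2r ?nnegrE ?(ltW b0) ?(ltW tp).
apply: le_trans bi; rewrite -[leRHS]mul1r ler_wpM2r ?invr_ge0 ?exprn_ge0 ?(ltW tp)//.
rewrite -[leRHS]expR0 ler_expR addrC subr_le0.
apply: (@le_trans _ _ (g y / y * t)); first by rewrite ler_wpM2l.
by rewrite -ler_pdivlMr//; exact: gdec.
Qed.

(** As [h = dl y], the exponential at level [l] is [exp (- (1 - 4 dl) g y)] times [exp (lam l h)]
    with [lam = g y / y]; the last factor is absorbed by the tail of the jump that reached this
    level. *)
Lemma log_case_sum (t0 y b h dl A : R) L : 1 <= t0 ->
  (forall t, t0 <= t -> Fbar X t <= 2 * (expR (- g t) * t ^- 2)) ->
  t0 <= b -> b <= y -> h = dl * y -> 0 < dl -> L%:R * dl = 1 ->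
  A <= expR (- ((1 - 4 * dl) * g y)) ->
  \sum_(l < L) Fbar X (Num.max (l%:R * h) b) * (A +
     (2 * L%:R + 1) * expR (- (g y / y * ((1 - 2 * dl) * y - l.+2%:R * h)))) <=
  L%:R * ((2 * L%:R + 2) * (2 * b ^- 2)) * expR (- ((1 - 4 * dl) * g y)).
Proof.
move=> t1 tail bt0 by_ hE dl0 Ldl AE; set E := expR (- ((1 - 4 * dl) * g y)).
have t00 : 0 < t0 by exact: lt_le_trans t1.
have b0 : 0 < b by exact: lt_le_trans bt0.
have y0 : 0 < y by exact: lt_le_trans by_.
have h0 : 0 < h by rewrite hE mulr_gt0.
have -> : L%:R * ((2 * L%:R + 2) * (2 * b ^- 2)) * E =
    \sum_(l < L) ((2 * L%:R + 2) * (2 * b ^- 2) * E).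
  by rewrite sumr_const card_ord -[RHS]mulr_natl -[LHS]mulrA.
apply: ler_sum => l _.
have -> : expR (- (g y / y * ((1 - 2 * dl) * y - l.+2%:R * h))) =
    expR (g y / y * (l%:R * h)) * E.
  rewrite -expRD; congr expR; rewrite hE -!natr1; field; rewrite gt_eqF//.
set t := Num.max _ _.
have bt : b <= t by rewrite le_max lexx orbT.
have lt : l%:R * h <= t by rewrite le_max lexx.
have ty : t <= y.
  rewrite ge_max by_ andbT hE mulrA.
  apply: (@le_trans _ _ (L%:R * dl * y)); last by rewrite Ldl mul1r.
  by rewrite ler_wpM2r ?(ltW y0)// ler_wpM2r ?(ltW dl0)// ler_nat ltnW.
have p1 := tilted_tail_le t1 tail bt0 bt ty lt.
have p2 : Fbar X t <= 2 * b ^- 2.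
  have tp : 0 <= t by rewrite ltW// (lt_le_trans b0).
  by have := tilted_tail_le t1 tail bt0 bt ty tp; rewrite mulr0 expR0 mulr1.
have E0 : 0 <= E by exact: expR_ge0.
have q1 : Fbar X t * A <= 2 * b ^- 2 * E.
  apply: le_trans (ler_wpM2l (Fbar_ge0 X t) AE) _.
  by rewrite ler_wpM2r.
have q2 : (2 * L%:R + 1) * E * (Fbar X t * expR (g y / y * (l%:R * h))) <=
    (2 * L%:R + 1) * E * (2 * b ^- 2).
  by rewrite ler_wpM2l// mulr_ge0// addr_ge0// mulr_ge0.
move: q1 q2; move: (Fbar X t) (expR (g y / y * (l%:R * h))) (b ^- 2) (E) (L%:R : R) => F G B e N.
lra.
Qed.

(** Reaching [h] costs [lam h] without any help from the drift. Staying positive costs the same,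
    since [n >= 2 h / a] steps at net drift [a / 2] amount to a descent by [h]. *)
Lemma pr_without_jump (t0 b h lam B : R) n : 1 <= t0 ->
  (forall t, t0 <= t -> Fbar X t <= 2 * t ^- 2) ->
  0 <= lam <= t0^-1 -> expR (lam * b) <= B ->
  (2 * m2 + 4 * expR 1 * B) * lam <= a / 2 -> 2 * h / a <= n%:R -> 0 <= h ->
  pr P (high_without_jump X h b n) <= expR (- (lam * h)) /\
  pr P (positive_without_jump X b n) <= expR (- (lam * h)).
Proof.
move=> t1 tail /andP[lam0 lt] lb; set C3 := 2 * m2 + _ => tilt nh h0.
have mgf := mgf_truncated t1 tail lt lb.
have m20 : 0 <= m2 by exact: second_moment_ge0.
have C30 : 0 <= C3.
  by apply: addr_ge0; apply: mulr_ge0 => //; exact: le_trans (expR_ge0 _) lb.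
have C3a : C3 * lam <= a.
  by apply: le_trans tilt _; rewrite ler_pdivrMr// ler_peMr ?(ltW a0)// ler1n.
split.
  have := @pr_exp_max _ _ _ _ X a C3 lam b (fun=> lam) 0 n (lam * h) _ iX.1 mgf C30 C3a.
  move=> /(_ (high_without_jump X h b n)); rewrite big_ord0 addr0; apply=> //.
  - by move=> i _; rewrite lam0 lexx.
  - exact: measurable_high_without_jump.
  - move=> w [j jn [Xb hS]]; exists j; first by rewrite jn.
    split=> //; rewrite -mulr_sumr ler_wpM2l//; exact: ltW.
apply: le_trans (@pr_positive_nojump _ _ _ _ X a C3 lam b 0 n _ iX.1 mgf C30 lam0 C3a
  (measurable_positive_without_jump X b n) _) _.
  by move=> w [h1 h2]; rewrite add0r.
rewrite ler_expR sub0r mulrN lerN2 ler_wpM2l//.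
apply: (@le_trans _ _ (a / 2 * (2 * h / a))).
  by apply: eq_implies_le; field; rewrite gt_eqF.
have a_gt0 := a0.
apply: ler_pM => //; [by rewrite divr_ge0// ltW|by rewrite divr_ge0 ?mulr_ge0// ltW|].
by move: tilt; move: (C3 * lam) => z; lra.
Qed.

Lemma area_tail_log_case (K dl : R) (L : nat) : 0 <= K -> 0 < dl -> 12 * dl <= 1 ->
  L%:R * dl = 1 -> exists2 C, 0 < C & \forall x \near +oo,
    g (Num.sqrt (2 * a * x)) <= K * ln (Num.sqrt (2 * a * x)) ->
    PAtau_gt X x <= C * (1 + ln (Num.sqrt (2 * a * x))) *
      (Num.sqrt (2 * a * x) ^- 2 * expR (- ((1 - 4 * dl) * g (Num.sqrt (2 * a * x))))).
Proof.
move=> K0 dl0 dl12 Ldl.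
have a_gt0 := a0.
have [t0 t01 tail] := tail_two_sided tailg.
have {}tail t : t0 <= t -> Fbar X t <= 2 * (expR (- g t) * t ^- 2) by move=> /tail/andP[].
have t00 : 0 < t0 by exact: lt_le_trans t01.
have m20 : 0 <= m2 by exact: second_moment_ge0.
have C00 : 0 < C0 by exact: mgf_const_gt0.
have tail2 t : t0 <= t -> Fbar X t <= 2 * t ^- 2.
  move=> tt; apply: le_trans (tail t tt) _.
  have tp : 0 < t by exact: lt_le_trans tt.
  rewrite ler_wpM2l// -[leRHS]mul1r ler_wpM2r ?invr_ge0 ?exprn_ge0 ?(ltW tp)//.
  by rewrite -expR0 ler_expR oppr_le0 (g_ge0 gdec glim).
(* With the tilt [M ln y / y], height [h = dl y] costs [exp (- (K + 2) ln y)], which is at most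
   [y ^ -2 exp (- g y)] as [g y <= K ln y]. Then [zt] solves [M zt = 1/2], so truncation at
   [b = zt y] lets the moment constant grow only like [sqrt y]. *)
pose M := (K + 2) / dl.
have K20 : 0 < K + 2 by lra.
have M0 : 0 < M by rewrite divr_gt0.
pose zt := dl / (2 * (K + 2)).
have zt0 : 0 < zt by rewrite divr_gt0// mulr_gt0.
have zt1 : zt <= 1 by rewrite ler_pdivrMr ?mulr_gt0//; lra.
have e1p : 0 <= 4 * expR 1 :> R by rewrite mulr_ge0 ?expR_ge0.
have [Y Y1 HY] := log_tilt (mulr_ge0 (ler0n _ 2) m20) e1p t00 a0 M0.
pose c5 := L%:R * ((2 * L%:R + 2) * (2 * zt ^- 2)).
have c50 : 0 <= c5.
  by rewrite /c5 !mulr_ge0 ?invr_ge0 ?exprn_ge0 ?(ltW zt0)// addr_ge0// mulr_ge0.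
have ma0 : 0 <= m2 / a ^+ 2 by rewrite divr_ge0 ?sqr_ge0.
pose c6 := 1 + 2 * (m2 / a ^+ 2).
have c60 : 1 <= c6 by rewrite /c6 lerDl mulr_ge0.
exists (2 + c6 * (2 + c5)); first by rewrite ltr_wpDr// mulr_ge0 ?(le_trans ler01 c60)// addr_ge0.
(* The second bound makes [a / 2 - C0 lam] keep the fraction [1 - dl] of [a / 2]. *)
pose e := Num.min t0^-1 (dl * a / (2 * C0)).
have e0 : 0 < e by rewrite lt_min invr_gt0 t00 divr_gt0 ?mulr_gt0.
have [N N1 gN] := near_pinfty_ex (g_sublinear glim e0) 1.
near=> x.
have x1 : 1 <= x by near: x; apply: nbhs_pinfty_ge; exact: num_real.
have x0 : 0 < x by exact: lt_le_trans x1.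
set y := Num.sqrt (2 * a * x) => gK.
have [yN yY [yzt yda ya]] : [/\ N <= y, Y <= y & [/\ t0 / zt <= y, a / dl <= y & 8 / a <= y]].
  by split; [| |split]; rewrite /y; near: x; apply: sqrt_near; rewrite mulr_gt0.
have y1 : 1 <= y by exact: le_trans yN.
have y0 : 0 < y by exact: lt_le_trans y1.
have ly0 : 0 <= ln y by exact: ln_ge0.
have gy0 : 0 <= g y by exact: (g_ge0 gdec glim).
have yt0 : t0 <= y by apply: le_trans yzt; rewrite ler_pdivlMr// ler_piMr// ltW.
have [h hE] : exists h, h = dl * y by exists (dl * y).
have [b bE] : exists b, b = zt * y by exists (zt * y).
have h0 : 0 < h by rewrite hE mulr_gt0.
have b0 : 0 < b by rewrite bE mulr_gt0.
have bt0 : t0 <= b by rewrite bE mulrC -ler_pdivrMr.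
have by_ : b <= y by rewrite bE -[leRHS]mul1r ler_wpM2r// ltW.
have ha : a <= h by rewrite hE mulrC -ler_pdivrMr.
have Lh : L%:R * h = y by rewrite hE mulrA Ldl mul1r.
have [lam lamE] : exists lam, lam = g y / y by exists (g y / y).
have lam0 : 0 <= lam by rewrite lamE divr_ge0// ltW.
have lame : lam <= e by rewrite lamE ler_pdivrMr//; exact: gN.
have /andP[lamt lama] : (lam <= t0^-1) && (lam <= dl * a / (2 * C0)) by rewrite -le_min.
have {}lama : C0 * lam <= dl * (a / 2).
  move: lama; rewrite ler_pdivlMr ?mulr_gt0// => lama.
  by rewrite mulrA ler_pdivlMr//; apply: le_trans lama; apply: eq_implies_le; ring.
have gE : g y = lam * y by rewrite lamE divfK// gt_eqF.
have dl1 : dl <= 1 by apply: le_trans dl12; rewrite ler_peMl ?(ltW dl0)// ler1n.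
have dla : (1 - dl) * (a / 2) <= a / 2 - C0 * lam by rewrite mulrBl mul1r lerD2l lerN2.
have c0 : 0 <= a / 2 - C0 * lam.
  by apply: le_trans dla; rewrite mulr_ge0 ?subr_ge0// divr_ge0// ltW.
have [tilt1 tilt2] := HY y yY.
have [n0 [W [n00 W0 /andP[n01 n02] [n0x xx] /andP[n1l n1u]]]] :=
  log_case_parameters a0 x0 dl12 Ldl hE dl0 ha.
pose E4 := expR (- ((1 - 4 * dl) * g y)).
have E40 : 0 <= E4 by exact: expR_ge0.
have E4g : expR (- g y) <= E4.
  rewrite ler_expR lerN2 -[leRHS]mul1r ler_wpM2r// lerBlDr lerDl mulr_ge0//.
  exact: ltW.
have n1F : (2 * L * W)%:R * Fbar X y <= E4.
  apply: le_trans E4g.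
  apply: le_trans (ler_pM (ler0n _ _) (Fbar_ge0 X y) n1u (tail y yt0)) _.
  have -> : 4 * y / a * (2 * (expR (- g y) * y ^- 2)) = expR (- g y) * (8 / a / y).
    by field; rewrite !gt_eqF.
  by rewrite -[leRHS]mulr1 ler_wpM2l ?expR_ge0// ler_pdivrMr// mul1r.
have mgf i u : 0 <= u <= lam ->
    (\int[P]_w (trunc_exp u y (X i w))%:E <= (expR (- (a * u) + C0 * u ^+ 2))%:E)%E.
  move=> /andP[u0 ul].
  apply: (mgf_subexponential iX intX EX X2 gdec t01 tail y0).
  - by rewrite u0 -lamE.
  - exact: le_trans lamt.
(* [2 L] windows and the survival term share one exponential. In [1 - 2 dl], one [dl] comes from
   [sqrt_scaled_ge] and the other absorbs the summand [a / 2], through [a <= h]. *)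
pose Q l := (2 * L * W)%:R * Fbar X y +
  (2 * L%:R + 1) * expR (- (g y / y * ((1 - 2 * dl) * y - l.+2%:R * h))).
have hQ j l : (l < L)%N ->
    pr P (large_area (shifted X j.+1) (l.+2%:R * h) (x - n0%:R * h) (2 * L * W)) <= Q l.
  move=> lL.
  have jump i : pr P [set w | y < shifted X j.+1 i w] <= Fbar X y by rewrite (pr_tail iX.2).
  have mgfs i u : 0 <= u <= lam -> (\int[P]_w (trunc_exp u y (shifted X j.+1 i w))%:E <=
      (expR (- (a * u) + C0 * u ^+ 2))%:E)%E by exact: mgf.
  have x''0 : 0 <= x - n0%:R * h - a * W%:R ^+ 2 / 2.
    by apply: le_trans xx; rewrite mulr_ge0 ?(ltW x0)// subr_ge0.
  apply: le_trans (pr_large_area (l.+2%:R * h) (2 * L) (shift_independent j.+1 iX.1) mgfs jump a0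
    (ltW C00) lam0 c0 W0 x''0) _.
  rewrite /Q -lamE -addrA lerD2l (mulrDl (2 * L%:R) 1) mul1r; apply: lerD.
    rewrite natrM ler_wpM2l ?mulr_ge0// ler_expR lerN2 ler_wpM2l//.
    have dl10 : 0 <= 1 - dl by rewrite subr_ge0.
    have := sqrt_scaled_ge (ltW x0) (ltW a0) dl10 xx dla; rewrite -/y => sq.
    rewrite [leRHS]addrAC lerD2r lerBrDr; apply: le_trans sq.
    have -> : (1 - 2 * dl) * y = (1 - dl) * y - h by rewrite hE; ring.
    rewrite -addrA gerDl addrC subr_le0; apply: le_trans ha.
    by rewrite ler_pdivrMr// ler_peMr ?(ltW a0)// ler1n.
  rewrite ler_expR -[leRHS]mulrN ler_wpM2l// opprB lerD2l lerN2.
  apply: (@le_trans _ _ (a / 2 * (2 * y / a))).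
    have -> : a / 2 * (2 * y / a) = y by field; rewrite gt_eqF.
    by rewrite -[leRHS]mul1r ler_wpM2r ?(ltW y0)// lerBlDr lerDl mulr_ge0// ltW.
  apply: ler_pM => //; rewrite ?divr_ge0 ?mulr_ge0 ?(ltW y0) ?(ltW a0)//.
  by move: c0; move: (C0 * lam) => z; lra.
have lam30 : 0 <= M * ln y / y.
  by apply: divr_ge0; [apply: mulr_ge0 => //; exact: ltW|exact: ltW].
have lam3h : M * ln y / y * h = (K + 2) * ln y.
  by rewrite hE /M; field; rewrite !gt_eqF.
have lam3b : expR (M * ln y / y * b) <= expR (ln y / 2).
  rewrite ler_expR; apply: eq_implies_le; rewrite bE /M /zt; field.
  by rewrite !gt_eqF.
have lam3t : 0 <= M * ln y / y <= t0^-1 by rewrite lam30.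
have [N1b N2b] := pr_without_jump t01 tail2 lam3t lam3b tilt1 n01 (ltW h0).
have yL : y <= L%:R * h by rewrite Lh.
have main := pr_first_big_jump iX h0 b0 n00 n0x yL N1b N2b hQ.
have sumQ := log_case_sum t01 tail bt0 by_ hE dl0 Ldl n1F.
have [r rE] : exists r, r = y ^- 2 * E4 by exists (y ^- 2 * E4).
have r0 : 0 <= r by rewrite rE mulr_ge0// invr_ge0 exprn_ge0// ltW.
have eN : expR (- (M * ln y / y * h)) <= r.
  rewrite lam3h mulrDl opprD addrC expRD rE ler_pM ?expR_ge0//.
    by rewrite expRN mulr_natl -lnXn// lnK// posrE exprn_gt0.
  by apply: le_trans E4g; rewrite ler_expR lerN2.
have Fr : Fbar X y <= 2 * r.
  apply: le_trans (tail y yt0) _; rewrite ler_wpM2l// rE mulrC.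
  by rewrite ler_wpM2l// invr_ge0 exprn_ge0// ltW.
have sumr : \sum_(l < L) Fbar X (Num.max (l%:R * h) b) * Q l <= c5 * r.
  apply: le_trans sumQ _; apply: eq_implies_le; rewrite rE /c5 bE /E4.
  by move: (expR _) => z; field; rewrite !gt_eqF.
have Hn : \sum_(j < n0) pr P (positive_until X j) <= c6 * (1 + ln y).
  apply: le_trans (sum_positive_until n00) _.
  (* [n0 <= 4 h / a <= y ^ 2] once [y >= 8 / a]. *)
  have lnn : ln n0%:R <= 2 * ln y.
    rewrite mulr_natl -lnXn// ler_ln ?posrE ?exprn_gt0 ?ltr0n//.
    apply: le_trans n02 _; rewrite expr2.
    apply: (@le_trans _ _ (8 / a * y)); last by rewrite ler_wpM2r// ltW.
    rewrite hE; have -> : 4 * (dl * y / a) = dl * (4 / a * y) by ring.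
    have p4 : 0 <= 4 / a * y by rewrite mulr_ge0 ?divr_ge0 ?(ltW y0) ?(ltW a0).
    apply: (@le_trans _ _ (1 * (4 / a * y))); first by rewrite ler_wpM2r.
    by rewrite mul1r ler_wpM2r ?(ltW y0)// ler_wpM2r ?invr_ge0 ?(ltW a0)// ler_nat.
  have := ler_wpM2l ma0 lnn; rewrite /c6.
  move: (m2 / a ^+ 2) (ln n0%:R) (ln y) ma0 ly0 => u v w u0 w0 uv.
  by have := mulr_ge0 u0 w0; lra.
apply: (le_trans main); rewrite -/y -/E4 -rE.
have H0 : 0 <= \sum_(j < n0) pr P (positive_until X j) by apply: sumr_ge0 => j _; exact: pr_ge0.
have S0 : 0 <= Fbar X y + \sum_(l < L) Fbar X (Num.max (l%:R * h) b) * Q l.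
  apply: addr_ge0; first exact: Fbar_ge0.
  apply: sumr_ge0 => l _; apply: mulr_ge0; first exact: Fbar_ge0.
  apply: addr_ge0; apply: mulr_ge0; [exact: ler0n|exact: Fbar_ge0| |exact: expR_ge0].
  by apply: addr_ge0 => //; exact: mulr_ge0.
have := ler_pM H0 S0 Hn (lerD Fr sumr).
have : 0 <= ln y * r by rewrite mulr_ge0.
move: eN; move: (expR _) (_ * (Fbar X y + _)) => u v uv h1 h2.
apply: le_trans (lerD (lerD uv uv) h2) _.
move: h1; move: (ln y) (c5) (c6) => p q s; lra.
Unshelve. all: by end_near. Qed.

End LogarithmicCase.

(** * Logarithmic asymptotics *)

Lemma ln_near (R : realType) (b M : R) : 0 < b ->
  \forall x \near +oo, M <= ln (Num.sqrt (b * x)).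
Proof.
move=> b0; near=> x.
have h : expR M <= Num.sqrt (b * x) by near: x; exact: sqrt_near.
rewrite -[leLHS]expRK ler_ln ?posrE ?expR_gt0//.
by apply: lt_le_trans h; exact: expR_gt0.
Unshelve. all: by end_near. Qed.

Lemma ratio_close (R : realType) (p f e : R) : 0 < - f ->
  (1 - e) * - f <= - p -> - p <= (1 + e) * - f -> `|1 - p / f| <= e.
Proof.
move=> f0 h1 h2.
have -> : p / f = (- p) / (- f) by rewrite invrN mulrNN.
have k1 : 1 - e <= (- p) / (- f) by rewrite ler_pdivlMr.
have k2 : (- p) / (- f) <= 1 + e by rewrite ler_pdivrMr.
move: k1 k2; move: (_ / _) => z k1 k2.
by rewrite ler_norml; apply/andP; split; lra.
Qed.

(** [G] and [l] stand for [g y] and [ln y]. Both logarithms have main part [- (G + 2 l)]; once [l]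
    is large, the minimum in the upper estimate outweighs all additive constants, collected in
    [B]. *)
Lemma log_ratio_arith (R : realType) (e M G l lP lF c2 c4 : R) : 0 < e -> e < 1 ->
  0 <= G -> 0 <= c2 -> 0 <= c4 ->
  let B := 2 + `|M| + c2 + (e + c4 + 2 * c2) / e in 2 * B + B / e <= l ->
  lF <= c2 - G - 2 * l -> - c2 - G - 2 * l <= lF ->
  (1 - e) * (G + 2 * l) + Num.min (l / 2) (e * l) - M <= - lP ->
  - lP <= (1 + e / 2) * G + 2 * l + (2 * (e / 2) + c4) ->
  `|1 - lP / lF| <= e.
Proof.
move=> e0 e1 G0 c20 c40 B lB f2 f1 up low.
have M0 : M <= `|M| by exact: ler_norm.
have Mp := normr_ge0 M.
have D0 : 0 <= (e + c4 + 2 * c2) / e.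
  by rewrite divr_ge0 ?(ltW e0)// !addr_ge0 ?(ltW e0)// mulr_ge0.
have [BM BD Bc] : [/\ M + c2 <= B, (e + c4 + 2 * c2) / e <= B & c2 + 1 <= B].
  by move: D0; rewrite /B; move: (_ / e) => z D0; split; lra.
move: (B) BM BD Bc lB => b BM BD Bc lB.
have be : 0 <= b / e by rewrite divr_ge0 ?(ltW e0)//; lra.
have l2 : b <= l / 2 by rewrite ler_pdivlMr//; lra.
have le : b <= e * l by rewrite mulrC -ler_pdivrMr//; lra.
have mn : b <= Num.min (l / 2) (e * l) by rewrite le_min l2.
have lc : e + c4 + 2 * c2 <= e * l by rewrite [leRHS]mulrC -ler_pdivrMr//; lra.
have ec2 : e * c2 <= 1 * c2 by rewrite ler_wpM2r// ltW.
have eG0 : 0 <= e * G by rewrite mulr_ge0// ltW.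
have ec20 : 0 <= e * c2 by rewrite mulr_ge0// ltW.
have k1 : (1 - e) * - lF <= (1 - e) * (c2 + G + 2 * l) by rewrite ler_wpM2l//; lra.
have k2 : (1 + e) * (G + 2 * l - c2) <= (1 + e) * - lF by rewrite ler_wpM2l//; lra.
apply: ratio_close; first by lra.
- by apply: le_trans k1 _; apply: le_trans up; lra.
- by apply: le_trans low _; apply: le_trans k2; lra.
Qed.

Lemma ln_tail_term (R : realType) (c u y : R) : 0 < c -> 0 < y ->
  ln (c * (expR (- u) * y ^- 2)) = ln c - u - 2 * ln y.
Proof.
move=> c0 y0.
have y2 : 0 < y ^+ 2 by rewrite exprn_gt0.
rewrite lnM ?posrE ?mulr_gt0 ?expR_gt0 ?invr_gt0//.
rewrite lnM ?posrE ?expR_gt0 ?invr_gt0// expRK lnV ?posrE// lnXn// -mulr_natl.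
by ring.
Qed.

Section LogarithmicRatio.
Context {d : measure_display} {T : measurableType d} {R : realType}.
Variables (P : probability T R) (X : nat -> {RV P >-> R}) (a : R) (g : R -> R).
Hypotheses (iX : iid X) (a0 : 0 < a)
  (intX : P.-integrable setT (EFin \o X 0%N))
  (EX : ('E_P[X 0%N] = (- a)%:E)%E)
  (X2 : P.-integrable setT (EFin \o (fun w => X 0%N w ^+ 2)))
  (tailg : (fun x => Fbar X x / (expR (- g x) * x ^- 2)) @ +oo --> (1:R))
  (gdec : forall x y, 0 < x -> x <= y -> g y / y <= g x / x)
  (glim : (fun x => g x / x) @ +oo --> (0:R)).

(** A jump at the very first step suffices ([K = 1]). With [eps = 1/8] the overshoot [2 x ^ (3/8)]
    is negligible against [y], so [g z <= (z / y) g y] is close to [g y]. One factor 2 in [ln 4]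
    comes from [area_tail_lower], the other from the tail estimate. *)
Lemma ln_area_tail_lower e : 0 < e -> \forall x \near +oo,
  0 < PAtau_gt X x /\ - ln (PAtau_gt X x) <=
    (1 + e) * g (Num.sqrt (2 * a * x)) + 2 * ln (Num.sqrt (2 * a * x)) + (2 * e + ln 4).
Proof.
move=> e0.
have [t0 t01 tail] := tail_two_sided tailg.
have t00 : 0 < t0 by exact: lt_le_trans t01.
have half : 2^-1 < \sum_(k < 1) pr P (positive_until X k).
  rewrite big_ord_recl big_ord0 addr0 /= (_ : positive_until X 0 = setT).
    by rewrite /pr probability_setT /= invf_lt1// ltr1n.
  by apply/seteqP; split=> // w _ k; case: k => [|k]; rewrite ?andbF.
have eps0 : (0 : R) < 8^-1 by rewrite invr_gt0.
pose s := Num.sqrt (2 * a).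
have s0 : 0 < s by rewrite sqrtr_gt0 mulr_gt0.
near=> x.
have low : 2^-1 <= PAtau_gt X x / Fbar X (Num.sqrt (2 * a * x) + 2 * x `^ (4^-1 + 8^-1)).
  by near: x; exact: (area_tail_lower iX a0 intX EX X2 tailg gdec glim eps0 half).
have x1 : 1 <= x by near: x; apply: nbhs_pinfty_ge; exact: num_real.
have x0 : 0 < x by exact: lt_le_trans x1.
move: low; set y := Num.sqrt (2 * a * x); set q := x `^ _ => low.
have yt0 : t0 <= y by rewrite /y; near: x; apply: sqrt_near; rewrite mulr_gt0.
have y0 : 0 < y by exact: lt_le_trans yt0.
pose r := x `^ 8^-1.
have r1 : 2 / (s * e) <= r by rewrite /r; near: x; exact: powR_near.
have r0 : 0 < r by exact: powR_gt0.
have r4 : r ^+ 4 = Num.sqrt x.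
  rewrite -root4E ?(ltW x0)// -powR_mulrn ?(ltW r0)// -powRrM.
  rewrite -powR_mulrn ?powR_ge0// -powRrM; congr (_ `^ _).
  by field.
have qr : q = r ^+ 3.
  rewrite -powR_mulrn ?(ltW r0)// -powRrM; congr (_ `^ _).
  by field.
have yr : y = s * r ^+ 4 by rewrite /y sqrtrM ?r4// mulr_ge0// ltW.
set z := y + 2 * q in low.
have q0 : 0 < q by exact: powR_gt0.
have zy : y <= z by rewrite lerDl mulr_ge0// ltW.
have z0 : 0 < z by exact: lt_le_trans zy.
have qe : 2 * q <= e * y.
  rewrite qr yr.
  have : 2 <= s * e * r by rewrite mulrC -ler_pdivrMr// mulr_gt0.
  have r30 : 0 <= r ^+ 3 by rewrite exprn_ge0// ltW.
  move=> /(ler_wpM2r r30)/le_trans; apply; apply: eq_implies_le; ring.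
have ze : z / y <= 1 + e by rewrite ler_pdivrMr// mulrDl mul1r lerD2l.
have gz : g z <= (1 + e) * g y.
  have gy0 : 0 <= g y by exact: (g_ge0 gdec glim).
  apply: (@le_trans _ _ (z / y * g y)); last by rewrite ler_wpM2r.
  have := gdec y0 zy; rewrite ler_pdivrMr// => /le_trans; apply.
  by apply: eq_implies_le; ring.
have lz : ln z <= ln y + e.
  have -> : z = (1 + 2 * q / y) * y by rewrite /z; field; rewrite gt_eqF.
  have p0 : 0 <= 2 * q / y by rewrite divr_ge0 ?mulr_ge0 ?(ltW q0) ?(ltW y0).
  rewrite lnM ?posrE ?ltr_wpDr// addrC lerD2l.
  apply: (@le_trans _ _ (2 * q / y)); last by rewrite ler_pdivrMr.
  by apply: le_ln1Dx; rewrite (lt_le_trans _ p0)// ltrN10.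
have /tail/andP[Fz _] := le_trans yt0 zy.
have tz0 : 0 < expR (- g z) * z ^- 2 by rewrite mulr_gt0 ?expR_gt0// invr_gt0 exprn_gt0.
have Fz0 : 0 < Fbar X z by apply: lt_le_trans Fz; rewrite divr_gt0.
move: low; rewrite ler_pdivlMr// => low.
have low' : 4^-1 * (expR (- g z) * z ^- 2) <= PAtau_gt X x.
  apply: le_trans low; move: Fz; move: (expR _ * _) (Fbar X z) => u v; lra.
have c40 : (0 : R) < 4^-1 by rewrite invr_gt0.
have u0 : 0 < 4^-1 * (expR (- g z) * z ^- 2) by rewrite mulr_gt0.
have P0 := lt_le_trans u0 low'; split=> //.
have := low'; rewrite -ler_ln ?posrE// ln_tail_term// lnV ?posrE//.
move: gz lz; move: (ln (PAtau_gt X x)) (g z) (ln z) (ln 4) (g y) (ln y) => A B C D E F.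
lra.
Unshelve. all: by end_near. Qed.

(** Above [g y = K ln y], three quarters of [e g y >= 4 ln y] pay for the missing [2 ln y] and for
    [x ^ (1/4)], with [(ln y) / 2] to spare; below, [area_tail_log_case] loses only [ln (1 + ln y)]
    and leaves a surplus [e ln y]. The minimum of the two surpluses is kept to absorb constants
    later. *)
Lemma ln_area_tail_upper e : 0 < e -> e < 1 -> exists M, \forall x \near +oo,
  0 < PAtau_gt X x -> (1 - e) * (g (Num.sqrt (2 * a * x)) + 2 * ln (Num.sqrt (2 * a * x))) +
     Num.min (ln (Num.sqrt (2 * a * x)) / 2) (e * ln (Num.sqrt (2 * a * x))) - M <=
     - ln (PAtau_gt X x).
Proof.
move=> e0 e1.
have a_gt0 := a0.
have [C [C0 upper]] := area_tail_upper iX a0 intX EX X2 tailg gdec glim.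
pose K := 4 / e.
have K0 : 0 <= K by rewrite divr_ge0// ltW.
(* Ensures both [12 dl <= 1] and [4 dl <= e] for [dl = 1 / L]. *)
pose L := (Num.truncn (12 + 4 / e)).+1.
have L1 : 12 + 4 / e <= L%:R.
  by have /andP[] := @truncnS_itv R (12 + 4 / e) (addr_ge0 (ler0n _ _) K0).
have L0 : (0 : R) < L%:R by [].
pose dl : R := L%:R^-1.
have dl0 : 0 < dl by rewrite invr_gt0.
have dl12 : 12 * dl <= 1.
  by rewrite ler_pdivrMr// mul1r; apply: le_trans L1; rewrite lerDl.
have dl4 : 4 * dl <= e.
  rewrite ler_pdivrMr// mulrC -ler_pdivrMr//; apply: le_trans L1.
  by rewrite lerDr.
have Ldl : L%:R * dl = 1 by rewrite divff// gt_eqF.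
have [C' C'0 logc] := area_tail_log_case iX a0 intX EX X2 tailg gdec glim K0 dl0 dl12 Ldl.
have e40 : 0 < a * e / (8 * C) by rewrite divr_gt0 ?mulr_gt0.
have [N N1 gN] := near_pinfty_ex (g_sublinear glim e40) 1.
have [M [MC MC']] : exists M, ln C - ln (2 * a) / 4 <= M /\ ln C' + e - ln e <= M.
  by exists (Num.max (ln C - ln (2 * a) / 4) (ln C' + e - ln e)); rewrite !le_max !lexx orbT.
exists M.
near=> x => P0.
have x1 : 1 <= x by near: x; apply: nbhs_pinfty_ge; exact: num_real.
have x0 : 0 < x by exact: lt_le_trans x1.
have up : PAtau_gt X x <= C * x `^ 4^-1 *
    expR (- (g (Num.sqrt (2 * a * x)) *
       Num.sqrt (1 - 2 * C * g (Num.sqrt (2 * a * x)) / (a * Num.sqrt (2 * a * x))))).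
  by near: x.
have lc : g (Num.sqrt (2 * a * x)) <= K * ln (Num.sqrt (2 * a * x)) ->
    PAtau_gt X x <= C' * (1 + ln (Num.sqrt (2 * a * x))) *
      (Num.sqrt (2 * a * x) ^- 2 * expR (- ((1 - 4 * dl) * g (Num.sqrt (2 * a * x))))).
  by near: x.
move: up lc; set y := Num.sqrt (2 * a * x) => up lc.
have yN : N <= y by rewrite /y; near: x; apply: sqrt_near; rewrite mulr_gt0.
have l0 : 1 <= ln y by rewrite /y; near: x; apply: ln_near; rewrite mulr_gt0.
have y1 : 1 <= y by exact: le_trans yN.
have y0 : 0 < y by exact: lt_le_trans y1.
have gy0 : 0 <= g y by exact: (g_ge0 gdec glim).
have [gK|gK] := leP (g y) (K * ln y).
  have l10 : 0 < 1 + ln y by rewrite ltr_wpDr// (le_trans ler01).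
  have y2 : 0 < y ^+ 2 by rewrite exprn_gt0.
  have h : ln (PAtau_gt X x) <=
      ln (C' * (1 + ln y) * (expR (- ((1 - 4 * dl) * g y)) * y ^- 2)).
    rewrite ler_ln ?posrE ?(mulr_gt0 (mulr_gt0 _ _))//.
      by rewrite [expR _ * _]mulrC; exact: lc.
    by rewrite mulr_gt0 ?expR_gt0 ?invr_gt0.
  move: h; rewrite ln_tail_term ?mulr_gt0// lnM ?posrE// => h.
  (* [ln u < u] at [u = e (1 + ln y)] makes the doubly logarithmic loss a small multiple of
     [ln y]. *)
  have l1 : ln (1 + ln y) <= e * (1 + ln y) - ln e.
    have : ln (e * (1 + ln y)) < e * (1 + ln y) by apply: ln_sublinear; rewrite mulr_gt0.
    rewrite lnM ?posrE//; move: (ln e) (ln (1 + ln y)) (e * _) => u v w; lra.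
  have m1 : Num.min (ln y / 2) (e * ln y) <= e * ln y by rewrite ge_min lexx orbT.
  have gd : 4 * dl * g y <= e * g y by rewrite ler_wpM2r.
  have m2 := MC'; move: h l1 m1 m2 gd.
  move: (M) (ln y) (g y) (ln (PAtau_gt X x)) (ln C') (ln e) (dl)
    (ln (1 + ln y)) (Num.min (ln y / 2) (e * ln y)).
  move=> B G H I J Q D F A h l1 m1 m2 gd; lra.
have q0 : 0 < x `^ 4^-1 by exact: powR_gt0.
have Cq0 : 0 < C * x `^ 4^-1 by rewrite mulr_gt0.
have h : ln (PAtau_gt X x) <= ln (C * x `^ 4^-1 *
    expR (- (g y * Num.sqrt (1 - 2 * C * g y / (a * y))))).
  by rewrite ler_ln ?posrE// mulr_gt0// expR_gt0.
move: h; rewrite lnM ?posrE ?expR_gt0// lnM ?posrE// expRK ln_powR => h.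
have lx : ln x = 2 * ln y - ln (2 * a).
  have : ln (y ^+ 2) = ln (2 * a * x) by rewrite sqr_sqrtr// !mulr_ge0// ltW.
  by rewrite lnXn// lnM ?posrE ?mulr_gt0// [2 * ln y]mulr_natl => ->; ring.
pose t := 2 * C * g y / (a * y).
have t0 : 0 <= t by rewrite divr_ge0 ?mulr_ge0 ?(ltW C0) ?(ltW a0) ?(ltW y0).
have te : t <= e / 4.
  have := gN y yN; rewrite ler_pdivrMr ?mulr_gt0// => gy.
  have := ler_wpM2l (mulr_ge0 (ler0n _ 2) (ltW C0)) gy.
  move/le_trans; apply; apply: eq_implies_le; field; rewrite gt_eqF//.
have st : 1 - t <= Num.sqrt (1 - t).
  have t1 : 0 <= 1 - t by lra.
  rewrite -{1}(sqr_sqrtr t1) expr2 ler_piMl ?sqrtr_ge0//.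
  by rewrite -[leRHS]sqrtr1 ler_wsqrtr// lerBlDr lerDl.
have gs : g y * (1 - e / 4) <= g y * Num.sqrt (1 - t).
  by rewrite ler_wpM2l//; apply: le_trans st; lra.
have m1 : Num.min (ln y / 2) (e * ln y) <= ln y / 2 by rewrite ge_min lexx.
have ge : 4 * ln y <= e * g y.
  move: gK; rewrite /K mulrAC ltr_pdivrMr// => /ltW; rewrite [g y * e]mulrC; exact.
have el : 0 <= e * ln y by rewrite mulr_ge0 ?(ltW e0)// (le_trans ler01).
have m2 := MC; move: h gs m1 m2 ge el; rewrite lx -/t.
move: (M) (ln y) (ln (PAtau_gt X x)) (ln C) (ln (2 * a)) (g y)
  (Num.sqrt (1 - t)) (Num.min (ln y / 2) (e * ln y)).
move=> B G I J Q H F A h gs m1 m2 ge el; lra.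
Unshelve. all: by end_near. Qed.

Lemma ln_area_tail_ratio :
  (fun x => ln (PAtau_gt X x) / ln (Fbar X (Num.sqrt (2 * a * x)))) @ +oo --> (1:R).
Proof.
apply/cvgrPdist_le => e' e'0.
pose e := Num.min e' (2^-1).
have h0 : (0 : R) < 2^-1 by rewrite invr_gt0.
have h1 : (2^-1 : R) < 1 by rewrite invf_lt1// ltr1n.
have e0 : 0 < e by rewrite lt_min e'0.
have e1 : e < 1 by rewrite gt_min h1 orbT.
have ee' : e <= e' by rewrite ge_min lexx.
have [M upper] := ln_area_tail_upper e0 e1.
have [t0 t01 tail] := tail_two_sided tailg.
have e20 : 0 < e / 2 by rewrite divr_gt0.
near=> x.
have up : 0 < PAtau_gt X x -> (1 - e) * (g (Num.sqrt (2 * a * x)) + 2 * ln (Num.sqrt (2 * a * x))) +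
     Num.min (ln (Num.sqrt (2 * a * x)) / 2) (e * ln (Num.sqrt (2 * a * x))) - M <=
     - ln (PAtau_gt X x) by near: x.
have [P0 low] : 0 < PAtau_gt X x /\ - ln (PAtau_gt X x) <=
    (1 + e / 2) * g (Num.sqrt (2 * a * x)) + 2 * ln (Num.sqrt (2 * a * x)) + (2 * (e / 2) + ln 4).
  by near: x; exact: ln_area_tail_lower.
move: up low; set y := Num.sqrt (2 * a * x) => /(_ P0) up low.
have yt0 : t0 <= y by rewrite /y; near: x; apply: sqrt_near; rewrite mulr_gt0.
have y0 : 0 < y by apply: lt_le_trans yt0; exact: lt_le_trans t01.
pose B := 2 + `|M| + ln 2 + (e + ln 4 + 2 * ln 2) / e.
have lB : 2 * B + B / e <= ln y by rewrite /y; near: x; apply: ln_near; rewrite mulr_gt0.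
have /tail/andP[F1 F2] := yt0.
have u0 : 0 < expR (- g y) * y ^- 2 by rewrite mulr_gt0 ?expR_gt0// invr_gt0 exprn_gt0.
have F0 : 0 < Fbar X y by apply: lt_le_trans F1; rewrite divr_gt0.
have gy0 : 0 <= g y by exact: (g_ge0 gdec glim).
have f2 : ln (Fbar X y) <= ln 2 - g y - 2 * ln y.
  by rewrite -ln_tail_term// ler_ln ?posrE// mulr_gt0.
have f1 : - ln 2 - g y - 2 * ln y <= ln (Fbar X y).
  have : ln (2^-1 * (expR (- g y) * y ^- 2)) <= ln (Fbar X y).
    by rewrite ler_ln ?posrE//; [rewrite [leLHS]mulrC|exact: mulr_gt0].
  by rewrite ln_tail_term// lnV ?posrE.
have ln20 : 0 <= ln 2 :> R by rewrite ln_ge0// ler1n.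
have ln40 : 0 <= ln 4 :> R by rewrite ln_ge0// ler1n.
apply: le_trans ee'.
exact: (log_ratio_arith e0 e1 gy0 ln20 ln40 lB f2 f1 up low).
Unshelve. all: by end_near. Qed.

End LogarithmicRatio.

Theorem theorem1 (d : measure_display) (T : measurableType d) (R : realType)
  (P : probability T R) (X : nat -> {RV P >-> R}) (a : R) (g : R -> R) :
  iid X ->
  0 < a ->
  P.-integrable setT (EFin \o X 0%N) ->
  ('E_P[X 0%N] = (- a)%:E)%E ->
  (X 0%N : T -> R) \in Lfun P 2%:E ->
  (* Fbar(x) ~ e^{-g(x)} x^{-2} *)
  (fun x => Fbar X x / (expR (- g x) * x ^- 2)) @ +oo --> (1:R) ->
  (* g continuously differentiable on (0, oo) *)
  (forall x, 0 < x -> derivable g x 1) ->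
  {in `]0, +oo[, continuous (derive1 g)} ->
  (* g nondecreasing for all sufficiently large x *)
  (exists x0, forall x y, x0 <= x -> x <= y -> g x <= g y) ->
  (* g(x)/x nonincreasing on (0, oo), tending to 0 *)
  (forall x y, 0 < x -> x <= y -> g y / y <= g x / x) ->
  (fun x => g x / x) @ +oo --> (0:R) ->
  [/\
   (* (i) *)
   (exists C, 0 < C /\
      \forall x \near +oo,
        PAtau_gt X x <=
          C * x `^ (4^-1) *
          expR (- (g (Num.sqrt (2 * a * x)) *
                   Num.sqrt (1 - 2 * C * g (Num.sqrt (2 * a * x))
                                   / (a * Num.sqrt (2 * a * x)))))),
   (* (ii) : liminf_{x -> oo} ratio >= E tau *)
   (forall eps, 0 < eps -> exists C, 0 < C /\
      forall c : R, (c%:E < Etau X)%E ->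
        \forall x \near +oo,
          c <= PAtau_gt X x / Fbar X (Num.sqrt (2 * a * x) + C * x `^ (4^-1 + eps)))
   &
   (* (iii) *)
   ((exists gamma0, 0 < gamma0 < 1 /\
       (forall x y, 0 < x -> x <= y -> g y / y `^ gamma0 <= g x / x `^ gamma0) /\
       (fun x => g x / x `^ gamma0) @ +oo --> (0:R)) ->
    (fun x => ln (PAtau_gt X x) / ln (Fbar X (Num.sqrt (2 * a * x)))) @ +oo --> (1:R))].
Proof.
move=> iX a0 intX EX L2 tailg _ _ _ gdec glim.
have X2 := Lfun2_integrable_sqr L2.
split.
- exact: (area_tail_upper iX a0 intX EX X2 tailg gdec glim).
(* The constant 2 is the two margins of [jump_area], for fluctuation and for positivity; it depends
   neither on [eps] nor on [c]. *)
- move=> eps eps0; exists 2; split=> // c /Etau_gt[K cK].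
  exact: (area_tail_lower iX a0 intX EX X2 tailg gdec glim eps0 cK).
- by move=> _; exact: (ln_area_tail_ratio iX a0 intX EX X2 tailg gdec glim).
Qed.
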